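(* Let $\alpha \in \mathbb{R}$ and $p,q \in (0, \infty]$. Suppose that $A, B \in \mathrm{GL}(d, \mathbb{R})$ are expansive matrices that are equivalent and satisfy $|\det(A)|>|\det(B)|$. Let $\varepsilon = \ln |\det(A)| /\ln |\det(B)|$. Then, for each $j\in \mathbb{Z}$, there exists an injection $\pi_j: \mathbb{Z}^d \to \mathbb{Z}^d$ such that the induced operators $S$ and $T$ on $\mathbb{C}^{\mathbb{Z} \times \mathbb{Z}^d}$, defined by \[ S\big( (c_{j,k})_{j\in \mathbb{Z}, k\in \mathbb{Z}^d}\big) = (s_{i,k})_{i\in \mathbb{Z}, k\in \mathbb{Z}^d}, \qquad s_{i,k} = \begin{cases} c_{j ,\pi_j ^{-1}(k)} & \text{if } i=\lfloor j \varepsilon \rfloor \text{ for some } j\in\mathbb{Z} \text{ and } k\in \pi_j(\mathbb{Z}^d),\\ 0 & \text{otherwise}, \end{cases} \] \[ T\big( (s_{i,k})_{i\in \mathbb{Z}, k\in \mathbb{Z}^d}\big) = (c_{j,k})_{j\in \mathbb{Z}, k\in \mathbb{Z}^d}, \qquad c_{j,k} = s_{\lfloor j \varepsilon \rfloor,\pi_j(k)}, \quad j \in \mathbb{Z},\ k\in \mathbb{Z}^d, \] satisfy: (1) $S: \dot{\mathbf f}^\alpha_{p,q}(A) \hookrightarrow \dot{\mathbf f}^\alpha_{p,q}(B)$ is a bounded embedding; (2) $T: \dot{\mathbf f}^\alpha_{p,q}(B) \to \dot{\mathbf f}^\alpha_{p,q}(A)$ is bounded and surjective; (3) $T \circ S$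 is the identity.
   Context: A matrix $A \in \mathrm{GL}(d,\mathbb{R})$ is expansive if all its eigenvalues $\lambda$ satisfy $|\lambda|>1$. A homogeneous quasi-norm associated with an expansive matrix $A$ is a Borel measurable function $\rho_A:\mathbb{R}^d\to[0,\infty)$ such that (i) $\rho_A(x)>0$ for $x\neq 0$; (ii) $\rho_A(Ax)=|\det(A)|\rho_A(x)$ for all $x\in\mathbb{R}^d$; (iii) there is $c>0$ with $\rho_A(x+y)\le c(\rho_A(x)+\rho_A(y))$ for all $x,y\in\mathbb{R}^d$. Any two homogeneous quasi-norms associated with the same $A$ are equivalent (each is bounded by a constant multiple of the other). Two expansive matrices $A$ and $B$ are called equivalent if associated homogeneous quasi-norms $\rho_A$ and $\rho_B$ are equivalent, i.e. there is $C\ge 1$ with $C^{-1}\rho_A(x)\le\rho_B(x)\le C\rho_A(x)$ for all $x\in\mathbb{R}^d$. For an expansive matrix $A$, $\alpha\in\mathbb{R}$ and $p,q\in(0,\infty]$, the anisotropic Triebel-Lizorkin sequence space $\dot{\mathbf f}^\alpha_{p,q}(A)$ is the space of all $c=(c_{j,k})\in\mathbb{C}^{\mathbb{Z}\times\mathbb{Z}^d}$ with $\|c\|_{\dot{\mathbf f}^\alpha_{p,q}(A)}<\infty$, where the quasi-norm (with values in $[0,\infty]$) is defined as follows. For $p<\infty$, \[ \|c\|_{\dot{\mathbf f}^\alpha_{p,q}(A)}:=\bigg\|\bigg(\sum_{j\in\mathbb{Z}}\sum_{k\in\mathbb{Z}^d}\big(|\det(A)|^{-j(\alpha+1/2)}|c_{j,k}|\mathbf{1}_{A^j([0,1]^d+k)}\big)^q\bigg)^{1/q}\bigg\|_{L^p(\mathbb{R}^d)},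 \] with the usual modification (supremum over $(j,k)$) for $q=\infty$. For $p=\infty$, $q<\infty$, \[ \|c\|_{\dot{\mathbf f}^\alpha_{\infty,q}(A)}:=\sup_{P\in\mathcal{Q}}\bigg(\frac1{|P|}\int_P\sum_{j\in\mathbb{Z},\,j\le \operatorname{scale}(P)}\sum_{k\in\mathbb{Z}^d}\big(|\det(A)|^{-j(\alpha+1/2)}|c_{j,k}|\mathbf{1}_{A^j([0,1]^d+k)}(x)\big)^q\,dx\bigg)^{1/q}, \] where $\mathcal{Q}=\{A^j([0,1]^d+k):j\in\mathbb{Z},k\in\mathbb{Z}^d\}$ and $\operatorname{scale}(A^j([0,1]^d+k))=j$. For $p=q=\infty$, $\|c\|_{\dot{\mathbf f}^\alpha_{\infty,\infty}(A)}:=\sup_{j\in\mathbb{Z},k\in\mathbb{Z}^d}|\det(A)|^{-j(\alpha+1/2)}|c_{j,k}|$. Since $\varepsilon>1$, the map $j\mapsto\lfloor j\varepsilon\rfloor$ is injective on $\mathbb{Z}$, so the $j$ in the definition of $s_{i,k}$ is unique when it exists. A bounded embedding of quasi-normed spaces means a bounded linear map $S$ for which there is also a constant $C>0$ with $\|c\|\le C\|Sc\|$ for all $c$ in the domain. *)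

(* Defs.v *)
From HB Require Import structures.
From mathcomp Require Import all_boot all_order all_algebra.
From mathcomp Require Import complex.
From mathcomp Require Import all_classical all_reals all_analysis.
From mathcomp Require Import measurable_realfun.

Set Implicit Arguments.
Unset Strict Implicit.
Unset Printing Implicit Defensive.

Import Order.TTheory GRing.Theory Num.Theory.
Import numFieldNormedType.Exports.

Local Open Scope classical_set_scope.
Local Open Scope ring_scope.

(** Borel sigma-algebra of matrix spaces, in particular of R^n = 'cV[R]_n. *)

Fact mx_borel_display : measure_display. Proof. exact: default_measure_display. Qed.

Section borel_mx.
Variables (R : realType) (m n : nat).

HB.instance Definition _ := @isMeasurable.Build mx_borel_display 'M[R]_(m, n)
  <<s @open 'M[R]_(m, n) >>
  (@sigma_algebra0 _ setT _) (@sigma_algebraC _ _) (@sigma_algebra_bigcup _ setT _).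

Lemma measurable_mxE :
  @measurable mx_borel_display 'M[R]_(m, n) = <<s @open 'M[R]_(m, n) >>.
Proof. by []. Qed.

Lemma open_measurable_mx (U : set 'M[R]_(m, n)) : open U -> measurable U.
Proof. by move=> oU; rewrite measurable_mxE; exact: sub_sigma_algebra. Qed.

End borel_mx.

(** Lebesgue measure on 'cV[R]_n, by recursion on n: the image of the product
    of the Lebesgue measures of R and 'cV[R]_n under (x, v) |-> col_mx x v. *)

Section cons_cV.
Variables (R : realType) (n : nat).

Definition cons_cV (xv : measurableTypeR R * 'cV[R]_n) : 'cV[R]_(1 + n) :=
  col_mx (xv.1 : R)%:M xv.2.

Definition uncons_cV (v : 'cV[R]_(1 + n)) : measurableTypeR R * 'cV[R]_n :=
  (v ord0 ord0, dsubmx v).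

Lemma cons_cVK : cancel cons_cV uncons_cV.
Proof.
move=> [x v]; rewrite /cons_cV /uncons_cV /= col_mxKd; congr pair.
by rewrite mxE; case: splitP => // j _; rewrite mxE [j]ord1 eqxx.
Qed.

Lemma measurable_cons_cV : measurable_fun setT cons_cV.
Proof.
apply: (measurability _ (measurable_mxE R (1 + n) 1)) => _ [U oU <-].
rewrite setTI.
pose Bq (p : 'cV[rat]_(1 + n) * nat) : set 'cV[R]_(1 + n) :=
  ball (map_mx ratr p.1 : 'cV[R]_(1 + n)) (p.2.+1%:R^-1).
have -> : U = \bigcup_(p in [set p | Bq p `<=` U]) Bq p.
  apply/seteqP; split => [x Ux|x [p pU]]; last exact: pU.
  have /nbhs_ballP[e /= e0 eU] : nbhs x U by apply: open_nbhs_nbhs.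
  have [k ke] : exists k, k.+1%:R^-1 < e / 2.
    have [k _ kP] := near_infty_natSinv_lt (PosNum (divr_gt0 e0 (@ltr0n R 2))).
    by exists k; exact: (kP k (leqnn k)).
  have dn (i : 'I_(1 + n)) : exists q : rat,
      ball (x i ord0) (k.+1%:R^-1) (ratr q : R).
    have /rat_in_itvoo[q qI] : x i ord0 < x i ord0 + k.+1%:R^-1.
      by rewrite ltrDl.
    exists q; move: qI; rewrite in_itv /= => /andP[q1 q2].
    by rewrite /ball /= distrC ltr_distl q2 andbT (lt_trans _ q1)// gtrBl.
  have [q qP] := boolp.choice dn.
  exists (\col_i q i, k); last first.
    split; first by rewrite /= invr_gt0.
    by move=> i j; rewrite !mxE ord1; apply: ball_sym; exact: qP.
  move=> y [_ yB]; apply: eU; split => // i j.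
  rewrite (splitr e); apply: (@ball_triangle _ _ (ratr (q i) : R)).
    by apply: (le_ball (ltW ke)); rewrite ord1; exact: qP.
  by have := yB i j; rewrite !mxE; exact: (le_ball (ltW ke)).
rewrite preimage_bigcup bigcup_mkcond; apply: countable_bigcupT_measurable => // p.
case: ifPn => // _.
have -> : cons_cV @^-1` Bq p =
    ball (ratr (p.1 ord0 ord0) : R) (p.2.+1%:R^-1) `*`
    ball (map_mx ratr (dsubmx p.1) : 'cV[R]_n) (p.2.+1%:R^-1).
  apply/seteqP; split => -[x v]; rewrite /Bq /cons_cV /=.
    move=> [e0 xB]; split; last first.
      split => // i j; have := xB (rshift 1 i) j.
      by rewrite col_mxEd !mxE.
    have := xB (lshift n ord0) ord0; rewrite col_mxEu !mxE eqxx mulr1n.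
    by rewrite (_ : lshift n ord0 = ord0)//; exact: val_inj.
  move=> [/= xB [e0 vB]]; split => // i j; rewrite !ord1 -(splitK i).
  case: (fintype.split i) => k /=.
    rewrite !ord1 col_mxEu !mxE eqxx mulr1n.
    by rewrite (_ : lshift n 0 = ord0)//; exact: val_inj.
  by rewrite col_mxEd; have := vB k ord0; rewrite !mxE.
apply: measurableX; first exact: measurable_ball.
by apply: open_measurable_mx; exact: ball_open.
Qed.

Lemma measurable_uncons_cV : measurable_fun setT uncons_cV.
Proof.
apply: measurable_fun_pair => /=.
- apply: (measurability _ (RGenOpens.measurableE R)) => _ [_ [a [b ->] <-]].
  rewrite setTI; apply: open_measurable_mx.
  have /continuousP := @coord_continuous R (1 + n) 1 ord0 ord0.
  by apply; exact: interval_open.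
- apply: (measurability _ (measurable_mxE R n 1)) => _ [U oU <-].
  rewrite setTI; apply: open_measurable_mx.
  suff /continuousP : continuous (@dsubmx R 1 n 1) by exact.
  move=> v P /nbhs_ballP[e /= e0 eP]; apply/nbhs_ballP; exists e => //= w [_ vw].
  by apply: eP; split => // i j; rewrite !mxE; exact: vw.
Qed.

Definition lebesgue_cons
    (mu : {sigma_finite_measure set 'cV[R]_n -> \bar R}) :
    set 'cV[R]_(1 + n) -> \bar R :=
  pushforward (lebesgue_measure \x mu)%E cons_cV.

Section lebesgue_cons_measure.
Variable mu : {sigma_finite_measure set 'cV[R]_n -> \bar R}.

Let lebesgue_cons0 : lebesgue_cons mu set0 = 0%E.
Proof. by rewrite /lebesgue_cons /pushforward preimage_set0 measure0. Qed.

Let lebesgue_cons_ge0 A : (0 <= lebesgue_cons mu A)%E.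
Proof. by rewrite /lebesgue_cons /pushforward; exact: measure_ge0. Qed.

Let lebesgue_cons_sigma_additive : semi_sigma_additive (lebesgue_cons mu).
Proof.
move=> F mF tF _; rewrite /lebesgue_cons /pushforward preimage_bigcup.
have mcF k : measurable (cons_cV @^-1` F k).
  by rewrite -[X in measurable X]setTI; exact: measurable_cons_cV.
apply: measure_semi_sigma_additive => //; last exact: bigcupT_measurable.
apply/trivIsetP => i j _ _ ij; rewrite -preimage_setI.
by move/trivIsetP : tF => ->//; rewrite preimage_set0.
Qed.

HB.instance Definition _ := isMeasure.Build _ _ _ (lebesgue_cons mu)
  lebesgue_cons0 lebesgue_cons_ge0 lebesgue_cons_sigma_additive.

Lemma lebesgue_consX (A : set R) (B : set 'cV[R]_n) :
  measurable A -> measurable B ->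
  lebesgue_cons mu (uncons_cV @^-1` (A `*` B)) = (lebesgue_measure A * mu B)%E.
Proof.
move=> mA mB; rewrite /lebesgue_cons /pushforward -comp_preimage.
rewrite (_ : uncons_cV \o cons_cV = id) ?preimage_id ?product_measure1E//.
by apply/funext => xv; exact: cons_cVK.
Qed.

Let lebesgue_cons_sigma_finite : sigma_finite setT (lebesgue_cons mu).
Proof.
have /sigma_finiteP[F [TF ndF Foo]] :=
  sigma_finiteT (lebesgue_measure : {sigma_finite_measure set (measurableTypeR R) -> \bar R}).
have /sigma_finiteP[G [TG ndG Goo]] := sigma_finiteT mu.
exists (fun k => uncons_cV @^-1` (F k `*` G k)).
  rewrite -preimage_bigcup -[LHS](@preimage_setT _ _ uncons_cV); congr preimage.
  rewrite -setXTT TF TG; apply/seteqP; split => [[x y]|[x y] [k _ []]]; last first.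
    by move=> Fkx Gky; split; exists k.
  move=> [/= [k _ Fkx] [l _ Gly]]; exists (maxn k l) => //; split => /=.
    by move: Fkx; exact/subsetPset/ndF/leq_maxl.
  by move: Gly; exact/subsetPset/ndG/leq_maxr.
move=> k; have [mF Fk] := Foo k; have [mG Gk] := Goo k; split.
  rewrite -[X in measurable X]setTI; apply: measurable_uncons_cV => //.
  exact: measurableX.
by rewrite lebesgue_consX// lte_mul_pinfty// ge0_fin_numE.
Qed.

HB.instance Definition _ := Measure_isSigmaFinite.Build _ _ _
  (lebesgue_cons mu) lebesgue_cons_sigma_finite.

End lebesgue_cons_measure.
End cons_cV.

Fixpoint lebesgue_cV (R : realType) (n : nat) :
    {sigma_finite_measure set 'cV[R]_n -> \bar R} :=
  match n with
  | 0 => \d_(0 : 'cV[R]_0)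
  | n'.+1 => lebesgue_cons (lebesgue_cV R n')
  end.

Lemma lebesgue_cV_box (R : realType) (n : nat) (a b : 'cV[R]_n) :
  (forall i, a i ord0 <= b i ord0) ->
  lebesgue_cV R n [set x : 'cV[R]_n | forall i, a i ord0 <= x i ord0 <= b i ord0] =
  (\prod_i (b i ord0 - a i ord0))%:E.
Proof.
move: a b; suff h : forall a b : 'cV[R]_n, (forall i, a i ord0 <= b i ord0) ->
    measurable [set x : 'cV[R]_n | forall i, a i ord0 <= x i ord0 <= b i ord0] /\
    lebesgue_cV R n [set x : 'cV[R]_n | forall i, a i ord0 <= x i ord0 <= b i ord0] =
    (\prod_i (b i ord0 - a i ord0))%:E.
  by move=> a b /h[].
elim: n => [|n IHn] a b ab.
  rewrite big_ord0 (_ : [set x | _] = setT); last first.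
    by apply/seteqP; split => x // _ [].
  split; first exact: measurableT.
  by rewrite /= diracE mem_set.
have [|mB lB] := IHn (dsubmx (a : 'cV_(1 + n))) (dsubmx (b : 'cV_(1 + n))).
  by move=> i; rewrite !mxE.
rewrite (_ : [set x | _] = @uncons_cV R n @^-1` (`[a ord0 ord0, b ord0 ord0] `*`
    [set x : 'cV[R]_n | forall i, dsubmx (a : 'cV_(1 + n)) i ord0 <= x i ord0 <=
                       dsubmx (b : 'cV_(1 + n)) i ord0])); last first.
  apply/seteqP; split => [x xab|x [/=]]; rewrite ?in_itv/=.
    by split => [|i] /=; rewrite ?in_itv/= ?mxE; exact: xab.
  move=> x0 xS i; case: (unliftP ord0 i) => [j ->|->//].
  have := xS j; rewrite !mxE.
  by rewrite (_ : rshift 1 j = lift ord0 j)//; exact: val_inj.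
split.
  rewrite -[X in measurable X]setTI; apply: measurable_uncons_cV => //.
  exact: measurableX.
rewrite /= lebesgue_consX// lB lebesgue_measure_itv/= big_ord_recl EFinM.
congr (_ * _)%E.
  rewrite lte_fin; case: ltgtP (ab ord0) => // -> _.
  by rewrite subrr.
congr EFin; apply: eq_bigr => i _; rewrite !mxE.
by rewrite (_ : rshift 1 i = lift ord0 i)//; exact: val_inj.
Qed.

(** The ambient dimension is d.+1 >= 1, so that the integer powers A ^ j are those of the unit ring of
    square matrices. *)

Section expansive.
Variables (R : realType) (d : nat).
Implicit Types (A B : 'M[R]_d.+1) (rho : 'cV[R]_d.+1 -> R).

Definition expansive A : Prop :=
  A \in unitmx /\
  forall l : R[i], eigenvalue (map_mx (real_complex R) A) l -> 1 < `|l|.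

Definition homogeneous_quasi_norm A rho : Prop :=
  [/\ measurable_fun [set: 'cV[R]_d.+1] rho,
      forall x, 0 <= rho x,
      forall x, x != 0 -> 0 < rho x,
      forall x, rho (A *m x) = `|\det A| * rho x &
      exists2 c : R, 0 < c & forall x y, rho (x + y) <= c * (rho x + rho y)].

Definition equivalent_quasi_norms rho rho' : Prop :=
  exists2 C : R, 1 <= C & forall x, C^-1 * rho x <= rho' x <= C * rho x.

(* All quasi-norms associated with one expansive matrix are equivalent to each
   other, so the choice of rhoA and rhoB is immaterial. *)
Definition equivalent_mx A B : Prop :=
  exists rhoA rhoB,
    [/\ homogeneous_quasi_norm A rhoA, homogeneous_quasi_norm B rhoB &
        equivalent_quasi_norms rhoA rhoB].

End expansive.

(** The values of a sequence are in R[i]^o so that sequences form a module over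
    the scalars R[i]. *)

Definition cseq (R : realType) (d : nat) := int -> 'cV[int]_d.+1 -> R[i]^o.

Section triebel_lizorkin.
Variables (R : realType) (d : nat).
Implicit Types (A : 'M[R]_d.+1) (alpha : R) (p q : \bar R) (c : cseq R d).
Implicit Types (j : int) (k : 'cV[int]_d.+1) (x : 'cV[R]_d.+1).

Local Notation mu := (lebesgue_cV R d.+1).

Definition unit_cube : set 'cV[R]_d.+1 :=
  [set x | forall i, 0 <= x i ord0 <= 1].

(* A^j ([0, 1]^d + k) *)
Definition dilated_cube A j k : set 'cV[R]_d.+1 :=
  [set A ^ j *m (x + map_mx intr k) | x in unit_cube].

Definition tl_coef A alpha c j k : R :=
  `|\det A| `^ (- (j%:~R * (alpha + 2^-1))) * Normc.normc (c j k : R[i]).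

Definition tl_term A alpha c j k x : R :=
  tl_coef A alpha c j k * \1_(dilated_cube A j k) x.

Local Open Scope ereal_scope.

Definition tl_sum A alpha (q : R) c (J : set int) x : \bar R :=
  \esum_(j in J) \esum_(k in [set: 'cV[int]_d.+1])
    ((tl_term A alpha c j k x) `^ q)%:E.

Definition tl_fun A alpha q c x : \bar R :=
  if q is r%:E then tl_sum A alpha r c [set: int] x `^ r^-1
  else ereal_sup [set (tl_term A alpha c jk.1 jk.2 x)%:E
                 | jk in [set: int * 'cV[int]_d.+1]].

(* Meant for p, q in ]0, +oo].  For p = +oo > q, the supremum over the cubes
   P of scale l is indexed by the pairs (l, m) with P = dilated_cube A l m. *)
Definition tl_norm A alpha p q c : \bar R :=
  match p, q with
  | _%:E, _ => 'N[mu]_p[tl_fun A alpha q c]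
  | _, r%:E => ereal_sup
      [set ((mu (dilated_cube A lm.1 lm.2))^-1 *
            \int[mu]_(x in dilated_cube A lm.1 lm.2)
               tl_sum A alpha r c [set j | (j <= lm.1)%R] x) `^ r^-1
      | lm in [set: int * 'cV[int]_d.+1]]
  | _, _ => ereal_sup [set (tl_coef A alpha c jk.1 jk.2)%:E
                      | jk in [set: int * 'cV[int]_d.+1]]
  end.

Definition tl_space A alpha p q : set (cseq R d) :=
  [set c | tl_norm A alpha p q c < +oo].

End triebel_lizorkin.

Section bounded_operators.
Variables (R : realType) (d : nat).
Implicit Types (X Y : set (cseq R d)) (NX NY : cseq R d -> \bar R).
Implicit Type F : cseq R d -> cseq R d.

Local Open Scope ereal_scope.

Definition bounded_operator X NX Y NY F : Prop :=
  [/\ linear F, {homo F : c / X c >-> Y c} &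
      exists2 C : R, (0 < C)%R & forall c, X c -> NY (F c) <= C%:E * NX c].

Definition bounded_embedding X NX Y NY F : Prop :=
  bounded_operator X NX Y NY F /\
  exists2 C : R, (0 < C)%R & forall c, X c -> NX c <= C%:E * NY (F c).

End bounded_operators.

Section induced_operators.
Variables (R : realType) (d : nat) (eps : R).
Variable pi : int -> 'cV[int]_d.+1 -> 'cV[int]_d.+1.

Definition floor_scale (j : int) : int := Num.floor (j%:~R * eps).

(* When eps > 1 and the pi_j are injective, S_source i k has at most one
   element, namely (j, pi_j^-1 (k)) with i = floor (j eps). *)
Definition S_source (i : int) (k : 'cV[int]_d.+1) : set (int * 'cV[int]_d.+1) :=
  [set jm | i = floor_scale jm.1 /\ k = pi jm.1 jm.2].

Definition operator_S (c : cseq R d) : cseq R d := fun i k =>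
  if pselect (S_source i k !=set0) is left ex
  then c (projT1 (cid ex)).1 (projT1 (cid ex)).2 else 0.

Definition operator_T (s : cseq R d) : cseq R d := fun j k =>
  s (floor_scale j) (pi j k).

End induced_operators.

(* Main.v *)
Require Import Defs.
From HB Require Import structures.
From mathcomp Require Import all_boot all_order all_algebra.
From mathcomp Require Import perm complex.
From mathcomp Require Import all_classical all_reals all_analysis.
From mathcomp Require Import measurable_realfun ring lra zify.

Set Implicit Arguments.
Unset Strict Implicit.
Unset Printing Implicit Defensive.

Import Order.TTheory GRing.Theory Num.Theory.
Import numFieldNormedType.Exports.

Local Open Scope classical_set_scope.
Local Open Scope ring_scope.

(** Let M j = A^-j B^i with i = floor (j eps).  The theorem rests on the fact that the scales j
    of A and i of B describe the same cubes up to bounded distortion: the entries of M j and of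
    its inverse are bounded uniformly in j, and |det (M j)| lies between 1 / |det B| and 1.
    The determinants come from the choice of eps.  The entries come from the equivalence of the
    quasi-norms, which makes M j a bounded operator for rho_A, with a bound independent of j,
    and from the fact that a quasi-norm of an expansive matrix has bounded sublevel sets
    (quasi_norm_sublevel_bounded, matched_scale_bounded).  Quasi-norms are only assumed to be
    measurable, and their boundedness near 0 is obtained by Steinhaus' argument
    (quasi_subadditive_bounded).

    A matrix M with bounded entries and |det M| between a positive constant and 1 admits an
    injection pi of the integer lattice into itself with M (pi k) - k bounded
    (lattice_approx_bounded): M is a bounded product of shears and of a diagonal matrix whose
    only non-trivial entry is det M, a shear is within bounded distance of a bijection of the
    lattice, and division by a number of modulus at most 1 remains injective after rounding.
    Applied to M j this yields pi_j.  Then the cube of B of scale i and position pi_j k and the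
    cube of A of scale j and position k both lie in one box, whose measure is comparable to
    theirs, and the boxes W obtained in this way have the engulfing property of Vitali's
    covering lemma, because the negative powers of A are bounded (matched_engulfing).

    The operators S and T only transport coefficients between matched cubes, and the factors
    |det A|^j and |det B|^i are comparable.  So for finite p what is needed is that the norm in
    L^p(l^q) of a family of multiples of indicators changes at most by a constant factor when
    the sets U of the family are replaced by sets V, if U and V lie in common boxes W as above
    (Lnorm_lq_bound).  With u = p / q this compares the L^u norms of G = sum b_i 1_V and
    F = sum b_i 1_U.  By quadrature and monotone convergence it suffices to treat finitely many
    sets on a finite weighted set of points (finite_quadrature, integral_sup_power_le), where
    the maximal operator over the sets W is bounded in L^u for u > 1 by Doob's argument
    (maximal_doob).  For u > 1 the comparison of F and G follows by duality, for u = 1 it is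
    trivial, and for u < 1 it follows from a weighted duality with the maximal function of a
    small power of F (sum_over_lt1).  The case of suprema, q = +oo, bounds a power of
    sup b_i 1_V by the maximal function of the same power of sup b_i 1_U (max_over_le).

    For p = +oo and finite q, the norm is a supremum of averages over cubes P, that is of sums of
    b_i mu (U_i & P).  A cube of one matrix is covered by boundedly many cubes of the other one
    of the matched scale, even after enlarging all sets to the boxes W, so the averages over P
    are bounded by averages for the other matrix (local_mass_change_frame).  For p = q = +oo the
    coefficients are compared one by one.

    These bounds and T (S c) = c give the theorem. *)

(** * Entrywise bounds on matrices *)

Definition entries_le (R : numDomainType) m n (K : R) (M : 'M[R]_(m, n)) :=
  forall i j, `|M i j| <= K.

Section entry_bounds.
Variable R : numDomainType.
Implicit Types (m n p : nat) (K L : R).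

Lemma le_entries m n K L (M : 'M[R]_(m, n)) :
  K <= L -> entries_le K M -> entries_le L M.
Proof. by move=> KL MK i j; exact: le_trans (MK i j) KL. Qed.

Lemma entries_leD m n K L (M N : 'M[R]_(m, n)) :
  entries_le K M -> entries_le L N -> entries_le (K + L) (M + N).
Proof.
by move=> MK NL i j; rewrite mxE (le_trans (ler_normD _ _)) ?lerD.
Qed.

Lemma entries_leN m n K (M : 'M[R]_(m, n)) : entries_le K M -> entries_le K (- M).
Proof. by move=> MK i j; rewrite mxE normrN. Qed.

Lemma entries_leB m n K L (M N : 'M[R]_(m, n)) :
  entries_le K M -> entries_le L N -> entries_le (K + L) (M - N).
Proof. by move=> MK /entries_leN; exact: entries_leD. Qed.

Lemma entries_leM m n p K L (M : 'M[R]_(m, n)) (N : 'M[R]_(n, p)) :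
  entries_le K M -> entries_le L N -> entries_le (n%:R * (K * L)) (M *m N).
Proof.
move=> MK NL i j; rewrite mxE (le_trans (ler_norm_sum _ _ _))//.
apply: (@le_trans _ _ (\sum_(k < n) (K * L))); last first.
  by rewrite sumr_const card_ord mulr_natl.
by apply: ler_sum => k _; rewrite normrM ler_pM.
Qed.

Lemma entries_le1 n : entries_le 1 (1%:M : 'M[R]_n).
Proof. by move=> i j; rewrite mxE; case: eqP => _; rewrite ?normr1 ?normr0 ?ler01. Qed.

Lemma entries_le0 m n K : 0 <= K -> entries_le K (0 : 'M[R]_(m, n)).
Proof. by move=> K0 i j; rewrite mxE normr0. Qed.

Lemma entries_le_block m1 m2 n1 n2 K (a : 'M[R]_(m1, n1)) (b : 'M[R]_(m1, n2))
    (c : 'M[R]_(m2, n1)) (e : 'M[R]_(m2, n2)) :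
  entries_le K a -> entries_le K b -> entries_le K c -> entries_le K e ->
  entries_le K (block_mx a b c e).
Proof.
move=> aK bK cK eK i j; rewrite -(splitK i) -(splitK j).
by case: (fintype.split i) => i'; case: (fintype.split j) => j' /=;
  rewrite ?block_mxEul ?block_mxEur ?block_mxEdl ?block_mxEdr.
Qed.

Lemma entries_le_subblock m1 m2 n1 n2 K (M : 'M[R]_(m1 + m2, n1 + n2)) :
  entries_le K M -> [/\ entries_le K (ulsubmx M), entries_le K (ursubmx M),
    entries_le K (dlsubmx M) & entries_le K (drsubmx M)].
Proof. by move=> MK; split=> i j; rewrite !mxE. Qed.

Lemma norm_det_le n K (M : 'M[R]_n) :
  entries_le K M -> `|\det M| <= n`!%:R * K ^+ n.
Proof.
move=> MK; rewrite /determinant (le_trans (ler_norm_sum _ _ _))//.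
apply: (@le_trans _ _ (\sum_(s : 'S_n) K ^+ n)); last first.
  by rewrite sumr_const card_Sn mulr_natl.
apply: ler_sum => s _; rewrite normrM normrX normrN1 expr1n mul1r normr_prod.
rewrite -[X in K ^+ X]card_ord -prodr_const; apply: ler_prod => i _.
by rewrite normr_ge0 MK.
Qed.

Lemma entries_bounded m n (M : 'M[R]_(m, n)) : exists2 K, 0 <= K & entries_le K M.
Proof.
exists (\sum_i \sum_j `|M i j|) => [|i j].
  by rewrite sumr_ge0// => i _; rewrite sumr_ge0.
rewrite (bigD1 i)//= (bigD1 j)//= -addrA lerDl addr_ge0 ?sumr_ge0// => k _.
by rewrite sumr_ge0.
Qed.

End entry_bounds.

(** * Injections of the integer lattice close to a linear map *)

Definition lattice_approx (R : realType) n (C : R) (M : 'M[R]_n) :=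
  exists2 pi : 'cV[int]_n -> 'cV[int]_n, injective pi &
    forall k, entries_le C (M *m map_mx intr (pi k) - map_mx intr k).

Section lattice_approx.
Variable R : realType.
Implicit Types (n : nat) (C K eta delta : R).

Lemma lattice_approx_le n C C' (M : 'M[R]_n) :
  C <= C' -> lattice_approx C M -> lattice_approx C' M.
Proof. by move=> CC' [pi ipi piC]; exists pi => // k; exact: le_entries (piC k). Qed.

Lemma lattice_approxM n C D K (M N : 'M[R]_n) : entries_le K M ->
  lattice_approx C M -> lattice_approx D N ->
  lattice_approx (n%:R * (K * D) + C) (M *m N).
Proof.
move=> MK [f fi fC] [g gi gD]; exists (g \o f); first exact: inj_comp.
move=> k; rewrite [X in entries_le _ X](_ : _ =
  M *m (N *m map_mx intr (g (f k)) - map_mx intr (f k)) +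
  (M *m map_mx intr (f k) - map_mx intr k)).
  by apply: entries_leD => //; exact: entries_leM.
by rewrite mulmxBr -mulmxA addrA subrK.
Qed.

(** N reads only the coordinates outside P and modifies only those in P, so that
    k - floor (N k) has the same image under N as k: the map k |-> k - floor (N k) can be
    undone by adding floor (N k) back, whence its injectivity. *)
Lemma lattice_approx_shear n (P : pred 'I_n) (N : 'M[R]_n) :
  (forall i j, N i j != 0 -> P i && ~~ P j) -> lattice_approx 1 (1%:M + N).
Proof.
move=> NP.
pose fl (x : 'cV[R]_n) : 'cV[int]_n := map_mx Num.floor x.
pose pi (k : 'cV[int]_n) := k - fl (N *m map_mx intr k).
have Npi k : N *m map_mx intr (pi k) = N *m map_mx intr k.
  apply/matrixP => i j; rewrite !mxE; apply: eq_bigr => l _; rewrite !mxE.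
  have [->|/NP/andP[_ Pl]] := eqVneq (N i l) 0; first by rewrite !mul0r.
  congr (_ * _%:~R); rewrite [X in _ - Num.floor X]big1 ?floor0 ?subr0// => h _.
  have [->|/NP/andP[]] := eqVneq (N l h) 0; first by rewrite mul0r.
  by rewrite (negPf Pl).
exists pi.
  move=> k l kl; have := congr1 (fun z => N *m map_mx intr z) kl.
  rewrite /= !Npi => Nkl.
  by move: kl; rewrite /pi Nkl => /addIr.
move=> k i j; rewrite mulmxDl mul1mx Npi /pi !mxE intrB.
set x := \sum_(_ < _) _.
rewrite [X in `|X|](_ : _ = x - (Num.floor x)%:~R); last by ring.
by have /andP[] := floor_itv x; rewrite intrD => *; rewrite ger0_norm; lra.
Qed.

Definition ushear n (u : 'rV[R]_n) : 'M[R]_(1 + n) := block_mx 1%:M u 0 1%:M.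
Definition lshear n (v : 'cV[R]_n) : 'M[R]_(1 + n) := block_mx 1%:M 0 v 1%:M.

Lemma lattice_approx_ushear n (u : 'rV[R]_n) : lattice_approx 1 (ushear u).
Proof.
have -> : ushear u = 1%:M + block_mx 0 u 0 0.
  by rewrite (@scalar_mx_block _ 1 n 1) add_block_mx !addr0 add0r.
apply: (@lattice_approx_shear _ (fun i => i == lshift n ord0)) => i j.
rewrite -(splitK i) -(splitK j).
case: (fintype.split i) => i'; case: (fintype.split j) => j' /=;
  rewrite ?block_mxEul ?block_mxEur ?block_mxEdl ?block_mxEdr ?mxE ?eqxx//.
by rewrite [i']ord1 eqxx.
Qed.

Lemma lattice_approx_lshear n (v : 'cV[R]_n) : lattice_approx 1 (lshear v).
Proof.
have -> : lshear v = 1%:M + block_mx 0 0 v 0.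
  by rewrite (@scalar_mx_block _ 1 n 1) add_block_mx !addr0 add0r.
apply: (@lattice_approx_shear _ (fun i => i != lshift n ord0)) => i j.
rewrite -(splitK i) -(splitK j).
case: (fintype.split i) => i'; case: (fintype.split j) => j' /=;
  rewrite ?block_mxEul ?block_mxEur ?block_mxEdl ?block_mxEdr ?mxE ?eqxx//.
by rewrite [j']ord1 eqxx.
Qed.

Lemma lattice_approx_block n C (D : 'M[R]_n) : 0 <= C ->
  lattice_approx C D -> lattice_approx C (block_mx (1%:M : 'M[R]_1) 0 0 D).
Proof.
move=> C0 [f fi fC].
exists (fun k : 'cV[int]_(1 + n) => col_mx (usubmx k) (f (dsubmx k))).
  by move=> k l /eq_col_mx[kl /fi kl']; rewrite -[k]vsubmxK kl kl' vsubmxK.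
move=> k; rewrite map_col_mx mul_block_col !mul0mx addr0 add0r mul1mx.
rewrite -[X in _ - map_mx _ X]vsubmxK map_col_mx opp_col_mx add_col_mx subrr.
move=> i j; rewrite -(splitK i); case: (fintype.split i) => i' /=.
  by rewrite col_mxEu mxE normr0.
by rewrite col_mxEd; exact: fC.
Qed.

(** Dividing by a spreads the integers at distances at least 1, and points at such distances
    have different integral parts. *)
Lemma lattice_approx_contraction (a : R) : 0 < `|a| <= 1 ->
  lattice_approx 1 (a%:M : 'M[R]_1).
Proof.
move=> /andP[a0 a1]; have an0 : a != 0 by rewrite -normr_gt0.
have aV : 1 <= `|a|^-1 by rewrite invf_ge1.
pose pi (k : 'cV[int]_1) : 'cV[int]_1 :=
  const_mx (Num.floor (a^-1 * (k ord0 ord0)%:~R)).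
have pi_floor (k : 'cV[int]_1) :
    0 <= a^-1 * (k ord0 ord0)%:~R - (pi k ord0 ord0)%:~R < 1.
  rewrite mxE; set x := a^-1 * _; have /andP[] := floor_itv x.
  by rewrite intrD => ? ?; apply/andP; split; lra.
exists pi.
  move=> k l kl; apply/matrixP => i j; rewrite !ord1.
  apply/eqP/negPn/negP => kln.
  have kl1 : 1 <= `|a^-1 * (k ord0 ord0)%:~R - a^-1 * (l ord0 ord0)%:~R|.
    rewrite -mulrBr -intrB normrM normfV -[leLHS]mulr1 ler_pM//.
    by rewrite -intr_norm ler1z -gtz0_ge1 normr_gt0 subr_eq0.
  have := pi_floor l; rewrite -kl; have := pi_floor k.
  move=> /andP[? ?] /andP[? ?]; suff : `|a^-1 * (k ord0 ord0)%:~R - a^-1 * (l ord0 ord0)%:~R| < 1 by lra.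
  by rewrite ltr_norml; apply/andP; split; lra.
move=> k i j; rewrite !ord1 mul_scalar_mx.
rewrite [X in `|X|](_ : _ = - (a * (a^-1 * (k ord0 ord0)%:~R - (pi k ord0 ord0)%:~R))).
  have /andP[x0 x1] := pi_floor k.
  by rewrite normrN normrM -[leRHS]mulr1 ler_pM// ger0_norm// ltW.
by rewrite !mxE mulrBr mulVKf//; ring.
Qed.

Lemma ushear_inv n (u : 'rV[R]_n) : ushear (- u) *m ushear u = 1%:M.
Proof.
rewrite /ushear mulmx_block !(mul1mx, mulmx1, mulmx0, mul0mx, addr0, add0r).
by rewrite subrr (@scalar_mx_block _ 1 n 1).
Qed.

Lemma lshear_inv n (u : 'cV[R]_n) : lshear (- u) *m lshear u = 1%:M.
Proof.
rewrite /lshear mulmx_block !(mul1mx, mulmx1, mulmx0, mul0mx, addr0, add0r).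
by rewrite addNr (@scalar_mx_block _ 1 n 1).
Qed.

Lemma det_ushear n (u : 'rV[R]_n) : \det (ushear u) = 1.
Proof. by rewrite det_ublock !det1 mulr1. Qed.

Lemma det_lshear n (u : 'cV[R]_n) : \det (lshear u) = 1.
Proof. by rewrite det_lblock !det1 mulr1. Qed.

Lemma entries_le_ushear n K (u : 'rV[R]_n) : 1 <= K ->
  entries_le K u -> entries_le K (ushear u).
Proof.
move=> K1 uK; apply: entries_le_block => //.
- exact: le_entries (@entries_le1 _ _).
- by apply: entries_le0; exact: le_trans K1.
- exact: le_entries (@entries_le1 _ _).
Qed.

Lemma entries_le_lshear n K (u : 'cV[R]_n) : 1 <= K ->
  entries_le K u -> entries_le K (lshear u).
Proof.
move=> K1 uK; apply: entries_le_block => //.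
- exact: le_entries (@entries_le1 _ _).
- by apply: entries_le0; exact: le_trans K1.
- exact: le_entries (@entries_le1 _ _).
Qed.

(** With a pivot equal to 1, M is a lower shear times diag (1, D) times an upper shear, D being
    the Schur complement of the pivot; this reduces M to D, of the same determinant. *)
Lemma lattice_approx_unit_pivot n K :
  exists K' : R, forall C, 0 <= C -> exists C' : R, forall M : 'M[R]_(1 + n),
    entries_le K M -> ulsubmx M = 1%:M ->
    (forall D : 'M[R]_n, entries_le K' D -> \det D = \det M -> lattice_approx C D) ->
  lattice_approx C' M.
Proof.
exists (K + 1%:R * (K * K)) => C C0.
pose K1 := Num.max 1 K.
exists ((1 + n)%:R * (K1 * ((1 + n)%:R * (Num.max 1 (K + 1%:R * (K * K)) * 1) + C)) + 1) => M MK M1 DC.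
have [_ bK cK eK] := entries_le_subblock MK.
set b := ursubmx M in bK; set c := dlsubmx M in cK.
set e := drsubmx M in eK.
have cbK : entries_le (K + 1%:R * (K * K)) (e - c *m b).
  by apply: entries_leB => //; exact: entries_leM.
pose D : 'M[R]_(1 + n) := block_mx (1%:M : 'M[R]_1) 0 0 (e - c *m b).
have ME : M = lshear c *m (D *m ushear b).
  rewrite -[M]submxK M1 -/b -/c -/e /lshear /D /ushear !mulmx_block.
  rewrite !(mul1mx, mulmx1, mulmx0, mul0mx, addr0, add0r).
  by rewrite addrC subrK.
rewrite ME; apply: lattice_approxM.
- by apply: entries_le_lshear; [rewrite le_max lexx|apply: le_entries cK; rewrite le_max lexx orbT].
- exact: lattice_approx_lshear.
- apply: lattice_approxM.
  + have K2 : 1 <= Num.max 1 (K + 1%:R * (K * K)) by rewrite le_max lexx.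
    apply: entries_le_block.
    * exact: le_entries (@entries_le1 _ _).
    * by apply: entries_le0; exact: le_trans K2.
    * by apply: entries_le0; exact: le_trans K2.
    * by apply: le_entries cbK; rewrite le_max lexx orbT.
  + apply: lattice_approx_block => //; apply: DC => //.
    by rewrite ME !det_mulmx det_lshear det_ushear mul1r mulr1 det_lblock det1 mul1r.
  + exact: lattice_approx_ushear.
Qed.

(** An entry c i of the rest of column 0 that is bounded below reduces to the case of a
    unit pivot: adding (1 - a) / c i times its row to the first row is a shear with bounded
    coefficients that turns the pivot a into 1. *)
Lemma lattice_approx_pivot n K eta : 0 < eta -> 0 <= K ->
  exists K' : R, forall C, 0 <= C -> exists C' : R, forall M : 'M[R]_(1 + n),
    entries_le K M -> (exists i : 'I_n, eta <= `|dlsubmx M i ord0|) ->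
    (forall D : 'M[R]_n, entries_le K' D -> \det D = \det M -> lattice_approx C D) ->
  lattice_approx C' M.
Proof.
move=> eta0 K0; pose tau := (1 + K) / eta.
have tau0 : 0 <= tau by rewrite divr_ge0 ?addr_ge0// ltW.
pose K1 := K + n%:R * (tau * K).
have [K' K'P] := lattice_approx_unit_pivot n (Num.max K K1).
exists K' => C /K'P[C' C'P]; exists ((1 + n)%:R * (Num.max 1 tau * C') + 1) => M MK [i iM] DC.
have [aK bK cK eK] := entries_le_subblock MK.
set a := ulsubmx M in aK; set b := ursubmx M in bK.
set c := dlsubmx M in iM cK; set e := drsubmx M in eK.
have ci0 : c i ord0 != 0 by rewrite -normr_gt0 (lt_le_trans eta0).
pose u : 'rV[R]_n := ((1 - a ord0 ord0) / c i ord0) *: delta_mx ord0 i.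
have utau : entries_le tau u.
  move=> k l; rewrite [u k l]mxE [delta_mx _ _ _ _]mxE.
  case: (_ && _); last by rewrite mulr0 normr0.
  rewrite mulr1 normrM normfV ler_pM// ?invr_ge0//.
    by rewrite (le_trans (ler_normB _ _))// normr1 lerD2l.
  by rewrite lef_pV2 ?posrE ?normr_gt0.
have uc : a + u *m c = 1%:M.
  apply/matrixP => k l; rewrite !ord1 -scalemxAl -rowE mxE [X in _ + X]mxE [row _ _ _ _]mxE [RHS]mxE eqxx mulr1n.
  by rewrite divfK// addrC subrK.
pose N := ushear u *m M.
have ME : M = ushear (- u) *m N by rewrite mulmxA ushear_inv mul1mx.
have NE : N = block_mx 1%:M (b + u *m e) c e.
  rewrite /N -[M]submxK mulmx_block !mul1mx !mul0mx !add0r.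
  by rewrite uc.
rewrite ME; apply: lattice_approxM.
- apply: entries_le_ushear; first by rewrite le_max lexx.
  by apply/entries_leN; apply: le_entries utau; rewrite le_max lexx orbT.
- exact: lattice_approx_ushear.
- apply: C'P; first 1 last.
  + by rewrite NE block_mxKul.
  + move=> D DK' Ddet; apply: DC => //.
    by rewrite Ddet det_mulmx det_ushear mul1r.
  rewrite NE; apply: entries_le_block.
  + rewrite -uc; apply: (@le_entries _ _ _ K1); first by rewrite le_max lexx orbT.
    by apply: entries_leD => //; exact: entries_leM.
  + apply: (@le_entries _ _ _ K1); first by rewrite le_max lexx orbT.
    by apply: entries_leD => //; exact: entries_leM.
  + by apply: le_entries cK; rewrite le_max lexx.
  + by apply: le_entries eK; rewrite le_max lexx.
Qed.

(** Laplace expansion along column 0: small entries there would make the determinant small. *)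
Lemma det_column_bound n K delta (M : 'M[R]_n.+1) : 0 <= K ->
  entries_le K M -> delta <= `|\det M| ->
  exists i, delta / (n.+1%:R * (1 + n`!%:R * K ^+ n)) <= `|M i ord0|.
Proof.
move=> K0 MK dM; apply/not_existsP => lt_M.
set L := 1 + _ in lt_M.
have L0 : 0 < L by rewrite ltr_pwDl// mulr_ge0// exprn_ge0.
have lt_M' i : `|M i ord0| * L < delta / n.+1%:R.
  have /negP := lt_M i; rewrite -ltNge invfM mulrA => lti.
  by rewrite -ltr_pdivlMr.
have : `|\det M| < delta; last by rewrite ltNge dM.
rewrite (expand_det_col _ ord0) (le_lt_trans (ler_norm_sum _ _ _))//.
rewrite (@lt_le_trans _ _ (\sum_(i < n.+1) (delta / n.+1%:R)))//; last first.
  by rewrite sumr_const card_ord -[leLHS]mulr_natr divfK// pnatr_eq0.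
apply: ltr_sum => [|i _]; first by apply/hasP; exists ord0; rewrite ?mem_index_enum.
apply: le_lt_trans (lt_M' i); rewrite normrM ler_wpM2l//.
rewrite normrM normrX normrN1 expr1n mul1r.
apply: le_trans (norm_det_le (K := K) _) _; last by rewrite lerDr.
by move=> k l; rewrite !mxE.
Qed.

(** Induction on the dimension.  The lower bound on the determinant produces a large entry in
    column 0, shears move it below the pivot and then turn the pivot into 1, and the Schur
    complement of the pivot has the same determinant as M.  The upper bound on the
    determinant matters in dimension one, where it makes division by M expanding. *)
Lemma lattice_approx_bounded n K delta : 0 < delta -> 0 <= K ->
  exists2 C : R, 0 <= C & forall M : 'M[R]_n.+1,
    entries_le K M -> delta <= `|\det M| -> `|\det M| <= 1 -> lattice_approx C M.
Proof.
elim: n K delta => [|n IHn] K delta delta0 K0.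
  exists 1 => // M _ dM M1; rewrite [M]mx11_scalar.
  apply: lattice_approx_contraction; rewrite -det_mx11 M1 andbT.
  exact: lt_le_trans dM.
pose eta0 (L : R) := delta / (n.+2%:R * (1 + n.+1`!%:R * L ^+ n.+1)).
have eta0_gt0 L : 0 <= L -> 0 < eta0 L.
  by move=> L0; rewrite divr_gt0// mulr_gt0// ltr_pwDl// mulr_ge0// exprn_ge0.
pose eta := eta0 K / 2.
have eta_gt0 : 0 < eta by rewrite divr_gt0// eta0_gt0.
have K20 : 0 <= K + 1%:R * (1 * K) by lra.
have [K' K'P] := @lattice_approx_pivot n.+1 _ _ eta_gt0 K20.
have [C C0 CP] := IHn (Num.max 0 K') _ delta0 (ltac:(by rewrite le_max lexx)).
have [C' C'P] := K'P C C0.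
exists (Num.max 0 (Num.max C' ((1 + n.+1)%:R * (1 * C') + 1))); first by rewrite le_max lexx.
move=> M MK dM M1.
have DC (N : 'M[R]_(1 + n.+1)) : \det N = \det M -> forall D : 'M[R]_n.+1,
    entries_le K' D -> \det D = \det N -> lattice_approx C D.
  move=> NM D DK' DN; apply: CP; rewrite ?DN ?NM//.
  by apply: le_entries DK'; rewrite le_max lexx orbT.
have [[i iM]|noi] := pselect (exists i : 'I_n.+1,
    eta <= `|dlsubmx (M : 'M[R]_(1 + n.+1)) i ord0|).
  apply: (@lattice_approx_le _ C'); first by rewrite !le_max lexx orbT.
  apply: C'P; [|by exists i|exact: DC].
  by apply: le_entries MK; lra.
have M00 : eta0 K <= `|M ord0 ord0|.
  have [i iM] := det_column_bound K0 MK dM.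
  case: (unliftP ord0 i) iM => [j ->|->//] jM; exfalso; apply: noi; exists j.
  rewrite !mxE (_ : rshift 1 j = lift ord0 j); last exact: val_inj.
  rewrite (_ : lshift _ _ = @ord0 n.+1 :> 'I_(1 + n.+1)); last exact: val_inj.
  by apply: le_trans jM; rewrite /eta -/(eta0 K); have := eta0_gt0 K K0; lra.
have [aK bK cK eK] := entries_le_subblock (MK : entries_le K (M : 'M[R]_(1 + n.+1))).
set a := ulsubmx _ in aK; set b := ursubmx _ in bK.
set c := dlsubmx _ in noi cK; set e := drsubmx _ in eK.
(* Only the pivot is large: adding the first row to the second one brings back the
   previous case. *)
pose v : 'cV[R]_n.+1 := delta_mx ord0 ord0.
have v1 : entries_le 1 v.
  by move=> k l; rewrite mxE; case: (_ && _); rewrite ?normr1 ?normr0.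
pose N := lshear v *m (M : 'M[R]_(1 + n.+1)).
have ME : M = lshear (- v) *m N by rewrite mulmxA lshear_inv mul1mx.
have NE : N = block_mx a b (c + v *m a) (e + v *m b).
  have Mb : (M : 'M[R]_(1 + n.+1)) = block_mx a b c e by rewrite submxK.
  rewrite /N [X in _ *m X]Mb /lshear mulmx_block.
  by rewrite !mul1mx !mul0mx !addr0 [c + _]addrC [e + _]addrC.
have NM : \det N = \det M by rewrite det_mulmx det_lshear mul1r.
apply: (@lattice_approx_le _ ((1 + n.+1)%:R * (1 * C') + 1)).
  by rewrite !le_max lexx !orbT.
rewrite ME; apply: lattice_approxM.
- by apply: entries_le_lshear => //; exact: entries_leN.
- exact: lattice_approx_lshear.
apply: C'P; last exact: DC.
  rewrite NE; apply: entries_le_block.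
  + by apply: le_entries aK; lra.
  + by apply: le_entries bK; lra.
  + by apply: entries_leD => //; exact: entries_leM.
  + by apply: entries_leD => //; exact: entries_leM.
exists ord0; rewrite NE block_mxKdl.
have : `|c ord0 ord0| < eta by rewrite ltNge; apply/negP => ?; apply: noi; exists ord0.
have -> : (c + v *m a) ord0 ord0 = c ord0 ord0 + M ord0 ord0.
  rewrite mxE [X in _ + X = _]mxE big_ord1 [v _ _]mxE !eqxx mul1r [a _ _]mxE.
  have -> : @ord0 n.+1 = lshift n.+1 ord0 :> 'I_(1 + n.+1) by exact: val_inj.
  by rewrite !mxE.
move=> cM; have := ler_normB (c ord0 ord0 + M ord0 ord0) (c ord0 ord0).
by rewrite addrAC subrr add0r /eta in cM *; lra.
Qed.

End lattice_approx.

(** * Powers of expansive matrices *)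

Section spectral_decay.
Variables (F : numFieldType) (n : nat) (C : 'M[F]_n.+1) (t t' : F).
Hypotheses (t0 : 0 <= t) (tt' : t < t').

Let h := horner_mx C.

Lemma horner_mx_mulXn p m : h (p * 'X^m) = h p *m C ^+ m.
Proof. by rewrite /h rmorphM/= rmorphXn/= horner_mx_X. Qed.

(** The sequence u m = p(C) C^m satisfies u (m + 1) = z u m + ((X - z) p)(C) C^m, and a
    linear recursion of ratio |z| < t' preserves geometric bounds of ratio t'.  In this way
    the factors X - z of an annihilating polynomial can be removed one by one. *)
Lemma geometric_bound_factor (p : {poly F}) (z : F) (K : F) : `|z| <= t -> 0 <= K ->
  (forall m, entries_le (K * t' ^+ m) (h (('X - z%:P) * p * 'X^m))) ->
  exists2 K', 0 <= K' & forall m, entries_le (K' * t' ^+ m) (h (p * 'X^m)).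
Proof.
move=> zt K0 Kh.
have t'0 : 0 < t' by exact: le_lt_trans tt'.
have tt'0 : 0 < t' - t by rewrite subr_gt0.
have [L L0 hL] := entries_bounded (h p).
have KV0 : 0 <= K / (t' - t) by rewrite divr_ge0// ltW.
exists (L + K / (t' - t)); first exact: addr_ge0.
elim=> [|m IHm].
  by rewrite !expr0 !mulr1; apply: le_entries hL; rewrite lerDl.
have -> : h (p * 'X^(m.+1)) = h (('X - z%:P) * p * 'X^m) + z *: h (p * 'X^m).
  rewrite -[z *: _]mul_scalar_mx -(horner_mx_C C) mulmxE -rmorphM -rmorphD/=.
  by congr h; rewrite exprS; ring.
move=> i j; rewrite mxE (le_trans (ler_normD _ _))// mxE normrM.
apply: (@le_trans _ _ (K * t' ^+ m + t * ((L + K / (t' - t)) * t' ^+ m))).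
  by rewrite lerD ?ler_pM//; exact: Kh.
have -> : (L + K / (t' - t)) * t' ^+ m.+1 =
    K * t' ^+ m + t * ((L + K / (t' - t)) * t' ^+ m) + (t' - t) * L * t' ^+ m.
  by rewrite exprS; field; rewrite gt_eqF.
by rewrite lerDl !mulr_ge0// ?exprn_ge0// ltW.
Qed.

Lemma geometric_bound_roots (s : seq F) :
  (forall z, z \in s -> `|z| <= t) -> forall K, 0 <= K ->
  (forall m, entries_le (K * t' ^+ m) (h (\prod_(z <- s) ('X - z%:P) * 'X^m))) ->
  exists2 K', 0 <= K' & forall m, entries_le (K' * t' ^+ m) (C ^+ m).
Proof.
elim: s => [|z s IHs] st K K0.
  rewrite big_nil => Kh; exists K => // m.
  by have := Kh m; rewrite mul1r /h rmorphXn/= horner_mx_X.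
rewrite big_cons => Kh.
have [|K' K'0 K'h] := geometric_bound_factor _ K0 Kh.
  by apply: st; rewrite mem_head.
by apply: IHs K'h => // y ys; apply: st; rewrite in_cons ys orbT.
Qed.

End spectral_decay.

Lemma char_poly_eigenvalues (F : closedFieldType) n (C : 'M[F]_n) :
  exists2 s : seq F, char_poly C = \prod_(z <- s) ('X - z%:P) &
    forall z, z \in s -> eigenvalue C z.
Proof.
have [s] := closed_field_poly_normal (char_poly C).
rewrite (monicP (char_poly_monic C)) scale1r => sC; exists s => // z zs.
by rewrite eigenvalue_root_char sC root_prod_XsubC.
Qed.

Lemma eigenvalue_inv (F : fieldType) n (A : 'M[F]_n) (z : F) :
  A \in unitmx -> eigenvalue (invmx A) z -> eigenvalue A z^-1.
Proof.
move=> uA /eigenvalueP[v vz v0].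
have vzA : v = z *: (v *m A) by rewrite scalemxAl -vz mulmxKV.
have z0 : z != 0 by apply: contra_neq v0 => z0; rewrite vzA z0 scale0r.
by apply/eigenvalueP; exists v => //; rewrite {2}vzA scalerA mulVf// scale1r.
Qed.

Section expansive_theory.
Variables (R : realType) (d : nat).
Implicit Types A : 'M[R]_d.+1.
Local Open Scope complex_scope.

Lemma small_roots_bound (s : seq R[i]) : (forall z, z \in s -> `|z| < 1) ->
  exists t : R, 0 < t < 1 /\ forall z, z \in s -> `|z| <= t%:C.
Proof.
elim: s => [|z s IHs] s1; first by exists (2^-1); split => //; apply/andP; split; lra.
have [|t [/andP[t0 t1] st]] := IHs.
  by move=> y ys; apply: s1; rewrite in_cons ys orbT.
have : `|z| < 1 by apply: s1; rewrite mem_head.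
rewrite normc_def ltcR => z1.
exists (Num.max t (Num.sqrt ((complex.Re z) ^+ 2 + (complex.Im z) ^+ 2))); split.
  by rewrite lt_max t0/= gt_max t1.
move=> y; rewrite in_cons => /orP[/eqP ->|/st yt].
  by rewrite normc_def lecR le_max lexx orbT.
by apply: le_trans yt _; rewrite lecR le_max lexx.
Qed.

Lemma norm_real_complex (x : R) : `|x%:C| = `|x|%:C.
Proof. by rewrite normc_def /= expr0n addr0 sqrtr_sqr. Qed.

(** The eigenvalues of invmx A have modulus less than 1.  The product of the X - z over these
    eigenvalues annihilates invmx A by the theorem of Cayley and Hamilton, and the removal of
    its factors ends with a geometric bound on the powers of invmx A themselves. *)
Lemma expansive_decay A : expansive A ->
  exists K t : R, [/\ 0 <= K, 0 < t < 1 &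
    forall m, entries_le (K * t ^+ m) (invmx A ^+ m)].
Proof.
move=> [uA eA].
have [s sC sE] := char_poly_eigenvalues (map_mx (real_complex R) (invmx A)).
have [z zs|t [/andP[t0 t1] st]] := @small_roots_bound s.
  have uC : map_mx (real_complex R) A \in unitmx by rewrite map_unitmx.
  have := sE z zs; rewrite map_invmx => /(eigenvalue_inv uC) zV.
  have := eA _ zV; rewrite normfV => z1.
  by rewrite -invf_gt1// -invr_gt0 (lt_trans _ z1).
pose t' := (t + 1) / 2.
have tt' : t%:C < t'%:C by rewrite ltcR /t'; lra.
have t0' : 0 <= t%:C by rewrite lecR ltW.
have [m|K K0 KC] := @geometric_bound_roots _ _ (map_mx (real_complex R) (invmx A)) _ _ t0' tt' s st 0 (lexx _).
  rewrite -sC horner_mx_mulXn Cayley_Hamilton mul0mx mul0r.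
  exact: entries_le0.
exists (complex.Re K), t'; split.
- by move: K0; rewrite lecE /= => /andP[].
- by rewrite /t'; apply/andP; split; lra.
move=> m i j; have := KC m i j.
by rewrite -rmorphXn/= mxE norm_real_complex -(RRe_real (ger0_real K0)) -rmorphXn -rmorphM/= lecR.
Qed.

(** The determinant is, up to sign, the product of the eigenvalues. *)
Lemma expansive_det_gt1 A : expansive A -> 1 < `|\det A|.
Proof.
move=> [uA eA].
have [s sC sE] := char_poly_eigenvalues (map_mx (real_complex R) A).
have s1 z : z \in s -> 1 < `|z| by move=> /sE /eA.
have s0 : s != [::].
  have := congr1 (fun p : {poly R[i]} => size p) sC.
  by rewrite size_char_poly size_prod_XsubC; case: (s).
have : `|\det (map_mx (real_complex R) A)| = \prod_(z <- s) `|z|.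
  have := congr1 (fun p => `|p.[0]|) sC.
  rewrite horner_coef0 char_poly_det normrM normrX normrN1 expr1n mul1r => ->.
  rewrite horner_prod normr_prod; apply: eq_bigr => z _.
  by rewrite hornerXsubC sub0r normrN.
rewrite det_map_mx norm_real_complex => sA; rewrite -ltcR sA {sA sC sE}.
case: s s0 s1 => // z s _ s1; rewrite big_cons.
rewrite (@lt_le_trans _ _ `|z|)//; first by rewrite s1 ?mem_head.
rewrite -[leLHS]mulr1 ler_wpM2l// big_seq; elim/big_rec: _ => // y x ys x1.
by rewrite -[leLHS]mulr1 ler_pM// ltW// s1// in_cons ys orbT.
Qed.

End expansive_theory.

(** * Translation invariance of the Lebesgue measure *)

Lemma lebesgue_measure_translate (R : realType) (a : R) (E : set (measurableTypeR R)) :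
  measurable E ->
  lebesgue_measure ((fun x : measurableTypeR R => x + a : measurableTypeR R) @^-1` E)
  = lebesgue_measure E.
Proof.
have mf : measurable_fun setT (fun x : measurableTypeR R => x + a : measurableTypeR R).
  exact: measurable_funD.
pose f : {mfun measurableTypeR R >-> measurableTypeR R} :=
  HB.pack (fun x : measurableTypeR R => x + a : measurableTypeR R)
    (isMeasurableFun.Build _ _ _ _ _ mf).
move=> mE; rewrite [RHS](@lebesgue_measure_unique _ (pushforward lebesgue_measure f))//.
move=> X [[x y] _ <-]; rewrite /pushforward.
transitivity (lebesgue_measure (`]x - a, y - a]%classic : set (measurableTypeR R))).
  rewrite !lebesgue_measure_itv/= !lte_fin ltrD2r; case: ifP => // _.
  by rewrite -!EFinB; congr EFin; ring.
by congr lebesgue_measure; apply/seteqP; split => z /=;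
  rewrite !in_itv/= ltrBlDr lerBrDr.
Qed.

Section affine_maps.
Variable R : realType.

Lemma continuous_affine_cV m n (M : 'M[R]_(m, n)) (v : 'cV[R]_m) :
  continuous (fun x : 'cV[R]_n => M *m x + v).
Proof.
move=> x P /nbhs_ballP[e /= e0 eP].
have [K K0 MK] := entries_bounded M.
pose L := n%:R * K + 1.
have L0 : 0 < L by rewrite ltr_wpDl// mulr_ge0.
apply/nbhs_ballP; exists (e / L) => /=; first by rewrite divr_gt0.
move=> y [eL xy]; apply: eP; split => // i j; rewrite /ball /= !mxE.
rewrite [X in `|X|](_ : _ = \sum_k M i k * (x k j - y k j)); last first.
  rewrite opprD addrACA subrr addr0 -sumrB.
  by apply: eq_bigr => k _; rewrite mulrBr.
rewrite (le_lt_trans (ler_norm_sum _ _ _))//.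
rewrite (@le_lt_trans _ _ (\sum_(k < n) K * (e / L)))//.
  apply: ler_sum => k _; rewrite normrM ler_pM// ltW//.
  by have := xy k j; rewrite /ball.
rewrite sumr_const card_ord -[ltLHS]mulr_natl mulrA mulrCA gtr_pMr//.
by rewrite ltr_pdivrMr// mul1r /L ltrDl.
Qed.

Lemma continuous_measurable_cV m n (f : 'cV[R]_n -> 'cV[R]_m) :
  continuous f -> measurable_fun setT f.
Proof.
move=> /continuousP cf.
apply: (measurability _ (measurable_mxE R m 1)) => _ [U oU <-].
by rewrite setTI; apply: open_measurable_mx; exact: cf.
Qed.

Lemma measurable_affine_cV m n (M : 'M[R]_(m, n)) (v : 'cV[R]_m) :
  measurable_fun setT (fun x : 'cV[R]_n => M *m x + v).
Proof. by apply: continuous_measurable_cV; exact: continuous_affine_cV. Qed.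

End affine_maps.

(** Induction along the recursive definition of the measure, through the sections of E: a
    translation acts on the first coordinate and on the others independently. *)
Lemma lebesgue_cV_translate (R : realType) n (v : 'cV[R]_n) (E : set 'cV[R]_n) :
  measurable E -> lebesgue_cV R n ((fun x => x + v) @^-1` E) = lebesgue_cV R n E.
Proof.
elim: n v E => [|n IHn] v E mE.
  by congr (lebesgue_cV _ _ _); apply/seteqP; split => x /=; rewrite [x + v]flatmx0 [x]flatmx0.
rewrite /= /lebesgue_cons /pushforward.
set F := @cons_cV R n @^-1` E.
have mF : measurable F.
  by rewrite -[F]setTI; exact: measurable_cons_cV.
pose v0 := v ord0 ord0; pose v' := dsubmx (v : 'cV_(1 + n)).
have consD (x : measurableTypeR R) (w : 'cV[R]_n) : cons_cV (x, w) + v =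
    cons_cV (x + v0 : measurableTypeR R, w + v').
  apply/matrixP => i j; rewrite [j]ord1 -(splitK i) /cons_cV /=.
  case: (fintype.split i) => k /=; rewrite mxE ?col_mxEu ?col_mxEd !mxE.
    rewrite [k]ord1 eqxx !mulr1n; congr (_ + v _ _); exact: val_inj.
  by congr (_ + v _ _); exact: val_inj.
have -> : @cons_cV R n @^-1` ((fun x => x + v) @^-1` E) =
    (fun xw : measurableTypeR R * 'cV[R]_n =>
      (xw.1 + v0 : measurableTypeR R, xw.2 + v')) @^-1` F.
  by apply/seteqP; split => -[x w]; rewrite /F /preimage /= consD.
rewrite /product_measure1.
have mF' := measurable_fun_xsection (lebesgue_cV R n) mF.
have mtr : measurable_fun setT (fun x : measurableTypeR R => x + v0 : measurableTypeR R).
  exact: measurable_funD.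
pose f : {mfun measurableTypeR R >-> measurableTypeR R} :=
  HB.pack (fun x : measurableTypeR R => x + v0 : measurableTypeR R)
    (isMeasurableFun.Build _ _ _ _ _ mtr).
transitivity (\int[lebesgue_measure]_x ((lebesgue_cV R n \o xsection F) \o f) x)%E.
  apply: eq_integral => x _ /=.
  rewrite -[RHS](IHn v'); last exact: measurable_xsection.
  by congr (lebesgue_cV _ _ _); apply/seteqP; split => w; rewrite /xsection /= !inE.
rewrite -(@ge0_integral_pushforward _ _ _ _ _ f mtr lebesgue_measure setT)//.
apply: eq_measure_integral => X mX _.
exact: lebesgue_measure_translate.
Qed.

(** * Parallelepipeds in a linear frame *)

Lemma measure_le_fin_cover d (T : measurableType d) (R : realType)
    (mu : {measure set T -> \bar R}) (I : finType) (A : set T) (B : I -> set T) :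
  measurable A -> (forall i, measurable (B i)) -> A `<=` \bigcup_(i in [set: I]) B i ->
  (mu A <= \sum_i mu (B i))%E.
Proof.
move=> mA mB AB.
have U (s : seq I) : (mu (\big[setU/set0]_(i <- s) B i) <= \sum_(i <- s) mu (B i))%E.
  elim: s => [|i s IHs]; first by rewrite !big_nil measure0.
  rewrite !big_cons (le_trans (measureU2 _ _ _))//; last by rewrite leeD2l.
  exact: bigsetU_measurable.
apply: le_trans (U (index_enum I)); apply: le_measure; rewrite ?inE//.
  exact: bigsetU_measurable.
by move=> x /AB[i _ xi]; rewrite -bigcup_seq; exists i => //=; exact: mem_index_enum.
Qed.

Section frames.
Variables (R : realType) (n : nat).
Implicit Types (X Y : 'M[R]_n) (v w x : 'cV[R]_n) (N K : R).
Local Notation mu := (lebesgue_cV R n).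

(** The parallelepipeds X ([0, 1]^n + v) and X ([-N, N]^n + v).  With X = A^j and v integral
    the former are the dilated cubes; the latter are their enlargements. *)
Definition frame_cube X v : set 'cV[R]_n :=
  [set x | forall i, 0 <= (invmx X *m x - v) i ord0 <= 1].

Definition frame_box X v N : set 'cV[R]_n :=
  [set x | entries_le N (invmx X *m x - v)].

Lemma measurable_box_cV (a b : R) :
  measurable [set x : 'cV[R]_n | forall i, a <= x i ord0 <= b].
Proof.
have mc (i : 'I_n) : measurable_fun setT (fun x : 'cV[R]_n => x i ord0 : measurableTypeR R).
  apply: (measurability _ (RGenOpens.measurableE R)) => _ [_ [p [q ->] <-]].
  rewrite setTI; apply: open_measurable_mx.
  have /continuousP := @coord_continuous R n 1 i ord0.
  by apply; exact: interval_open.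
rewrite (_ : [set x | _] = \bigcap_(i in [set: 'I_n])
    ((fun x : 'cV[R]_n => x i ord0 : measurableTypeR R) @^-1` `[a, b])).
  apply: fin_bigcap_measurable => // i _.
  by rewrite -[X in measurable X]setTI; apply: mc.
apply/seteqP; split => [x xab i _|x xab i].
  by rewrite /= in_itv/=; exact: xab.
by have := xab i I; rewrite /= in_itv.
Qed.

Lemma frame_boxE X v N : frame_box X v N =
  (fun x => invmx X *m x + (- v)) @^-1` [set x : 'cV[R]_n | forall i, - N <= x i ord0 <= N].
Proof.
apply/seteqP; split => x /= xN i; first by rewrite -ler_norml; exact: xN.
by move=> j; rewrite ord1 ler_norml; exact: xN.
Qed.

Lemma measurable_frame_cube X v : measurable (frame_cube X v).
Proof.
rewrite (_ : frame_cube X v = (fun x => invmx X *m x + (- v)) @^-1`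
  [set x : 'cV[R]_n | forall i, 0 <= x i ord0 <= 1])// -[X in measurable X]setTI.
by apply: (measurable_affine_cV (invmx X) (- v)) => //; exact: measurable_box_cV.
Qed.

Lemma measurable_frame_box X v N : measurable (frame_box X v N).
Proof.
rewrite frame_boxE -[X in measurable X]setTI.
by apply: (measurable_affine_cV (invmx X) (- v)) => //; exact: measurable_box_cV.
Qed.

Lemma frame_cube_sub_box X v : frame_cube X v `<=` frame_box X v 1.
Proof.
by move=> x xX i j; rewrite ord1 ger0_norm; have /andP[] := xX i.
Qed.

Lemma le_frame_box X v N N' : N <= N' -> frame_box X v N `<=` frame_box X v N'.
Proof. by move=> NN' x; exact: le_entries. Qed.

Lemma frame_box_sub X Y v w K D N : entries_le K (invmx X *m Y) -> Y \in unitmx ->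
  entries_le D (invmx X *m Y *m v - w) ->
  frame_box Y v N `<=` frame_box X w (n%:R * (K * N) + D).
Proof.
move=> XYK uY vwD x xN.
rewrite /frame_box /= (_ : _ - w = invmx X *m Y *m (invmx Y *m x - v) + (invmx X *m Y *m v - w)).
  by apply: entries_leD => //; exact: entries_leM.
by rewrite mulmxBr addrA subrK -mulmxA mulKVmx.
Qed.

Lemma mu_frame_cube_translate X v w : X \in unitmx ->
  mu (frame_cube X v) = mu (frame_cube X w).
Proof.
move=> uX; rewrite -[RHS](lebesgue_cV_translate (X *m (w - v))); last first.
  exact: measurable_frame_cube.
have E x : invmx X *m (x + X *m (w - v)) - w = invmx X *m x - v.
  by rewrite mulmxDr mulKmx// -addrA [w - v]addrC addrK.
by congr (mu _); apply/seteqP; split => x /= xX i; have := xX i; rewrite E.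
Qed.

Definition box_shift (N : nat) (s : {ffun 'I_n -> 'I_(2 * N).+1}) : 'cV[int]_n :=
  \col_i ((s i)%:Z - N%:Z).

Lemma frame_box_cover X (N : nat) (k : 'cV[int]_n) :
  frame_box X (map_mx intr k) N%:R `<=`
  \bigcup_(s in [set: {ffun 'I_n -> 'I_(2 * N).+1}]) frame_cube X (map_mx intr (k + box_shift s)).
Proof.
move=> x xN; pose y := invmx X *m x - map_mx intr k.
have yN i : - N%:R <= y i ord0 <= N%:R by rewrite -ler_norml; exact: xN.
have fl i : - N%:Z <= Num.floor (y i ord0) <= N%:Z.
  have /andP[yl yu] := yN i; rewrite floor_ge_int mulrNz yl/=.
  by rewrite -(@intrKfloor R N%:Z) le_floor.
have yf i : (`|(Num.floor (y i ord0) + N%:Z)%R|%N < (2 * N).+1)%N.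
  by have := fl i; lia.
exists [ffun i => Ordinal (yf i)] => // i.
have -> : (invmx X *m x - map_mx intr (k + box_shift [ffun i => Ordinal (yf i)])) i ord0 =
    y i ord0 - (Num.floor (y i ord0))%:~R.
  rewrite raddfD opprD addrA -/y [LHS]mxE; congr (_ + _).
  rewrite mxE; congr (- _); rewrite mxE; congr (_%:~R); rewrite mxE ffunE.
  have /andP[+ _] := fl i; rewrite -subr_ge0 opprK => /gez0_abs /= fN.
  by rewrite fN addrK.
by have /andP[] := floor_itv (y i ord0); rewrite intrD => ? ?; apply/andP; split; lra.
Qed.

Lemma mu_frame_box_le X (N : nat) (k : 'cV[int]_n) v : X \in unitmx ->
  (mu (frame_box X (map_mx intr k) N%:R) <=
    (((2 * N).+1 ^ n)%N%:R)%:E * mu (frame_cube X v))%E.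
Proof.
move=> uX; have cover := @frame_box_cover X N k.
have := @measure_le_fin_cover _ _ _ mu _ _ _ (measurable_frame_box _ _ _)
  (fun=> measurable_frame_cube _ _) cover.
move=> /le_trans; apply.
rewrite (eq_bigr (fun=> mu (frame_cube X v))).
  by rewrite sumr_const card_ffun !card_ord mule_natl.
by move=> s _; exact: mu_frame_cube_translate.
Qed.

Lemma mu_frame_cube_fin X v : X \in unitmx -> (mu (frame_cube X v) < +oo)%E.
Proof.
move=> uX; rewrite (mu_frame_cube_translate v 0 uX).
have [K K0 XK] := entries_bounded X.
apply: (@le_lt_trans _ _ (mu [set x | forall i,
   (const_mx (- (n%:R * K)) : 'cV[R]_n) i ord0 <= x i ord0 <= (const_mx (n%:R * K) : 'cV[R]_n) i ord0])).
  apply: le_measure; rewrite ?inE; [exact: measurable_frame_cube| |].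
    rewrite (_ : [set x | _] = [set x | forall i, - (n%:R * K) <= x i ord0 <= n%:R * K]).
      exact: measurable_box_cV.
    by apply/seteqP; split => x xK i; have := xK i; rewrite !mxE.
  move=> x /frame_cube_sub_box xX i; rewrite !mxE -ler_norml -(mulKVmx uX x).
  rewrite -[K]mulr1; apply: entries_leM => //.
  by move=> k l; have := xX k l; rewrite subr0.
rewrite lebesgue_cV_box ?ltry// => i; rewrite !mxE.
by rewrite ge0_cp// mulr_ge0.
Qed.

(** The translates of a null cube would cover every box, and some box contains the standard
    unit cube. *)
Lemma mu_frame_cube_gt0 X v : X \in unitmx -> (0 < mu (frame_cube X v))%E.
Proof.
move=> uX.
have [K K0 XK] := entries_bounded (invmx X).
have [N NK] : exists N : nat, n%:R * K <= N%:R.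
  by exists (Num.truncn (n%:R * K)).+1; apply/ltW/truncnS_gt.
have := mu_frame_box_le N 0 v uX.
rewrite lt0e measure_ge0 andbT => cube_le; apply/eqP => cube0.
have := cube_le; rewrite cube0 mule0; apply/negP; rewrite -ltNge.
apply: (@lt_le_trans _ _ (mu [set x | forall i,
   (0 : 'cV[R]_n) i ord0 <= x i ord0 <= (const_mx 1 : 'cV[R]_n) i ord0])).
  rewrite lebesgue_cV_box; last by move=> i; rewrite !mxE.
  by rewrite lte_fin prodr_gt0// => i _; rewrite !mxE subr0.
apply: le_measure; rewrite ?inE; [|exact: measurable_frame_box|].
  rewrite (_ : [set x | _] = [set x | forall i, 0 <= x i ord0 <= 1]).
    exact: measurable_box_cV.
  by apply/seteqP; split => x xK i; have := xK i; rewrite !mxE.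
move=> x x01; rewrite /frame_box /= map_mx0 subr0; apply: le_entries NK _.
rewrite -[K]mulr1; apply: entries_leM => // i j; rewrite ord1 ger0_norm;
by have := x01 i; rewrite !mxE => /andP[].
Qed.

Lemma mu_frame_cube_compare X Y v w K (N : nat) : X \in unitmx -> Y \in unitmx ->
  entries_le K (invmx Y *m X) -> n%:R * K <= N%:R ->
  (mu (frame_cube X v) <= (((2 * N).+1 ^ n)%N%:R)%:E * mu (frame_cube Y w))%E.
Proof.
move=> uX uY YXK nK; apply: le_trans (mu_frame_box_le N 0 w uY).
rewrite (mu_frame_cube_translate v 0 uX); apply: le_measure; rewrite ?inE.
- exact: measurable_frame_cube.
- exact: measurable_frame_box.
apply: subset_trans (@frame_cube_sub_box _ _) _.
have XY0 : entries_le 0 (invmx Y *m X *m 0 - map_mx intr (0 : 'cV[int]_n)).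
  by rewrite (map_mx0 intr) mulmx0 subr0; exact: entries_le0.
apply: subset_trans (frame_box_sub YXK uX XY0 (N := 1)) _.
by apply: le_frame_box; rewrite mulr1 addr0.
Qed.

(** A box whose frame Z is at most comparable to X has bounded size when seen from X.  If it
    meets a given cube with frame Y, with Y comparable to X, it is therefore confined to a
    fixed neighbourhood of that cube, and a neighbourhood of bounded size in the frame X
    consists of boundedly many lattice cubes, whose number and measures do not depend on the
    matrices. *)
Lemma frame_cube_neighbours K (N : nat) : exists (M : nat) (C : R), [/\ 0 <= C &
  forall X Y (m : 'cV[int]_n), X \in unitmx -> Y \in unitmx ->
    entries_le K (invmx X *m Y) -> entries_le K (invmx Y *m X) ->
  exists P' : 'I_M -> 'cV[int]_n,
    (forall Z v (U V : set 'cV[R]_n), Z \in unitmx -> entries_le K (invmx X *m Z) ->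
      U `<=` frame_box Z v N%:R -> V `<=` frame_box Z v N%:R ->
      V `&` frame_cube Y (map_mx intr m) !=set0 ->
      U `<=` \bigcup_(s in setT) frame_cube X (map_mx intr (P' s))) /\
    forall s, (mu (frame_cube X (map_mx intr (P' s))) <=
      C%:E * mu (frame_cube Y (map_mx intr m)))%E].
Proof.
pose L := n%:R * (K * (N%:R + N%:R)) + (n%:R * (K * 1) + 1).
have [N' LN'] : exists N' : nat, L <= N'%:R.
  by exists (Num.truncn L).+1; apply/ltW/truncnS_gt.
have [N1 nKN1] : exists N1 : nat, n%:R * K <= N1%:R.
  by exists (Num.truncn (n%:R * K)).+1; apply/ltW/truncnS_gt.
exists #|{: {ffun 'I_n -> 'I_(2 * N').+1}}|, (((2 * N1).+1 ^ n)%N%:R).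
split=> // X Y m uX uY XY YX.
pose k0 : 'cV[int]_n := map_mx Num.floor (invmx X *m Y *m map_mx intr m).
exists (fun s => k0 + box_shift (enum_val s)); split; last first.
  by move=> s; exact: mu_frame_cube_compare YX nKN1.
move=> Z v U V uZ XZ UZ VZ [x [Vx Yx]] y Uy.
have k01 : entries_le 1 (invmx X *m Y *m map_mx intr m - map_mx intr k0).
  move=> i j; set z := invmx X *m Y *m _.
  have -> : (z - map_mx intr k0) i j = z i j - (Num.floor (z i j))%:~R by rewrite !mxE.
  have /andP[] := floor_itv (z i j); rewrite intrD => *.
  by rewrite ger0_norm; lra.
have xk0 := frame_box_sub XY uY k01 (frame_cube_sub_box Yx).
have yx : entries_le (n%:R * (K * (N%:R + N%:R))) (invmx X *m (y - x)).
  rewrite (_ : invmx X *m (y - x) = invmx X *m Z *m ((invmx Z *m y - v) - (invmx Z *m x - v))).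
    by apply: entries_leM => //; apply: entries_leB; [exact: UZ|exact: VZ].
  rewrite opprB addrA subrK -mulmxBr -mulmxA mulKVmx//.
have yk0 : frame_box X (map_mx intr k0) N'%:R y.
  apply: le_entries LN' _; rewrite (_ : _ - _ = invmx X *m (y - x) +
      (invmx X *m x - map_mx intr k0)); first exact: entries_leD.
  by rewrite mulmxBr addrA subrK.
have [s _ sy] := frame_box_cover yk0.
by exists (enum_rank s) => //; rewrite enum_rankK.
Qed.

End frames.

(** * Quasi-norms and the operators that they bound *)

Section archimedean.
Variable R : realType.

Lemma exists_pow_lt (t e : R) : 0 <= t < 1 -> 0 < e -> exists m, t ^+ m < e.
Proof.
move=> /andP[t0 t1] e0.
have : (t ^+ m) @[m --> \oo] --> (0 : R) by apply: cvg_expr; rewrite ger0_norm.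
move/cvgrPdist_lt => /(_ e e0)[m _ /(_ m (leqnn m))]; rewrite sub0r normrN.
by rewrite ger0_norm ?exprn_ge0// => tm; exists m.
Qed.

Lemma exists_pow_gt (D x : R) : 1 < D -> exists m, x < D ^+ m.
Proof.
move=> D1; have D0 : 0 < D by exact: lt_trans D1.
have [| |m] := @exists_pow_lt D^-1 (1 + `|x|)^-1.
- by rewrite invr_ge0 ltW//= invf_lt1.
- by rewrite invr_gt0 ltr_pwDl.
rewrite exprVn ltf_pV2 ?posrE ?exprn_gt0// ?ltr_pwDl// => Dm.
by exists m; rewrite (le_lt_trans (ler_norm _))// (lt_trans _ Dm)// ltrDr.
Qed.

End archimedean.

(** Steinhaus' argument: for n large, the set E of the points of [0, 1] where f and its
    reflection are at most n has measure more than 3/4, so it meets its translates by at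
    most 1/4, and every such s is a difference of two points of E. *)
Lemma quasi_subadditive_bounded (R : realType) (c : R) (f : R -> R) :
  0 <= c -> measurable_fun setT f ->
  (forall s t, f (s + t) <= c * (f s + f t)) ->
  exists K, forall s, `|s| <= 4^-1 -> f s <= K.
Proof.
move=> c0 mf fD.
pose E (n : nat) : set (measurableTypeR R) :=
  `[0, 1]%classic `&` (f @^-1` `]-oo, n%:R] `&` (f \o -%R) @^-1` `]-oo, n%:R]).
have mE n : measurable (E n).
  apply: measurableI => //; apply: measurableI.
    by rewrite -[X in measurable X]setTI; exact: mf.
  rewrite -[X in measurable X]setTI.
  by apply: (measurableT_comp mf) => //; exact: measurable_oppr.
have ndE : nondecreasing_seq E.
  move=> m n mn; apply/subsetPset => t [t01 []].
  rewrite /= !in_itv/= => fm fNm; split => //; split; rewrite /= in_itv/=.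
    by rewrite (le_trans fm)// ler_nat.
  by rewrite (le_trans fNm)// ler_nat.
have UE : \bigcup_n E n = `[0, 1]%classic.
  apply/seteqP; split => [t [n _ []]//|t t01].
  pose m := Num.max (f t) (f (- t)).
  exists (Num.truncn m).+1 => //; split => //.
  have mT : m <= (Num.truncn m).+1%:R by apply/ltW/truncnS_gt.
  split; rewrite /= in_itv/= (le_trans _ mT)// /m le_max lexx ?orbT//.
have [n En] : exists n, ((3 / 4)%:E < lebesgue_measure (E n))%E.
  apply/not_existsP => Ele.
  have mUE : measurable (\bigcup_n E n) by rewrite UE.
  have cE := nondecreasing_cvg_mu (mu := lebesgue_measure) mE mUE ndE.
  have : (lebesgue_measure (\bigcup_n E n) <= (3 / 4)%:E)%E.
    rewrite -(cvg_lim _ cE)//; apply: lime_le; first by apply/cvg_ex; eexists; exact: cE.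
    by apply: nearW => k; rewrite leNgt; apply/negP; exact: Ele.
  rewrite UE lebesgue_measure_itv/= lte_fin ltr01 sube0 lee_fin.
  by apply/negP; rewrite -ltNge; lra.
exists (c * (n%:R + n%:R)) => s s4.
have [[x [Ex Exs]]|disj] := pselect (exists x, E n x /\ E n (x + s)).
  have -> : s = (x + s) + - x by ring.
  apply: le_trans (fD _ _) _; rewrite ler_wpM2l// lerD//.
    by case: Exs => _ [+ _]; rewrite /= in_itv.
  by case: Ex => _ [_]; rewrite /= in_itv.
exfalso; pose E' := (fun x : measurableTypeR R => x + s : measurableTypeR R) @^-1` E n.
have mE' : measurable E'.
  by rewrite -[E']setTI; apply: measurable_funD => //; exact: mE.
have E'n : lebesgue_measure E' = lebesgue_measure (E n) by exact: lebesgue_measure_translate.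
pose J : set (measurableTypeR R) := `[- 4^-1, 5 / 4]%classic.
have : (lebesgue_measure (E n `|` E') <= lebesgue_measure J)%E.
  apply: le_measure; rewrite ?inE//; [exact: measurableU|exact: measurable_itv|].
  move: s4; rewrite ler_norml => /andP[s1 s2].
  have JP x : - 4^-1 <= x <= 5 / 4 -> J x by rewrite /J /= in_itv.
  move=> x [[x01 _]|[x01 _]]; apply: JP; move: x01; rewrite /= in_itv/= => /andP[x0 x1].
    by apply/andP; split; lra.
  by apply/andP; split; lra.
have -> : lebesgue_measure (E n `|` E') =
    (lebesgue_measure (E n) + lebesgue_measure (E n))%E.
  rewrite -[in X in _ = (_ + X)%E]E'n measureU//.
  by apply/seteqP; split => // x [Ex Ex']; apply: disj; exists x.
have -> : lebesgue_measure J = (3 / 2)%:E.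
  rewrite lebesgue_measure_itv/= lte_fin ifT; last by lra.
  by rewrite -EFinB; congr EFin; lra.
apply/negP; rewrite -ltNge (@le_lt_trans _ _ ((3 / 4)%:E + (3 / 4)%:E)%E)//.
  by rewrite -EFinD lee_fin; lra.
by apply: lteD.
Qed.

Section quasi_norm.
Variables (R : realType) (d : nat) (A : 'M[R]_d.+1) (rho : 'cV[R]_d.+1 -> R).
Hypotheses (eA : expansive A) (hrho : homogeneous_quasi_norm A rho).

Let D := `|\det A|.
Let D_gt1 : 1 < D := expansive_det_gt1 eA.
Let uA : A \in unitmx := eA.1.

Lemma quasi_norm_exp m x : rho (A ^+ m *m x) = D ^+ m * rho x.
Proof.
have [_ _ _ hA _] := hrho.
elim: m => [|m IHm]; first by rewrite !expr0 mul1mx mul1r.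
by rewrite exprS -mulmxE -mulmxA hA IHm exprS mulrA.
Qed.

Lemma quasi_norm_axis_bounded (i : 'I_d.+1) :
  exists K, forall s, `|s| <= 4^-1 -> rho (s *: delta_mx i ord0) <= K.
Proof.
have [mr _ _ _ [c c0 hc]] := hrho.
apply: (@quasi_subadditive_bounded _ c (fun s => rho (s *: delta_mx i ord0))).
- exact: ltW.
- apply: measurableT_comp => //.
  apply: (measurability _ (measurable_mxE R d.+1 1)) => _ [U oU <-].
  rewrite setTI; apply: open_measurable.
  suff /continuousP : continuous (fun s : R => s *: (delta_mx i ord0 : 'cV[R]_d.+1)) by exact.
  by move=> s; apply: cvgZr_tmp; exact: cvg_id.
- by move=> s t; rewrite scalerDl; exact: hc.
Qed.

(** A vector is the sum of its components along the axes, so that the quasi-triangle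
    inequality extends the bound on each axis. *)
Lemma quasi_norm_bounded_near0 :
  exists K, forall x, entries_le 4^-1 x -> rho x <= K.
Proof.
have [_ _ _ _ [c c0 hc]] := hrho.
have sumB (s : seq 'I_d.+1) : exists K, forall x : 'cV[R]_d.+1, entries_le 4^-1 x ->
    rho (\sum_(i <- s) x i ord0 *: delta_mx i ord0) <= K.
  elim: s => [|i s [K HK]]; first by exists (rho 0) => x _; rewrite big_nil.
  have [L HL] := quasi_norm_axis_bounded i.
  exists (c * (L + K)) => x x4; rewrite big_cons (le_trans (hc _ _))//.
  by rewrite ler_wpM2l ?lerD ?HK ?HL// ltW.
have [K HK] := sumB (index_enum 'I_d.+1).
exists K => x x4; suff -> : x = \sum_i x i ord0 *: delta_mx i ord0 by exact: HK.
rewrite [LHS]matrix_sum_delta; apply: eq_bigr => i _.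
by rewrite big_ord1.
Qed.

(** The dilation by A^m multiplies rho by a large factor while it maps a small enough cube
    into the one where rho is bounded. *)
Lemma quasi_norm_small e : 0 < e ->
  exists2 dl, 0 < dl & forall x, entries_le dl x -> rho x <= e.
Proof.
move=> e0; have [K HK] := quasi_norm_bounded_near0.
have [m Dm] := exists_pow_gt (K / e) D_gt1.
have [L L0 AL] := entries_bounded (A ^+ m).
pose G := d.+1%:R * L + 1; have G0 : 0 < G by rewrite ltr_wpDl// mulr_ge0.
exists (4^-1 / G) => [|x xG]; first by rewrite divr_gt0.
have Dm0 : 0 < D ^+ m by rewrite exprn_gt0// (lt_trans _ D_gt1).
rewrite -(ler_pM2l Dm0) -quasi_norm_exp (le_trans (HK _ _))//.
  apply: le_entries (entries_leM AL xG).
  by rewrite mulrA mulrCA ger_pMr// ler_pdivrMr// mul1r /G lerDl.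
by rewrite -ler_pdivrMr// ltW.
Qed.

(** Compactness without continuity: near a point v of the shell, the quasi-triangle inequality
    rho v <= c (rho w + rho (v - w)) and the smallness of rho near 0 bound rho w from below
    by rho v / (2 c). *)
Lemma quasi_norm_shell (L : R) : exists2 dl, 0 < dl &
  forall x i, entries_le L x -> 1 <= `|x i ord0| -> dl <= rho x.
Proof.
have [_ _ rpos _ [c c0 hc]] := hrho.
pose Bx := [set v : 'rV[R]_d.+1 | forall i, v ord0 i \in `[- L, L]].
have cB : compact Bx.
  apply: (@rV_compact _  _ (fun=> `[- L, L]%classic)).
  by move=> _; apply: segment_compact.
pose P (dl : R) (v : 'rV[R]_d.+1) := forall i, 1 <= `|v ord0 i| -> dl <= rho v^T.
have : \forall dl \near 0^'+, Bx `<=` P dl.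
  move/compact_near_coveringP : cB; apply => v vB.
  have [v0|v0] := eqVneq v 0.
    exists (ball v 1, setT); first by split; [exact: nbhsx_ballx|exact: filterT].
    move=> [w dl] /= [[_ vw] _] i; have := vw ord0 i.
    by rewrite /ball /= v0 mxE sub0r normrN ltNge => /negP h /h.
  have rv : 0 < rho v^T by apply: rpos; rewrite trmx_eq0.
  have rv2 : 0 < rho v^T / (2 * c) by rewrite divr_gt0// mulr_gt0.
  have [s s0 sP] := quasi_norm_small rv2.
  exists (ball v s, [set dl | dl < rho v^T / (2 * c)]); first split.
  - exact: nbhsx_ballx.
  - exact: nbhs_right_lt.
  move=> [w dl] /= [[_ vw] dls] i _; apply: (le_trans (ltW dls)).
  have vws : rho (v^T - w^T) <= rho v^T / (2 * c).
    by apply: sP => k l; rewrite !mxE ltW//; exact: vw.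
  have := hc w^T (v^T - w^T); rewrite addrC subrK => vle.
  have : rho v^T <= c * (rho w^T + rho v^T / (2 * c)).
    by rewrite (le_trans vle)// ler_pM2l// lerD2l.
  rewrite -ler_pdivrMl// => h.
  have e2 : c^-1 * rho v^T = rho v^T / (2 * c) + rho v^T / (2 * c) by field; rewrite gt_eqF.
  by move: h; rewrite e2; lra.
move=> nearP; near (0 : R)^'+ => dl.
exists dl => [|x i xL xi]; first by near: dl; exact: nbhs_right_gt.
have : Bx `<=` P dl by near: dl.
move=> /(_ x^T); rewrite /P trmxK => /(_ _ i); rewrite mxE; apply => // k.
by rewrite mxE in_itv/= -ler_norml.
Unshelve. all: end_near. Qed.

Lemma entries_le_exp_mul (K : R) m (x : 'cV[R]_d.+1) (L : R) : 0 <= K ->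
  entries_le K A -> entries_le L x -> entries_le ((1 + d.+1%:R * K) ^+ m * L) (A ^+ m *m x).
Proof.
move=> K0 AK xL; elim: m => [|m IHm]; first by rewrite !expr0 mul1mx mul1r.
rewrite [A ^+ _]exprS -mulmxE -mulmxA; apply: le_entries (entries_leM AK IHm).
have L0 : 0 <= L by apply: le_trans (xL ord0 ord0).
rewrite [leLHS]mulrA [in leRHS]exprS -[leRHS]mulrA ler_wpM2r ?mulr_ge0 ?exprn_ge0 ?addr_ge0 ?mulr_ge0//.
by rewrite lerDr.
Qed.

(** Let m be the first exponent for which y = A^-m x lies in the open unit cube.  The preceding
    iterate A y lies outside of it but in a fixed bounded set, so rho (A y) >= dl, and
    rho x = |det A|^(m - 1) rho (A y) <= r bounds m.  Then x = A^m y is bounded. *)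
Lemma quasi_norm_sublevel_bounded r : exists L, forall x, rho x <= r -> entries_le L x.
Proof.
have [K K0 AK] := entries_bounded A.
have [Kd [t [Kd0 t01 decay]]] := expansive_decay eA.
have [dl dl0 shell] := quasi_norm_shell (d.+1%:R * (K * 1)).
have [m0 m0r] := exists_pow_gt (r / dl) D_gt1.
pose G := 1 + d.+1%:R * K.
have G1 : 1 <= G by rewrite lerDl mulr_ge0.
exists (G ^+ m0 * 1) => x xr.
pose y m := invmx A ^+ m *m x.
have Ay m : A ^+ m *m y m = x.
  by rewrite /y mulmxA -[invmx A]/(A^-1) mulmxE exprVn mulrV ?mul1mx// unitrX.
have [L L0 xL] := entries_bounded x.
have small : exists m, [forall i, `|y m i ord0| < 1].
  have L1 : 0 < (1 + d.+1%:R * (Kd * L))^-1 by rewrite invr_gt0 ltr_pwDl// !mulr_ge0.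
  have t01' : 0 <= t < 1 by case/andP: t01 => t0 ->; rewrite ltW.
  have [m tm] := exists_pow_lt t01' L1.
  exists m; apply/forallP => i.
  rewrite (le_lt_trans (entries_leM (decay m) xL i ord0))//.
  rewrite [ltLHS](_ : _ = t ^+ m * (d.+1%:R * (Kd * L))); last by ring.
  have t0 : 0 <= t ^+ m by rewrite exprn_ge0//; case/andP: t01 => /ltW.
  rewrite (@le_lt_trans _ _ (t ^+ m * (1 + d.+1%:R * (Kd * L))))//.
    by rewrite ler_wpM2l// lerDr.
  by rewrite -ltr_pdivlMr ?mul1r// ltr_pwDl// !mulr_ge0.
case: (ex_minnP small) => m /forallP ym minm.
have y1 : entries_le 1 (y m) by move=> i j; rewrite ord1 ltW.
have mm0 : (m <= m0)%N.
  case: m ym minm y1 => [//|m] ym minm y1.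
  have : ~~ [forall i, `|y m i ord0| < 1].
    by apply/negP => /minm; rewrite ltnn.
  move=> /forallPn [k]; rewrite -leNgt => ky.
  have ymA : y m = A *m y m.+1.
    by rewrite /y exprS -mulmxE -!mulmxA mulKVmx.
  have : dl <= rho (y m) by apply: shell ky; rewrite ymA; exact: entries_leM.
  move=> dly; rewrite ltnNge; apply/negP => m0m.
  have : D ^+ m * dl <= r.
    by rewrite (le_trans _ xr)// -(Ay m) quasi_norm_exp ler_wpM2l ?exprn_ge0 ?normr_ge0.
  rewrite -ler_pdivlMr// leNgt => /negP; apply.
  by rewrite (lt_le_trans m0r)// ler_weXn2l// ltW.
rewrite -(Ay m); apply: le_entries (entries_le_exp_mul m K0 AK y1).
by rewrite ler_wpM2r// ler_weXn2l.
Qed.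

Lemma quasi_norm_operator_bounded (C : R) : exists K, forall M : 'M[R]_d.+1,
  (forall x, rho (M *m x) <= C * rho x) -> entries_le K M.
Proof.
have [_ rge0 _ _ _] := hrho.
pose r := `|C| * \sum_i rho (delta_mx i ord0).
have [L LP] := quasi_norm_sublevel_bounded r.
exists L => M MC i j.
have /LP/(_ i ord0) : rho (M *m delta_mx j ord0) <= r.
  rewrite (le_trans (MC _))// (le_trans (ler_wpM2r (rge0 _) (ler_norm C)))//.
  by rewrite ler_wpM2l// (bigD1 j)//= lerDl sumr_ge0.
by rewrite -colE mxE.
Qed.

End quasi_norm.

(** * Scalar inequalities *)

Section scalar_inequalities.
Variable R : realType.
Implicit Types (a b x y u r e : R).

Lemma powR_subM x u : 0 <= x -> 1 < u -> x * x `^ (u - 1) = x `^ u.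
Proof. by move=> x0 u1; rewrite mulr_powRB1// (lt_trans _ u1). Qed.

(** Young's inequality for the product a b^(u-1).  The differential form is
    d(t^u) = u / (u - 1) t d(t^(u-1)), with t <= a. *)
Lemma powR_increment_le a b u : 1 < u -> 0 <= b <= a ->
  a `^ u - b `^ u <= a * (u / (u - 1) * (a `^ (u - 1) - b `^ (u - 1))).
Proof.
move=> u1 /andP[b0 ba]; have a0 : 0 <= a by exact: le_trans ba.
have u0 : 0 < u by exact: lt_trans u1.
have u10 : 0 < u - 1 by rewrite subr_gt0.
have := @conjugate_powR _ a (b `^ (u - 1)) u (u / (u - 1)) a0 (powR_ge0 _ _) u0.
rewrite divr_gt0// => /(_ isT); rewrite -powRrM mulrCA divff ?gt_eqF// mulr1.
have -> : u^-1 + (u / (u - 1))^-1 = 1 by field; rewrite !gt_eqF.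
move=> /(_ erefl) Y.
rewrite -subr_ge0 mulrBr mulrBr (mulrCA a) powR_subM//.
have -> : u / (u - 1) * a `^ u - a * (u / (u - 1) * b `^ (u - 1)) - (a `^ u - b `^ u) =
  u / (u - 1) * (a `^ u / u + b `^ u / (u / (u - 1)) - a * b `^ (u - 1)).
  by field; rewrite !gt_eqF.
by rewrite mulr_ge0 ?divr_ge0 ?subr_ge0// ltW.
Qed.

(** Young's inequality with an arbitrarily small coefficient in front of the term which is to
    be absorbed on the other side. *)
Lemma young_absorb A e r : 1 < r -> 0 <= A -> 0 < e -> exists2 C, 0 <= C &
  forall x y, 0 <= x -> 0 <= y -> A * (x * y) <= C * x `^ r + e * y `^ (r / (r - 1)).
Proof.
move=> r1 A0 e0; have r0 : 0 < r by exact: lt_trans r1.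
have r10 : 0 < r - 1 by rewrite subr_gt0.
pose q := r / (r - 1).
have q0 : 0 < q by rewrite divr_gt0.
pose c := A / e `^ q^-1.
have c0 : 0 <= c by rewrite divr_ge0 ?powR_ge0.
have e1 : e `^ q^-1 != 0 by rewrite gt_eqF ?powR_gt0.
exists (c `^ r / r); first by rewrite divr_ge0 ?powR_ge0 ?ltW.
move=> x y x0 y0.
have := @conjugate_powR _ (c * x) (e `^ q^-1 * y) r q
  (mulr_ge0 c0 x0) (mulr_ge0 (powR_ge0 _ _) y0) r0 q0.
have -> : r^-1 + q^-1 = 1 by rewrite /q; field; rewrite !gt_eqF.
move=> /(_ erefl); rewrite (powRM _ c0 x0) (powRM _ (powR_ge0 _ _) y0).
rewrite -(powRrM e) mulVf ?gt_eqF// (powRr1 (ltW e0)).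
have -> : c * x * (e `^ q^-1 * y) = A * (x * y) by rewrite /c; field.
move=> /le_trans; apply; rewrite [_ / r * _]mulrAC lerD2l.
have q1 : q^-1 <= 1 by rewrite invf_le1// /q ler_pdivlMr// mul1r gerBl.
by rewrite -/q ler_piMr// mulr_ge0 ?powR_ge0// ltW.
Qed.

(** The graph of the convex function x^(-k) lies above its tangent at e. *)
Lemma powRN_tangent (k x e : R) : 0 <= k -> 0 < x -> 0 < e ->
  (1 + k) * e `^ (- k) <= x `^ (- k) + k * (e `^ (- k) / e * x).
Proof.
move=> k0 x0 e0.
pose z := x / e; have z0 : 0 < z by rewrite divr_gt0.
have xE : x = z * e by rewrite /z divfK// gt_eqF.
rewrite {1}xE (powRM _ (ltW z0) (ltW e0)) (_ : _ / e * x = e `^ (- k) * z); last by rewrite /z; ring.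
suff h : 1 + k <= z `^ (- k) + k * z.
  rewrite [leRHS](_ : _ = (z `^ (- k) + k * z) * e `^ (- k)); last by ring.
  by rewrite ler_wpM2r ?powR_ge0.
rewrite /powR gt_eqF//.
have := expR_ge1Dx (- k * ln z).
have lnz : ln z <= z - 1.
  by have := @le_ln1Dx _ (z - 1); rewrite [1 + _]addrC subrK => -> //; lra.
have : k * ln z <= k * (z - 1) by rewrite ler_wpM2l.
by lra.
Qed.

(** According to whether x <= n^(2/r), one of the two terms suffices.  The first one is linear
    in x, which allows duality arguments, and the second one is the square of n. *)
Lemma powR_split_le x n r : 0 < r < 1 -> 0 <= x -> 0 < n ->
  x `^ r <= x * n `^ (- (2 * (1 - r) / r)) + n `^ 2.
Proof.
move=> /andP[r0 r1] x0 n0.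
have [xn|nx] := leP x (n `^ (2 / r)).
  apply: (@le_trans _ _ (n `^ 2)); last by rewrite lerDr mulr_ge0 ?powR_ge0.
  have := ge0_ler_powR (ltW r0) x0 (powR_ge0 n (2 / r)) xn.
  by rewrite -powRrM divfK// gt_eqF.
have xgt0 : 0 < x by rewrite (lt_trans _ nx)// powR_gt0.
apply: (@le_trans _ _ (x * n `^ (- (2 * (1 - r) / r)))); last by rewrite lerDl powR_ge0.
have -> : x `^ r = x * x `^ (- (1 - r)).
  rewrite -[X in X * _](powRr1 x0) -powRD; first by congr (_ `^ _); ring.
  by rewrite (gt_eqF xgt0) implybT.
rewrite ler_wpM2l// (_ : - (2 * (1 - r) / r) = 2 / r * - (1 - r)); last by ring.
rewrite powRrM !powRN lef_pV2 ?posrE ?powR_gt0//.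
apply: ge0_ler_powR (ltW nx); rewrite ?nnegrE ?powR_ge0//; lra.
Qed.

End scalar_inequalities.

(** * A maximal inequality on finite weighted models *)

Definition mass (R : nmodType) (T : finType) (w : T -> R) (P : pred T) : R :=
  (\sum_(t | P t) w t)%R.

(** Two families of cubes, U and V, on a finite weighted set of points: U i and V i lie in a
    common W i of comparable mass, and em_engulf is the property behind Vitali's covering
    lemma, with sg i the scale of W i and Wh i its enlargement. *)
Record engulfing_model (R : realType) (T I : finType) (w : T -> R)
    (U V W Wh : I -> pred T) (sg : I -> int) (K : R) : Prop := EngulfingModel {
  em_w_ge0 : forall t, 0 <= w t;
  em_subUW : forall i t, U i t -> W i t;
  em_subVW : forall i t, V i t -> W i t;
  em_mU_gt0 : forall i, 0 < mass w (U i);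
  em_mW_le : forall i, mass w (W i) <= K * mass w (U i);
  em_engulf : forall i j t t', sg i <= sg j -> W i t -> W j t -> W i t' -> Wh j t';
  em_mWh_le : forall i, mass w (Wh i) <= K * mass w (W i)
}.

Section finite_model.
Close Scope classical_set_scope.
Variables (R : realType) (T I : finType) (w : T -> R) (U V W Wh : I -> pred T)
  (sg : I -> int) (K : R).
Hypotheses (em : engulfing_model w U V W Wh sg K) (K_ge0 : 0 <= K).
Local Notation mass := (mass w).

Let w_ge0 := em_w_ge0 em.
Let subUW := em_subUW em.
Let subVW := em_subVW em.
Let mU_gt0 := em_mU_gt0 em.
Let mW_le := em_mW_le em.
Let engulf := em_engulf em.
Let mWh_le := em_mWh_le em.

Lemma le_sum_sub (P Q : pred T) (f : T -> R) : (forall t, P t -> Q t) ->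
  (forall t, 0 <= f t) -> \sum_(t | P t) f t <= \sum_(t | Q t) f t.
Proof.
move=> PQ f0; rewrite [leRHS](bigID P)/= [leLHS](eq_bigl (fun t => Q t && P t)).
  by rewrite lerDl sumr_ge0.
by move=> t; apply/idP/andP => [Pt|[]//]; split => //; exact: PQ.
Qed.

Lemma mW_gt0 i : 0 < mass (W i).
Proof. by apply: lt_le_trans (mU_gt0 i) _; apply: le_sum_sub => //; exact: subUW. Qed.

Lemma W_neq0 i : exists t, W i t.
Proof.
apply/not_existsP => W0; have := mW_gt0 i; rewrite /mass big1 ?ltxx// => t Wt.
by have := W0 t; rewrite Wt.
Qed.

(** Greedy selection: keep a set of largest scale, discard the sets meeting it, which lie in
    its enlargement, and repeat. *)
Lemma vitali_selection (J : {set I}) : exists S : {set I},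
  [/\ S \subset J, forall i j t, i \in S -> j \in S -> W i t -> W j t -> i = j &
      forall j, j \in J -> exists2 s, s \in S & forall t, W j t -> Wh s t].
Proof.
have [n] := ubnP #|J|; elim: n J => // n IHn J /ltnSE Jn.
have [->|[i0 i0J]] := set_0Vmem J.
  by exists finset.set0; split => [|i j t|j]; rewrite ?finset.sub0set// inE.
case: (@Order.TotalTheory.arg_maxP _ _ I i0 (fun i => i \in J) sg i0J) => i iJ imax.
pose J' : {set I} := [set j in J | ~~ [exists t, W j t && W i t]]%SET.
have J'J : J' \subset J by apply/fintype.subsetP => j; rewrite inE => /andP[].
have [|S [SJ' Sdisj Scov]] := IHn J'.
  apply: leq_trans Jn; apply: proper_card; rewrite properE J'J /=.
  apply/fintype.subsetPn; exists i => //; rewrite inE iJ /= negbK.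
  by have [t Wt] := W_neq0 i; apply/existsP; exists t; rewrite Wt.
have notS j t : j \in S -> W j t -> W i t -> False.
  move=> /(fintype.subsetP SJ'); rewrite inE => /andP[_ /existsP jt] Wj Wi.
  by apply: jt; exists t; rewrite Wj.
exists (i |: S); split.
- by rewrite finset.subUset finset.sub1set iJ (fintype.subset_trans SJ').
- move=> j k t; rewrite !inE => /predU1P[->|jS] /predU1P[->|kS]// Wj Wk.
  + by case: (notS k t).
  + by case: (notS j t).
  + exact: Sdisj Wj Wk.
- move=> j jJ; have [/existsP [t /andP[Wj Wi]]|jJ'] := boolP [exists t, W j t && W i t].
    exists i; first by rewrite !inE eqxx.
    by move=> t'; exact: engulf (imax j jJ) Wj Wi.
  have [|s sS sc] := Scov j; first by rewrite inE jJ.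
  by exists s => //; rewrite inE sS orbT.
Qed.

Definition avg (g : T -> R) i := (\sum_(t | W i t) w t * g t) / mass (W i).
Definition maximal (g : T -> R) t := \big[Num.max/0]_(i | W i t) avg g i.
Definition covered (J : {set I}) t := [exists i in J, W i t].

Lemma maximal_ge0 g t : 0 <= maximal g t.
Proof. exact: bigmax_ge_id. Qed.

Lemma avg_le_maximal g i t : W i t -> avg g i <= maximal g t.
Proof. by move=> Wt; exact: le_bigmax_cond. Qed.

Lemma avg_ge0 g i : (forall t, 0 <= g t) -> 0 <= avg g i.
Proof.
move=> g0; rewrite divr_ge0 ?(ltW (mW_gt0 _))// sumr_ge0// => t _.
by rewrite mulr_ge0.
Qed.

(** The selected sets are disjoint, each carries its share of g, and their enlargements
    cover the union. *)
Lemma maximal_weak_type (g : T -> R) (J : {set I}) l : (forall t, 0 <= g t) ->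
  0 <= l -> (forall i, i \in J -> l <= avg g i) ->
  l * mass (covered J) <= K * \sum_(t | covered J t) w t * g t.
Proof.
move=> g0 l0 lJ; have [S [SJ Sdisj Scov]] := vitali_selection J.
have mD : mass (covered J) <= \sum_(s in S) mass (Wh s).
  rewrite /mass (exchange_big_dep predT)//= [leLHS]big_mkcond/=.
  apply: ler_sum => t _; case: ifPn => [/existsP [j /andP[jJ Wj]]|_].
    have [s sS sc] := Scov j jJ.
    rewrite (bigD1 s)/=; last by rewrite sS sc.
    by rewrite lerDl sumr_ge0.
  by rewrite sumr_ge0.
apply: (le_trans (ler_wpM2l l0 mD)).
apply: (@le_trans _ _ (l * \sum_(s in S) K * mass (W s))).
  by rewrite ler_wpM2l// ler_sum.
rewrite -mulr_sumr mulrCA ler_wpM2l// mulr_sumr.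
apply: (@le_trans _ _ (\sum_(s in S) \sum_(t | W s t) w t * g t)).
  apply: ler_sum => s sS.
  by rewrite -ler_pdivlMr ?mW_gt0//; apply: lJ; exact: (fintype.subsetP SJ).
rewrite (exchange_big_dep (covered J))/=; last first.
  by move=> s t sS Wt; apply/existsP; exists s; rewrite (fintype.subsetP SJ).
apply: ler_sum => t _; have wg0 : 0 <= w t * g t by rewrite mulr_ge0.
have [/existsP [s /andP[sS Ws]]|/existsPn nS] := boolP [exists s in S, W s t].
  rewrite (bigD1 s)/= ?sS// big1 ?addr0// => k /andP[/andP[kS Wk]].
  by rewrite (Sdisj k s t kS sS Wk Ws) eqxx.
by rewrite big_pred0// => s; apply/negbTE.
Qed.

(** Doob's inequality, by induction on the number of sets with average above v.  Let v' be the
    least of these averages.  At the points covered by J but not by J' the maximal function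
    equals v', and the weak type inequality at level v' pays for passing from v' to v. *)
Lemma maximal_doob (g : T -> R) (u : R) (J : {set I}) (v : R) : (forall t, 0 <= g t) -> 1 < u ->
  0 <= v -> (forall i, (i \in J) = (v < avg g i)) ->
  \sum_(t | covered J t) w t * (maximal g t `^ u - v `^ u) <=
  K * (u / (u - 1)) *
    \sum_(t | covered J t) w t * g t * (maximal g t `^ (u - 1) - v `^ (u - 1)).
Proof.
move=> g0 u1; have [n] := ubnP #|J|; elim: n J v => // n IHn J v /ltnSE Jn v0 Jv.
have [J0|[i0 i0J]] := set_0Vmem J.
  rewrite !big_pred0 ?mulr0// => t; apply/negbTE/existsPn => i; by rewrite J0 inE.
case: (@Order.TotalTheory.arg_minP _ _ I i0 (fun i => i \in J) (avg g) i0J) => i iJ imin.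
pose v' := avg g i; have vv' : v < v' by rewrite -Jv.
have v'0 : 0 < v' by exact: le_lt_trans vv'.
pose J' : {set I} := [set j | v' < avg g j]%SET.
have J'J : J' \subset J.
  by apply/fintype.subsetP => j; rewrite inE Jv => /(lt_trans vv').
have Jv' j : (j \in J') = (v' < avg g j) by rewrite inE.
have {}IHn := IHn J' v' _ (ltW v'0) Jv'.
have /IHn {}IHn : (#|J'| < n)%N.
  apply: leq_trans Jn; apply: proper_card; rewrite properE J'J /=.
  by apply/fintype.subsetPn; exists i => //; rewrite inE ltxx.
have Jle t : covered J' t -> covered J t.
  by move=> /existsP [j /andP[jJ' Wj]]; apply/existsP; exists j; rewrite (fintype.subsetP J'J).
have M_eq t : covered J t -> ~~ covered J' t -> maximal g t = v'.
  move=> /existsP [j /andP[jJ Wj]] /existsPn nJ'; apply/eqP; rewrite eq_le; apply/andP; split.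
    rewrite /maximal; elim/big_ind: _ => [||k Wk]; first exact: ltW.
      by move=> x y xv yv; rewrite ge_max xv.
    by have := nJ' k; rewrite Wk andbT inE -leNgt.
  exact: le_trans (imin j jJ) (avg_le_maximal _ Wj).
have split_sum (a : T -> R) (x : R) :
    \sum_(t | covered J t) a t * (maximal g t `^ x - v `^ x) =
    \sum_(t | covered J' t) a t * (maximal g t `^ x - v' `^ x) +
    (v' `^ x - v `^ x) * \sum_(t | covered J t) a t.
  rewrite mulr_sumr [X in _ = X + _]big_mkcond/=.
  rewrite [X in _ = X + _](bigID (covered J))/= [X in _ = _ + X + _]big1 ?addr0; last first.
    by move=> t nJ; case: ifPn => // /Jle; rewrite (negPf nJ).
  rewrite -big_split/=; apply: eq_bigr => t Jt; case: ifPn => [_|nJ'].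
    by ring.
  by rewrite (M_eq t)//; ring.
rewrite !split_sum mulrDr lerD//.
have := maximal_weak_type g0 (ltW v'0) (fun j jJ => imin j jJ).
set m := mass _; set s := \sum_(t | covered J t) _ => ms.
have m0 : 0 <= m by exact: sumr_ge0.
rewrite (@le_trans _ _ (v' * (u / (u - 1) * (v' `^ (u - 1) - v `^ (u - 1))) * m))//.
  by rewrite ler_wpM2r// powR_increment_le// v0 ltW.
have c0 : 0 <= u / (u - 1) * (v' `^ (u - 1) - v `^ (u - 1)).
  rewrite mulr_ge0//; first by rewrite divr_ge0; lra.
  rewrite subr_ge0; apply: ge0_ler_powR; rewrite ?nnegrE//; [lra|exact: ltW|exact: ltW].
rewrite mulrAC mulrC [leRHS](_ : _ = u / (u - 1) * (v' `^ (u - 1) - v `^ (u - 1)) * (K * s)); last by ring.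
by rewrite ler_wpM2l.
Qed.

(** After the previous inequality at level 0, Young's inequality produces half of the
    left-hand side, which is absorbed. *)
Lemma maximal_strong_type (g : T -> R) (u C : R) : (forall t, 0 <= g t) -> 1 < u ->
  (forall x y, 0 <= x -> 0 <= y ->
    K * (u / (u - 1)) * (x * y) <= C * x `^ u + 2^-1 * y `^ (u / (u - 1))) ->
  \sum_t w t * maximal g t `^ u <= 2 * C * \sum_t w t * g t `^ u.
Proof.
move=> g0 u1 young.
have u10 : u - 1 != 0 by rewrite gt_eqF// subr_gt0.
have u0 : u != 0 by rewrite gt_eqF// (lt_trans _ u1).
pose J : {set I} := [set i | 0 < avg g i]%SET.
have JP i : (i \in J) = (0 < avg g i) by rewrite inE.
have doob := maximal_doob g0 u1 (lexx 0) JP.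
rewrite !powR0// in doob.
have M0 t : ~~ covered J t -> maximal g t = 0.
  move=> /existsPn nJ; apply/eqP; rewrite eq_le maximal_ge0 andbT.
  rewrite /maximal; elim/big_ind: _ => [//|x y x0 y0|k Wk]; first by rewrite ge_max x0.
  by have := nJ k; rewrite Wk andbT inE -leNgt.
have all_covered (a : T -> R) x : x != 0 ->
    \sum_(t | covered J t) a t * (maximal g t `^ x - 0) = \sum_t a t * maximal g t `^ x.
  move=> x0; rewrite [LHS]big_mkcond/=; apply: eq_bigr => t _; case: ifPn => [_|nJ].
    by rewrite subr0.
  by rewrite M0// powR0// mulr0.
rewrite !all_covered// in doob.
have : K * (u / (u - 1)) * \sum_t w t * g t * maximal g t `^ (u - 1) <=
    C * (\sum_t w t * g t `^ u) + 2^-1 * \sum_t w t * maximal g t `^ u.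
  rewrite !mulr_sumr -big_split/=; apply: ler_sum => t _.
  have := young _ _ (g0 t) (powR_ge0 (maximal g t) (u - 1)).
  rewrite -powRrM (mulrCA (u - 1)) divff// mulr1 => /(ler_wpM2l (w_ge0 t)).
  by lra.
by move=> /(le_trans doob); lra.
Qed.

Definition sum_over (X : I -> pred T) (b : I -> R) t := \sum_(i | X i t) b i.
Definition max_over (X : I -> pred T) (b : I -> R) t := \big[Num.max/0]_(i | X i t) b i.

Variable b : I -> R.
Hypothesis b_ge0 : forall i, 0 <= b i.

Let F := sum_over U b.
Let G := sum_over V b.

Lemma sum_over_ge0 (X : I -> pred T) t : 0 <= sum_over X b t.
Proof. exact: sumr_ge0. Qed.

Lemma exchange_sum_over (X : I -> pred T) (h : T -> R) :
  \sum_t w t * (sum_over X b t * h t) = \sum_i b i * \sum_(t | X i t) w t * h t.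
Proof.
under eq_bigr do rewrite /sum_over mulr_suml mulr_sumr.
rewrite (exchange_big_dep predT)//=; apply: eq_bigr => i _.
by rewrite mulr_sumr; apply: eq_bigr => t _; ring.
Qed.

(** The average of h over W i is a lower bound of the maximal function on U i, and W i has
    mass at most K times that of U i. *)
Lemma sum_over_dual (h : T -> R) : (forall t, 0 <= h t) ->
  \sum_t w t * (G t * h t) <= K * \sum_t w t * (F t * maximal h t).
Proof.
move=> h0; rewrite !exchange_sum_over mulr_sumr; apply: ler_sum => i _.
rewrite mulrCA ler_wpM2l//.
apply: (@le_trans _ _ (mass (W i) * avg h i)).
  rewrite mulrC /avg divfK ?gt_eqF ?mW_gt0//.
  by apply: le_sum_sub => [t|t]; [exact: subVW|rewrite mulr_ge0].
apply: (@le_trans _ _ (K * mass (U i) * avg h i)); first by rewrite ler_wpM2r// avg_ge0.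
rewrite -mulrA ler_wpM2l// mulr_suml; apply: ler_sum => t Ut.
by rewrite ler_wpM2l// avg_le_maximal// subUW.
Qed.

Lemma sum_over_le1 : \sum_t w t * G t `^ 1 <= K * \sum_t w t * F t `^ 1.
Proof.
have E (X : I -> pred T) : \sum_t w t * sum_over X b t `^ 1 = \sum_i b i * mass (X i).
  transitivity (\sum_i b i * \sum_(t | X i t) w t * 1).
    rewrite -exchange_sum_over; apply: eq_bigr => t _.
    by rewrite powRr1 ?sum_over_ge0// mulr1.
  by apply: eq_bigr => i _; congr (_ * _); apply: eq_bigr => t _; rewrite mulr1.
rewrite !E mulr_sumr; apply: ler_sum => i _; rewrite mulrCA ler_wpM2l//.
by apply: le_trans (mW_le i); apply: le_sum_sub => //; exact: subVW.
Qed.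

(** Duality with h = G^(r - 1).  The maximal function is bounded in L^(r / (r - 1)), and since
    h^(r / (r - 1)) = G^r, Young's inequality lets the left-hand side absorb its
    contribution. *)
Lemma sum_over_gt1 (r Cm C : R) : 1 < r -> 0 <= Cm ->
  (forall h, (forall t, 0 <= h t) ->
    \sum_t w t * maximal h t `^ (r / (r - 1)) <= Cm * \sum_t w t * h t `^ (r / (r - 1))) ->
  (forall x y, 0 <= x -> 0 <= y ->
    K * (x * y) <= C * x `^ r + (2 * (1 + Cm))^-1 * y `^ (r / (r - 1))) ->
  \sum_t w t * G t `^ r <= 2 * C * \sum_t w t * F t `^ r.
Proof.
move=> r1 Cm0 strong; have [e eE] : exists e, e = (2 * (1 + Cm))^-1 by eexists.
rewrite -eE => young.
have r10 : r - 1 != 0 by rewrite gt_eqF// subr_gt0.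
pose h t := G t `^ (r - 1).
have h0 t : 0 <= h t by exact: powR_ge0.
have GE : \sum_t w t * G t `^ r = \sum_t w t * (G t * h t).
  by apply: eq_bigr => t _; rewrite powR_subM ?sum_over_ge0.
have hE : \sum_t w t * h t `^ (r / (r - 1)) = \sum_t w t * G t `^ r.
  by apply: eq_bigr => t _; rewrite /h -powRrM (mulrCA (r - 1)) divff// mulr1.
have := strong h h0; rewrite hE => Mh.
have dual := sum_over_dual h0; rewrite -GE in dual.
set SG := \sum_t w t * G t `^ r in dual Mh *.
set SM := \sum_t w t * maximal h t `^ _ in Mh.
have SG0 : 0 <= SG by rewrite sumr_ge0// => t _; rewrite mulr_ge0 ?powR_ge0.
have : K * \sum_t w t * (F t * maximal h t) <=
    C * (\sum_t w t * F t `^ r) + e * SM.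
  rewrite !mulr_sumr -big_split/=; apply: ler_sum => t _.
  have := young (F t) _ (sum_over_ge0 U t) (maximal_ge0 h t).
  by move=> /(ler_wpM2l (w_ge0 t)); lra.
move=> /(le_trans dual).
have : e * SM <= 2^-1 * SG.
  rewrite eE invfM -mulrA ler_wpM2l// ler_pdivrMl ?ltr_pwDl//.
  by rewrite (le_trans Mh)// ler_wpM2r// lerDr.
by lra.
Qed.

(** Jensen's inequality for x^(-k). *)
Lemma avg_powRN (f : T -> R) k (P : pred T) e : 0 <= k -> 0 < e ->
  (forall t, P t -> 0 < f t) -> \sum_(t | P t) w t * f t = e * mass P ->
  e `^ (- k) * mass P <= \sum_(t | P t) w t * f t `^ (- k).
Proof.
move=> k0 e0 f0 fe.
have : \sum_(t | P t) w t * ((1 + k) * e `^ (- k)) <=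
    \sum_(t | P t) w t * (f t `^ (- k) + k * (e `^ (- k) / e * f t)).
  by apply: ler_sum => t Pt; rewrite ler_wpM2l// powRN_tangent ?f0.
rewrite -mulr_suml -/(mass P); under eq_bigr do rewrite mulrDr.
rewrite big_split/=.
have -> : \sum_(t | P t) w t * (k * (e `^ (- k) / e * f t)) = k * e `^ (- k) * mass P.
  transitivity (k * (e `^ (- k) / e) * \sum_(t | P t) w t * f t).
    by rewrite mulr_sumr; apply: eq_bigr => t _; ring.
  by rewrite fe; field; rewrite gt_eqF.
lra.
Qed.

(** Unweighted duality fails for r < 1.  Let n be the maximal function of F^(r/2) and
    k = 2 (1 - r) / r, and split G^r <= G n^(-k) + n^2.  The maximal inequality in L^2 bounds
    the sum of n^2.  In the other sum, which is linear in the coefficients, n is at least a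
    multiple of the average of F^(r/2) over U i at all points of V i, so by Jensen's
    inequality for x^(-k) the weight n^(-k) is bounded there by a multiple of the average of
    F^(r - 1) over U i; this leaves the sum of F F^(r - 1) = F^r. *)
Lemma sum_over_lt1 (r Cm : R) : 0 < r < 1 -> 0 <= Cm ->
  (forall h, (forall t, 0 <= h t) ->
    \sum_t w t * maximal h t `^ 2 <= Cm * \sum_t w t * h t `^ 2) ->
  \sum_t w t * G t `^ r <=
    (K * K `^ (2 * (1 - r) / r) + Cm) * \sum_t w t * F t `^ r.
Proof.
move=> /andP[r0 r1] Cm0 strong.
pose k := 2 * (1 - r) / r.
have k0 : 0 <= k by rewrite /k divr_ge0 ?mulr_ge0//; lra.
pose f t := F t `^ (r / 2).
have f0 t : 0 <= f t by exact: powR_ge0.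
pose n := maximal f.
have fE : \sum_t w t * f t `^ 2 = \sum_t w t * F t `^ r.
  by apply: eq_bigr => t _; rewrite /f -powRrM divfK.
have K0 : I -> 0 < K.
  move=> i; rewrite lt_neqAle K_ge0 andbT eq_sym; apply/eqP => K0.
  by have := mW_le i; rewrite K0 mul0r leNgt mW_gt0.
have bF i t : 0 < b i -> U i t -> 0 < F t.
  by move=> bi Ut; rewrite /F /sum_over (bigD1 i)//= ltr_pwDl// sumr_ge0.
pose e i := (\sum_(t | U i t) w t * f t) / mass (U i).
have e0 i : 0 < b i -> 0 < e i.
  move=> bi; rewrite divr_gt0// lt_neqAle sumr_ge0 ?andbT; last first.
    by move=> t _; rewrite mulr_ge0.
  apply/eqP => /esym/psumr_eq0P; rewrite /= => s0.
  have := mU_gt0 i; rewrite /mass big1 ?ltxx// => t Ut.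
  have /eqP := s0 (fun t _ => mulr_ge0 (w_ge0 t) (f0 t)) t Ut.
  by rewrite mulf_eq0 => /orP[/eqP//|]; rewrite gt_eqF// powR_gt0// (bF i).
have en i t : V i t -> e i / K <= n t.
  move=> Vt; apply: le_trans (avg_le_maximal f (subVW Vt)).
  rewrite /e /avg -mulrA -invfM.
  apply: (@le_trans _ _ ((\sum_(t0 | U i t0) w t0 * f t0) / mass (W i))).
    rewrite ler_wpM2l ?sumr_ge0//; first by move=> s _; rewrite mulr_ge0.
    by rewrite lef_pV2 ?posrE ?mulr_gt0 ?mW_gt0 ?(K0 i)// mulrC.
  rewrite ler_wpM2r ?invr_ge0 ?(ltW (mW_gt0 i))// le_sum_sub// => s; first exact: subUW.
  by rewrite mulr_ge0.
have G_le t : G t `^ r <= G t * n t `^ (- k) + n t `^ 2.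
  have [G0|Gpos] := eqVneq (G t) 0.
    by rewrite G0 powR0 ?gt_eqF// mul0r add0r powR_ge0.
  rewrite powR_split_le ?r0 ?sum_over_ge0//.
  have [i /andP[Vt bi]] := psumr_neq0P (fun i _ => b_ge0 i) (elimN eqP Gpos).
  by apply: lt_le_trans (en i t Vt); rewrite divr_gt0 ?e0 ?(K0 i).
have GN : \sum_t w t * (G t * n t `^ (- k)) <= K * K `^ k * \sum_t w t * F t `^ r.
  have -> : \sum_t w t * F t `^ r = \sum_t w t * (F t * f t `^ (- k)).
    apply: eq_bigr => t _; rewrite /f -powRrM.
    have [->|Ft] := eqVneq (F t) 0; first by rewrite powR0 ?gt_eqF// mul0r.
    rewrite -{2}[F t]powRr1 ?sum_over_ge0// -powRD ?Ft ?implybT//.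
    by congr (_ * _ `^ _); rewrite /k; field; rewrite gt_eqF.
  rewrite !exchange_sum_over mulr_sumr; apply: ler_sum => i _.
  have [->|bi] := eqVneq (b i) 0; first by rewrite !mul0r mulr0.
  have {}bi : 0 < b i by rewrite lt_neqAle eq_sym bi b_ge0.
  rewrite mulrCA (ler_wpM2l (ltW bi))//.
  apply: (@le_trans _ _ (\sum_(t | V i t) w t * (K `^ k * e i `^ (- k)))).
    apply: ler_sum => t Vt; rewrite ler_wpM2l//.
    have eK : 0 < e i / K by rewrite divr_gt0 ?e0 ?(K0 i).
    apply: (@le_trans _ _ ((e i / K) `^ (- k))).
      rewrite !powRN lef_pV2 ?posrE ?powR_gt0 ?(lt_le_trans eK) ?en//.
      by apply: ge0_ler_powR; rewrite ?nnegrE ?maximal_ge0 ?en// ltW.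
    rewrite powRM ?invr_ge0 ?(ltW (e0 _ bi))// mulrC.
    by rewrite -[K^-1]powR_inv1// -powRrM mulN1r opprK.
  rewrite -mulr_suml -/(mass (V i)).
  have mVU : mass (V i) <= K * mass (U i).
    by apply: le_trans (mW_le i); apply: le_sum_sub => //; exact: subVW.
  apply: (@le_trans _ _ (K * mass (U i) * (K `^ k * e i `^ (- k)))).
    by rewrite ler_wpM2r// mulr_ge0 ?powR_ge0.
  rewrite [leLHS](_ : _ = K * K `^ k * (e i `^ (- k) * mass (U i))); last by ring.
  rewrite ler_wpM2l ?mulr_ge0 ?powR_ge0// avg_powRN ?e0//.
    by move=> t Ut; rewrite powR_gt0// (bF i).
  by rewrite /e divfK// gt_eqF.
rewrite (@le_trans _ _ (\sum_t w t * (G t * n t `^ (- k) + n t `^ 2)))//.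
  by apply: ler_sum => t _; rewrite ler_wpM2l.
under eq_bigr do rewrite mulrDr; rewrite big_split/= mulrDl lerD//.
by rewrite -fE; exact: strong.
Qed.

(** Pointwise, b i ^ (p/2) on V i is at most K times an average of the function
    (max_over U b)^(p/2), so the maximal inequality in L^2 applies. *)
Lemma max_over_le (p Cm : R) : 0 < p -> 0 <= Cm ->
  (forall h, (forall t, 0 <= h t) ->
    \sum_t w t * maximal h t `^ 2 <= Cm * \sum_t w t * h t `^ 2) ->
  \sum_t w t * max_over V b t `^ p <= K `^ 2 * Cm * \sum_t w t * max_over U b t `^ p.
Proof.
move=> p0 Cm0 strong.
pose h t := max_over U b t `^ (p / 2).
have h0 t : 0 <= h t by exact: powR_ge0.
have hE : \sum_t w t * h t `^ 2 = \sum_t w t * max_over U b t `^ p.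
  by apply: eq_bigr => t _; rewrite /h -powRrM divfK.
rewrite -hE -mulrA (le_trans _ (ler_wpM2l (powR_ge0 _ _) (strong h h0)))//.
rewrite mulr_sumr; apply: ler_sum => t _; rewrite mulrCA ler_wpM2l//.
have max_ge0 (X : I -> pred T) s : 0 <= max_over X b s by exact: bigmax_ge_id.
have -> : max_over V b t `^ p = (max_over V b t `^ (p / 2)) `^ 2 by rewrite -powRrM divfK.
rewrite -powRM ?maximal_ge0//.
apply: ge0_ler_powR; rewrite ?nnegrE ?powR_ge0 ?mulr_ge0 ?maximal_ge0//.
have bh i s : U i s -> b i `^ (p / 2) <= h s.
  move=> Us; apply: ge0_ler_powR; rewrite ?nnegrE ?divr_ge0 ?(ltW p0)//.
  exact: le_bigmax_cond.
have bM i : V i t -> b i `^ (p / 2) <= K * maximal h t.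
  move=> Vt; apply: (@le_trans _ _ (K * avg h i)); last first.
    by rewrite ler_wpM2l// avg_le_maximal// subVW.
  rewrite /avg mulrA ler_pdivlMr ?mW_gt0//.
  apply: (@le_trans _ _ (b i `^ (p / 2) * (K * mass (U i)))).
    by rewrite ler_wpM2l ?powR_ge0.
  rewrite mulrCA ler_wpM2l// mulr_sumr.
  apply: (@le_trans _ _ (\sum_(s | U i s) w s * h s)).
    by apply: ler_sum => s Us; rewrite mulrC ler_wpM2l// bh.
  by apply: le_sum_sub => s; [exact: subUW|rewrite mulr_ge0].
have [m0|m0] := eqVneq (max_over V b t) 0.
  by rewrite m0 powR0 ?mulr_ge0 ?maximal_ge0// gt_eqF// divr_gt0.
rewrite /max_over; elim/big_ind: _ => [|x y xM yM|i Vt].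
- by rewrite powR0 ?mulr_ge0 ?maximal_ge0// gt_eqF// divr_gt0.
- by rewrite /Num.max; case: ifP.
- exact: bM.
Qed.

End finite_model.

(** ** Bounds that depend on the model only through K *)
Section uniform_constants.
Variables (R : realType) (K : R).
Hypothesis K_ge0 : 0 <= K.

Lemma maximal_bound (u : R) : 1 < u -> exists2 C, 0 <= C &
  forall (T I : finType) (w : T -> R) (U V W Wh : I -> pred T) (sg : I -> int),
    engulfing_model w U V W Wh sg K -> forall h, (forall t, 0 <= h t) ->
    \sum_t w t * maximal w W h t `^ u <= C * \sum_t w t * h t `^ u.
Proof.
move=> u1; have [||C C0 young] := @young_absorb R (K * (u / (u - 1))) 2^-1 u u1.
- by rewrite mulr_ge0// divr_ge0//; lra.
- by rewrite invr_gt0.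
exists (2 * C) => [|T I w U V W Wh sg em h h0]; first exact: mulr_ge0.
exact: (maximal_strong_type em K_ge0 h0 u1 young).
Qed.

Lemma sum_over_bound (r : R) : 0 < r -> exists2 C, 0 <= C &
  forall (T I : finType) (w : T -> R) (U V W Wh : I -> pred T) (sg : I -> int),
    engulfing_model w U V W Wh sg K -> forall b, (forall i, 0 <= b i) ->
    \sum_t w t * sum_over V b t `^ r <= C * \sum_t w t * sum_over U b t `^ r.
Proof.
move=> r0; have [r1|r1|->] := ltgtP r 1.
- have [Cm Cm0 strong] := @maximal_bound 2 (ltac:(lra)).
  exists (K * K `^ (2 * (1 - r) / r) + Cm).
    by rewrite addr_ge0// mulr_ge0// powR_ge0.
  move=> T I w U V W Wh sg em b b0; have /(strong T I) {}strong := em.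
  by apply: (sum_over_lt1 em K_ge0 b0) => //; rewrite r0.
- have r'1 : 1 < r / (r - 1) by rewrite ltr_pdivlMr ?subr_gt0//; lra.
  have [Cm Cm0 strong] := maximal_bound r'1.
  have [|C C0 young] := @young_absorb R K (2 * (1 + Cm))^-1 r r1 K_ge0.
    by rewrite invr_gt0 mulr_gt0// ltr_pwDl.
  exists (2 * C); first exact: mulr_ge0.
  move=> T I w U V W Wh sg em b b0; have /(strong T I) {}strong := em.
  exact: (sum_over_gt1 em K_ge0 b0 r1 Cm0 strong young).
- exists K => // T I w U V W Wh sg em b b0.
  exact: (sum_over_le1 em b0).
Qed.

Lemma max_over_bound (p : R) : 0 < p -> exists2 C, 0 <= C &
  forall (T I : finType) (w : T -> R) (U V W Wh : I -> pred T) (sg : I -> int),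
    engulfing_model w U V W Wh sg K -> forall b, (forall i, 0 <= b i) ->
    \sum_t w t * max_over V b t `^ p <= C * \sum_t w t * max_over U b t `^ p.
Proof.
move=> p0; have [Cm Cm0 strong] := @maximal_bound 2 (ltac:(lra)).
exists (K `^ 2 * Cm); first by rewrite mulr_ge0// powR_ge0.
move=> T I w U V W Wh sg em b b0; have /(strong T I) {}strong := em.
exact: (max_over_le em K_ge0 b0 p0 Cm0 strong).
Qed.

End uniform_constants.

(** * Reduction of finite families of sets to weighted points *)

Section quadrature.
Context d (X : measurableType d) (R : realType) (mu : {measure set X -> \bar R}).
Variables (x0 : X) (J : finType) (E : J -> set X).
Hypotheses (mE : forall j, measurable (E j)) (E_fin : forall j, (mu (E j) < +oo)%E).

Definition membership (x : X) : {set J} := finset (fun j => `[< E j x >]).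
Definition atom (a : {set J}) : set X := membership @^-1` [set a].

Lemma measurable_atom a : measurable (atom a).
Proof.
rewrite (_ : atom a = \bigcap_(j in [set: J]) (if j \in a then E j else ~` E j)).
  by apply: fin_bigcap_measurable => // j _; case: ifP => _ //; exact: measurableC.
apply/seteqP; split => [x xa j _|x xa].
  by rewrite /= -xa inE; case: ifPn => /asboolP.
apply/setP => j; rewrite inE; have := xa j I; case: ifPn => _ /asboolP //.
by rewrite asbool_neg => /negbTE.
Qed.

Lemma membership_integral (phi : {set J} -> R) : (forall a, 0 <= phi a) ->
  (\int[mu]_x (phi (membership x))%:E = \sum_a (phi a)%:E * mu (atom a))%E.
Proof.
move=> phi0.
have -> : (fun x => (phi (membership x))%:E) =
    (fun x => \sum_a (phi a)%:E * (\1_(atom a) x)%:E)%E.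
  apply/funext => x; rewrite (bigD1 (membership x))//= big1 ?adde0.
    by rewrite indicE mem_set// mule1.
  by move=> a ax; rewrite indicE memNset ?mule0// => xa; move: ax; rewrite -xa eqxx.
have mi a : measurable_fun setT (fun x => (\1_(atom a) x : R)%:E).
  by apply/measurable_EFinP; apply: measurable_indic; exact: measurable_atom.
rewrite ge0_integral_sum//; last 2 first.
- by move=> a; apply: measurable_funeM; exact: mi.
- by move=> a x _; rewrite mule_ge0// lee_fin.
apply: eq_bigr => a _; rewrite ge0_integralZl_EFin//.
by rewrite integral_indic ?setIT//; exact: measurable_atom.
Qed.

(** A function of the memberships in the E j is constant on the atoms of the algebra that they
    generate, so one point per nonempty atom, weighted by the measure of the atom, computes
    its integral.  The atom outside of all E j may have infinite measure, whence the
    condition on the value at the empty set. *)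
Lemma finite_quadrature : exists (w : {set J} -> R) (pt : {set J} -> X),
  (forall a, 0 <= w a) /\ forall phi : {set J} -> R, (forall a, 0 <= phi a) ->
    phi finset.set0 = 0 ->
    (\int[mu]_x (phi (membership x))%:E = (\sum_a w a * phi (membership (pt a)))%R%:E)%E.
Proof.
(* x0 is a default value: an empty atom has weight 0 and contains no point. *)
pose pt a := if pselect (exists x, membership x = a) is left ex then projT1 (cid ex) else x0.
have atom_fin a : a != finset.set0 -> mu (atom a) \is a fin_num.
  move=> /finset.set0Pn[j ja]; rewrite ge0_fin_numE ?measure_ge0//.
  apply: le_lt_trans (E_fin j); apply: le_measure; rewrite ?inE//.
    exact: measurable_atom.
  by move=> x xa; move: ja; rewrite -xa inE => /asboolP.
exists (fun a => fine (mu (atom a))), pt; split => [a|phi phi0 phi00].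
  by rewrite fine_ge0.
rewrite membership_integral// -sumEFin; apply: eq_bigr => a _.
have [-> |a0] := eqVneq a finset.set0.
  rewrite phi00 mul0e /pt; case: pselect => [ex|nex].
    by rewrite (projT2 (cid ex)) phi00 mulr0.
  rewrite (_ : atom _ = set0) ?measure0 ?mul0r//.
  by apply/seteqP; split => // x xa; apply: nex; exists x.
rewrite muleC EFinM fineK ?atom_fin//; rewrite /pt; case: pselect => [ex|nex].
  by rewrite (projT2 (cid ex)).
rewrite (_ : atom a = set0) ?measure0 ?mul0e//.
by apply/seteqP; split => // x xa; apply: nex; exists x.
Qed.

End quadrature.

(** The counterpart of engulfing_model for measurable sets. *)
Record engulfing_family d (X : measurableType d) (R : realType)
    (mu : {measure set X -> \bar R}) (I : Type) (U V W Wh : I -> set X) (sg : I -> int) (K : R) : Prop :=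
  EngulfingFamily {
  ef_mU : forall i, measurable (U i);
  ef_mV : forall i, measurable (V i);
  ef_mW : forall i, measurable (W i);
  ef_mWh : forall i, measurable (Wh i);
  ef_UW : forall i, U i `<=` W i;
  ef_VW : forall i, V i `<=` W i;
  ef_U_gt0 : forall i, (0 < mu (U i))%E;
  ef_W_fin : forall i, (mu (W i) < +oo)%E;
  ef_W_le : forall i, (mu (W i) <= K%:E * mu (U i))%E;
  ef_engulf : forall i j, sg i <= sg j -> W i `&` W j !=set0 -> W i `<=` Wh j;
  ef_Wh_le : forall i, (mu (Wh i) <= K%:E * mu (W i))%E }.

Section engulfing_family.
Context d (X : measurableType d) (R : realType) (mu : {measure set X -> \bar R}).
Variables (x0 : X) (I : finType) (U V W Wh : I -> set X) (sg : I -> int) (K : R).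
Hypothesis K_ge0 : 0 <= K.
Hypothesis ef : engulfing_family mu U V W Wh sg K.

Let J := (bool * bool * I)%type.
Let E (j : J) : set X :=
  match j with
  | (true, true, i) => U i
  | (true, false, i) => V i
  | (false, true, i) => W i
  | (false, false, i) => Wh i
  end.

(** The axioms of an engulfing family and the integrals at stake only involve measures of sets
    of the four families and memberships, which finite quadrature preserves. *)
Lemma engulfing_discretization : exists (T : finType) (w : T -> R) (pt : T -> X),
  let P (S : I -> set X) i t := `[< S i (pt t) >] in
  engulfing_model w (P U) (P V) (P W) (P Wh) sg K /\
  forall (S : I -> set X) (psi : {set I} -> R),
    (S = U \/ S = V) -> (forall a, 0 <= psi a) -> psi finset.set0 = 0 ->
    (\int[mu]_x (psi (finset (fun i => `[< S i x >])))%:E =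
    (\sum_t w t * psi (finset (fun i => `[< S i (pt t) >])))%R%:E)%E.
Proof.
case: ef => mU mV mW mWh UW VW U0 Wfin Wle eng Whle.
have mE j : measurable (E j) by case: j => [[[] []] i] /=.
have Efin j : (mu (E j) < +oo)%E.
  case: j => [[[] []] i] //=.
  - by apply: le_lt_trans (Wfin i); rewrite le_measure ?inE.
  - by apply: le_lt_trans (Wfin i); rewrite le_measure ?inE.
  - by apply: le_lt_trans (Whle i) _; rewrite lte_mul_pinfty.
have [w [pt [w0 quad]]] := finite_quadrature x0 mE Efin.
exists {set J}, w, pt => P.
pose ind (j : J) (a : {set J}) : R := (j \in a)%:R.
have mass_ind j : (mu (E j) = (mass w (fun a => `[< E j (pt a) >]))%:E)%E.
  have := quad (ind j) (fun a => ler0n _ _) (ltac:(by rewrite /ind inE)).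
  rewrite (eq_integral (fun x => (\1_(E j) x)%:E)); last first.
    by move=> x _; rewrite /ind inE indicE; congr (_%:R%:E); apply/idP/idP => [/asboolP/mem_set|/set_mem/asboolP].
  rewrite integral_indic// setIT => ->; congr EFin; rewrite /mass [RHS]big_mkcond/=.
  by apply: eq_bigr => a _; rewrite /ind inE; case: asboolP => _; rewrite ?mulr1 ?mulr0.
have mPU i : mu (U i) = (mass w (P U i))%:E := mass_ind (true, true, i).
have mPW i : mu (W i) = (mass w (P W i))%:E := mass_ind (false, true, i).
have mPWh i : mu (Wh i) = (mass w (P Wh i))%:E := mass_ind (false, false, i).
split.
  split => //.
  - by move=> i t /asboolP/UW/asboolP.
  - by move=> i t /asboolP/VW/asboolP.
  - by move=> i; rewrite -lte_fin -mPU.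
  - by move=> i; rewrite -lee_fin EFinM -mPU -mPW.
  - move=> i j t t' ij /asboolP Wi /asboolP Wj /asboolP Wi'; apply/asboolP.
    by apply: eng ij _ _ Wi'; exists (pt t).
  - by move=> i; rewrite -lee_fin EFinM -mPWh -mPW.
move=> S psi SUV psi0 psi00.
have [b Sb] : exists b, forall i, S i = E (true, b, i).
  by case: SUV => ->; [exists true|exists false].
pose phi (a : {set J}) := psi (finset (fun i => (true, b, i) \in a)).
have phiE x : phi (membership E x) = psi (finset (fun i => `[< S i x >])).
  by congr psi; apply/setP => i; rewrite !inE Sb.
have := quad phi (fun a => psi0 _).
rewrite (_ : phi finset.set0 = 0); last first.
  by rewrite /phi -[RHS]psi00; congr psi; apply/setP => i; rewrite !inE.
move=> /(_ erefl); under eq_integral do rewrite phiE; move=> ->.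
by congr EFin; apply: eq_bigr => a _; rewrite phiE.
Qed.

End engulfing_family.

(** * Countable families by monotone convergence *)

Lemma engulfing_family_comp d (X : measurableType d) (R : realType)
    (mu : {measure set X -> \bar R}) (I I' : Type) (e : I' -> I) (U V W Wh : I -> set X)
    (sg : I -> int) (K : R) : engulfing_family mu U V W Wh sg K ->
  engulfing_family mu (U \o e) (V \o e) (W \o e) (Wh \o e) (sg \o e) K.
Proof.
by case=> mU mV mW mWh UW VW U0 Wf Wl eng Whl; split => //= i j; exact: eng.
Qed.

Lemma poweR_ereal_sup (R : realType) (T : Type) (u : T -> \bar R) (r : R) : 0 < r ->
  (forall n, 0 <= u n)%E -> [set: T] !=set0 ->
  (ereal_sup (range u) `^ r = ereal_sup (range (fun n => u n `^ r)))%E.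
Proof.
move=> r0 u0 [n0 _].
have sup0 (v : T -> \bar R) : (forall n, 0 <= v n)%E -> (0 <= ereal_sup (range v))%E.
  by move=> v0; apply: le_trans (v0 n0) _; apply: ereal_sup_ubound; exists n0.
have le_pow (s : R) (x y : \bar R) : 0 < s -> (0 <= x)%E -> (x <= y)%E -> (x `^ s <= y `^ s)%E.
  move=> s0 x0 xy; apply: gt0_ler_poweR => //; rewrite ?ltW// in_itv/= leey andbT//.
  exact: le_trans xy.
apply/eqP; rewrite eq_le; apply/andP; split; last first.
  apply: ge_ereal_sup => _ [n _ <-]; apply: (le_pow _) => //.
  by apply: ereal_sup_ubound; exists n.
have uE n : (u n = (u n `^ r) `^ r^-1)%E.
  by rewrite -poweRrM divff ?gt_eqF// poweRe1.
have s0 : (0 <= ereal_sup (range (fun n => u n `^ r)))%E.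
  by apply: sup0 => n; exact: poweR_ge0.
rewrite -[leRHS]poweRe1// -(@mulVf _ r) ?gt_eqF// poweRrM.
apply: (le_pow _) => //; first exact: sup0.
apply: ge_ereal_sup => _ [n _ <-]; rewrite uE; apply: (le_pow _).
- by rewrite invr_gt0.
- exact: poweR_ge0.
- by apply: ereal_sup_ubound; exists n.
Qed.

Section monotone_limit.
Context d (X : measurableType d) (R : realType) (mu : {measure set X -> \bar R}).
Variables (g f : nat -> X -> R) (r C : R).
Hypotheses (r_gt0 : 0 < r) (C_ge0 : 0 <= C).
Hypotheses (g_ge0 : forall n x, 0 <= g n x) (f_ge0 : forall n x, 0 <= f n x).
Hypotheses (mg : forall n, measurable_fun setT (g n)) (mf : forall n, measurable_fun setT (f n)).
Hypotheses (ndg : forall x, nondecreasing_seq (g ^~ x)) (ndf : forall x, nondecreasing_seq (f ^~ x)).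

Let sup_of (h : nat -> X -> R) x := ereal_sup (range (fun n => (h n x)%:E)).

Lemma integral_sup_power (h : nat -> X -> R) : (forall n x, 0 <= h n x) ->
  (forall n, measurable_fun setT (h n)) -> (forall x, nondecreasing_seq (h ^~ x)) ->
  (\int[mu]_x ((h n x) `^ r)%:E)%E @[n --> \oo] --> (\int[mu]_x (sup_of h x `^ r))%E.
Proof.
move=> h0 mh ndh.
have nd x : nondecreasing_seq (fun n => ((h n x) `^ r)%:E).
  move=> m n mn; rewrite lee_fin; apply: ge0_ler_powR; rewrite ?nnegrE ?(ltW r_gt0)//.
  exact: ndh.
have -> : (fun x => sup_of h x `^ r)%E = (fun x => limn (fun n => ((h n x) `^ r)%:E)).
  apply/funext => x; apply/esym/cvg_lim => //.
  rewrite /sup_of poweR_ereal_sup//; last by move=> n; rewrite lee_fin.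
  rewrite (_ : ereal_sup _ = ereal_sup (range (fun n => ((h n x) `^ r)%:E))).
    exact: ereal_nondecreasing_cvgn.
  by congr ereal_sup; apply: eq_imagel => n _; rewrite poweR_EFin.
apply: cvg_monotone_convergence => //.
- by move=> n; apply/measurable_EFinP; exact: (measurableT_comp (measurable_powR _)).
- by move=> n x _; rewrite lee_fin powR_ge0.
Qed.

Lemma measurable_sup_of (h : nat -> X -> R) :
  (forall n, measurable_fun setT (h n)) -> (forall x, nondecreasing_seq (h ^~ x)) ->
  measurable_fun setT (sup_of h).
Proof.
move=> mh ndh; apply: (@emeasurable_fun_cvg _ _ _ _ (fun n x => (h n x)%:E)).
  by move=> n; exact/measurable_EFinP.
by move=> x _; apply: ereal_nondecreasing_cvgn => m n mn; rewrite lee_fin; exact: ndh.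
Qed.

Lemma integral_sup_power_le :
  (forall n, \int[mu]_x ((g n x) `^ r)%:E <= C%:E * \int[mu]_x ((f n x) `^ r)%:E)%E ->
  (\int[mu]_x (sup_of g x `^ r) <= C%:E * \int[mu]_x (sup_of f x `^ r))%E.
Proof.
move=> gf; rewrite -(cvg_lim _ (integral_sup_power g_ge0 mg ndg))//.
apply: lime_le; first by apply/cvg_ex; eexists; exact: integral_sup_power.
apply: nearW => n; apply: le_trans (gf n) _.
rewrite lee_wpmul2l ?lee_fin// -(cvg_lim _ (integral_sup_power f_ge0 mf ndf))//.
set u := (X in limn X).
have /ereal_nondecreasing_cvgn/cvg_lim -> // : nondecreasing_seq u.
  move=> m k mk; apply: ge0_le_integral => //.
  - by move=> x _; rewrite lee_fin powR_ge0.
  - by apply/measurable_EFinP; exact: (measurableT_comp (measurable_powR _)).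
  - by apply/measurable_EFinP; exact: (measurableT_comp (measurable_powR _)).
  - move=> x _; rewrite lee_fin; apply: ge0_ler_powR; rewrite ?nnegrE ?(ltW r_gt0)//.
    exact: ndf.
by apply: ereal_sup_ubound; exists n.
Qed.

End monotone_limit.

Lemma indic_asbool (R : pzRingType) (T : Type) (A : set T) x : \1_A x = `[< A x >]%:R :> R.
Proof. by rewrite indicE; congr (_%:R); apply/idP/asboolP; rewrite inE. Qed.

Section sequence_bounds.
Context d (X : measurableType d) (R : realType) (mu : {measure set X -> \bar R}).
Variable x0 : X.

Definition partial_sum (S : nat -> set X) (b : nat -> R) n x : R :=
  \sum_(i < n) b i * \1_(S i) x.
Definition partial_max (S : nat -> set X) (b : nat -> R) n x : R :=
  \big[Num.max/0]_(i < n) (b i * \1_(S i) x).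

Section partial.
Variables (S : nat -> set X) (b : nat -> R).
Hypotheses (mS : forall i, measurable (S i)) (b_ge0 : forall i, 0 <= b i).

Let term_ge0 i x : 0 <= b i * \1_(S i) x.
Proof. exact: mulr_ge0. Qed.

Let mterm i : measurable_fun setT (fun x => b i * \1_(S i) x : R).
Proof. by apply: measurable_funM => //; exact: measurable_indic. Qed.

Lemma partial_sum_ge0 n x : 0 <= partial_sum S b n x.
Proof. exact: sumr_ge0. Qed.

Lemma partial_max_ge0 n x : 0 <= partial_max S b n x.
Proof. exact: bigmax_ge_id. Qed.

Lemma nondecreasing_partial_sum x : nondecreasing_seq (partial_sum S b ^~ x).
Proof.
apply/nondecreasing_seqP => n.
by rewrite /partial_sum big_ord_recr/= lerDl.
Qed.

Lemma nondecreasing_partial_max x : nondecreasing_seq (partial_max S b ^~ x).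
Proof.
apply/nondecreasing_seqP => n.
apply/bigmax_leP; split => [|i _]; first exact: partial_max_ge0.
exact: (le_bigmax _ (fun j : 'I_n.+1 => b j * \1_(S j) x) (widen_ord (leqnSn n) i)).
Qed.

Lemma measurable_partial_sum n : measurable_fun setT (partial_sum S b n).
Proof. exact: measurable_sum. Qed.

Lemma measurable_partial_max n : measurable_fun setT (partial_max S b n).
Proof.
rewrite /partial_max; elim: (index_enum 'I_n) => [|i s IHs].
  by under eq_fun do rewrite big_nil; exact: measurable_cst.
by under eq_fun do rewrite big_cons; exact: measurable_maxr.
Qed.

Lemma ereal_sup_partial_sum x :
  ereal_sup (range (fun n => (partial_sum S b n x)%:E)) =
  (\sum_(i <oo) (b i * \1_(S i) x)%:E)%E.
Proof.
have E : (fun n => (partial_sum S b n x)%:E) =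
    (fun n => \sum_(0 <= i < n) (b i * \1_(S i) x)%:E)%E.
  by apply/funext => n; rewrite /partial_sum -sumEFin big_mkord.
rewrite E; apply/esym/cvg_lim => //; rewrite -E.
by apply: ereal_nondecreasing_cvgn => m n mn; rewrite lee_fin; exact: nondecreasing_partial_sum.
Qed.

Lemma ereal_sup_partial_max x :
  ereal_sup (range (fun n => (partial_max S b n x)%:E)) =
  ereal_sup (range (fun i => (b i * \1_(S i) x)%:E)).
Proof.
apply/eqP; rewrite eq_le; apply/andP; split; apply: ge_ereal_sup => _ [n _ <-].
  have sup0 : (0 <= ereal_sup (range (fun i => (b i * \1_(S i) x)%:E)))%E.
    apply: (@le_trans _ _ (b 0%N * \1_(S 0%N) x)%:E); first by rewrite lee_fin.
    by apply: ereal_sup_ubound; exists 0%N.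
  rewrite /partial_max; elim/big_ind: _ => [//|u v uS vS|i _].
    by rewrite /Num.max; case: ifP.
  by apply: ereal_sup_ubound; exists (nat_of_ord i).
apply: (@le_trans _ _ (partial_max S b n.+1 x)%:E); last by apply: ereal_sup_ubound; exists n.+1.
by rewrite lee_fin; exact: (le_bigmax _ (fun j : 'I_n.+1 => b j * \1_(S j) x) ord_max).
Qed.

End partial.

Variables (K : R) (K_ge0 : 0 <= K).

(** A single quadrature serves both families, sums and maxima, and all exponents. *)
Lemma discretize_family (U V W Wh : nat -> set X) (sg : nat -> int) (b : nat -> R) n :
  engulfing_family mu U V W Wh sg K ->
  exists (T : finType) (w : T -> R) (U' V' W' Wh' : 'I_n -> pred T),
    engulfing_model w U' V' W' Wh' (fun i => sg i) K /\
    forall r, 0 < r ->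
    [/\ (\int[mu]_x ((partial_sum U b n x) `^ r)%:E =
          (\sum_t w t * sum_over U' (fun i => b i) t `^ r)%R%:E)%E,
        (\int[mu]_x ((partial_sum V b n x) `^ r)%:E =
          (\sum_t w t * sum_over V' (fun i => b i) t `^ r)%R%:E)%E,
        (\int[mu]_x ((partial_max U b n x) `^ r)%:E =
          (\sum_t w t * max_over U' (fun i => b i) t `^ r)%R%:E)%E &
        (\int[mu]_x ((partial_max V b n x) `^ r)%:E =
          (\sum_t w t * max_over V' (fun i => b i) t `^ r)%R%:E)%E].
Proof.
move=> /(engulfing_family_comp (fun i : 'I_n => nat_of_ord i)).
move=> /(engulfing_discretization x0 K_ge0)[T [w [pt [em quad]]]].
exists T, w; do 4 eexists; split; first exact: em.
move=> r r0.
pose psum (a : {set 'I_n}) := (\sum_(i in a) b i) `^ r.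
pose pmax (a : {set 'I_n}) := (\big[Num.max/0]_(i in a) b i) `^ r.
have psum0 : psum finset.set0 = 0 by rewrite /psum big_set0 powR0 ?gt_eqF.
have pmax0 : pmax finset.set0 = 0 by rewrite /pmax big_set0 powR0 ?gt_eqF.
have sumE (S : nat -> set X) x :
    (partial_sum S b n x) `^ r = psum (finset (fun i : 'I_n => `[< S i x >])).
  congr (_ `^ _); rewrite /partial_sum [RHS]big_mkcond/=; apply: eq_bigr => i _.
  by rewrite inE indic_asbool; case: asboolP => _; rewrite ?mulr1 ?mulr0.
have maxE (S : nat -> set X) x :
    (partial_max S b n x) `^ r = pmax (finset (fun i : 'I_n => `[< S i x >])).
  congr (_ `^ _); rewrite /partial_max [RHS]bigmax_mkcond/=; apply: eq_bigr => i _.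
  by rewrite inE indic_asbool; case: asboolP => _; rewrite ?mulr1 ?mulr0.
have qsum S SUV := quad S psum SUV (fun a => powR_ge0 _ _) psum0.
have qmax S SUV := quad S pmax SUV (fun a => powR_ge0 _ _) pmax0.
split.
- under eq_integral do rewrite sumE.
  rewrite qsum; last by left.
  congr EFin; apply: eq_bigr => t _; rewrite /psum /sum_over; congr (_ * _ `^ _).
  by apply: eq_bigl => i; rewrite inE.
- under eq_integral do rewrite sumE.
  rewrite qsum; last by right.
  congr EFin; apply: eq_bigr => t _; rewrite /psum /sum_over; congr (_ * _ `^ _).
  by apply: eq_bigl => i; rewrite inE.
- under eq_integral do rewrite maxE.
  rewrite qmax; last by left.
  congr EFin; apply: eq_bigr => t _; rewrite /pmax /max_over; congr (_ * _ `^ _).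
  by apply: eq_bigl => i; rewrite inE.
- under eq_integral do rewrite maxE.
  rewrite qmax; last by right.
  congr EFin; apply: eq_bigr => t _; rewrite /pmax /max_over; congr (_ * _ `^ _).
  by apply: eq_bigl => i; rewrite inE.
Qed.

Theorem sum_seq_bound r : 0 < r -> exists2 C, 0 <= C &
  forall (U V W Wh : nat -> set X) (sg : nat -> int),
  engulfing_family mu U V W Wh sg K -> forall b, (forall i, 0 <= b i) ->
  (\int[mu]_x ((\sum_(i <oo) (b i * \1_(V i) x)%:E) `^ r) <=
   C%:E * \int[mu]_x ((\sum_(i <oo) (b i * \1_(U i) x)%:E) `^ r))%E.
Proof.
move=> r0; have [C C0 bound] := sum_over_bound K_ge0 r0.
exists C => // U V W Wh sg ef b b0; have [mU mV _ _ _ _ _ _ _ _ _] := ef.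
under eq_integral do rewrite -ereal_sup_partial_sum//.
under [in leRHS]eq_integral do rewrite -ereal_sup_partial_sum//.
apply: (integral_sup_power_le r0 C0).
- by move=> n x; exact: partial_sum_ge0.
- by move=> n x; exact: partial_sum_ge0.
- by move=> n; exact: measurable_partial_sum.
- by move=> n; exact: measurable_partial_sum.
- by move=> x; exact: nondecreasing_partial_sum.
- by move=> x; exact: nondecreasing_partial_sum.
move=> n; have [T [w [U' [V' [W' [Wh' [em E]]]]]]] := discretize_family b n ef.
have [-> -> _ _] := E r r0.
by rewrite -EFinM lee_fin; apply: (bound _ _ _ _ _ _ _ _ em) => i; exact: b0.
Qed.

Theorem max_seq_bound r : 0 < r -> exists2 C, 0 <= C &
  forall (U V W Wh : nat -> set X) (sg : nat -> int),
  engulfing_family mu U V W Wh sg K -> forall b, (forall i, 0 <= b i) ->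
  (\int[mu]_x (ereal_sup (range (fun i => (b i * \1_(V i) x)%:E)) `^ r) <=
   C%:E * \int[mu]_x (ereal_sup (range (fun i => (b i * \1_(U i) x)%:E)) `^ r))%E.
Proof.
move=> r0; have [C C0 bound] := max_over_bound K_ge0 r0.
exists C => // U V W Wh sg ef b b0; have [mU mV _ _ _ _ _ _ _ _ _] := ef.
under eq_integral do rewrite -ereal_sup_partial_max//.
under [in leRHS]eq_integral do rewrite -ereal_sup_partial_max//.
apply: (integral_sup_power_le r0 C0).
- by move=> n x; exact: partial_max_ge0.
- by move=> n x; exact: partial_max_ge0.
- by move=> n; exact: measurable_partial_max.
- by move=> n; exact: measurable_partial_max.
- by move=> x; exact: nondecreasing_partial_max.
- by move=> x; exact: nondecreasing_partial_max.
move=> n; have [T [w [U' [V' [W' [Wh' [em E]]]]]]] := discretize_family b n ef.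
have [_ _ -> ->] := E r r0.
by rewrite -EFinM lee_fin; apply: (bound _ _ _ _ _ _ _ _ em) => i; exact: b0.
Qed.

End sequence_bounds.

(** * Norms in L^p(l^q) of countable families *)

Lemma enumerate_countType (I : countType) (g : nat -> I) : injective g ->
  exists (e : nat -> I) (f : I -> nat), cancel e f /\ cancel f e.
Proof.
move=> ginj.
have : ([set: I] #= [set: nat])%card.
  rewrite card_eq_le; apply/andP; split; first exact: countableP.
  apply/infiniteP => finI; apply: infinite_nat.
  rewrite -(preimage_setT g); apply: finite_preimage finI.
  by move=> m n _ _ /ginj.
move=> /card_set_bijP[f [_ finj fsurj]].
have [e fe] : exists e, cancel e f.
  have fs n : exists i, f i = n by have [i _ <-] := fsurj n Logic.I; exists i.
  by have [e fe] := boolp.choice fs; exists e.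
exists e, f; split => // i; apply: finj; rewrite ?inE//; exact: fe.
Qed.

Section lq_functions.
Context d (X : measurableType d) (R : realType) (mu : {measure set X -> \bar R}).
Variables (x0 : X) (I : choiceType) (e : nat -> I) (f : I -> nat).
Hypotheses (ef : cancel e f) (fe : cancel f e).

Implicit Types (a : I -> R) (S : I -> set X) (q : \bar R).

Definition lq_term a S i x : R := a i * \1_(S i) x.

Definition lq_fun q a S x : \bar R :=
  if q is r%:E then ((\esum_(i in [set: I]) ((lq_term a S i x) `^ r)%:E) `^ r^-1)%E
  else ereal_sup (range (fun i => (lq_term a S i x)%:E)).

Lemma esum_enumerate (h : I -> \bar R) : (forall i, 0 <= h i)%E ->
  (\esum_(i in [set: I]) h i = \sum_(n <oo) h (e n))%E.
Proof.
move=> h0; rewrite nneseries_esumT//; apply: reindex_esum; split => //.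
- by move=> m n _ _ mn; rewrite -(ef m) mn ef.
- by move=> i _; exists (f i).
Qed.

Lemma range_enumerate (T : Type) (h : I -> T) : range h = range (h \o e).
Proof.
apply/seteqP; split => [_ [i _ <-]|_ [n _ <-]]; last by exists (e n).
by exists (f i); rewrite //= fe.
Qed.

Lemma lq_term_power a S r i x : 0 < r -> 0 <= a i ->
  (lq_term a S i x) `^ r = (a i) `^ r * \1_(S i) x.
Proof.
move=> r0 a0; rewrite /lq_term indic_asbool; case: asboolP => _.
  by rewrite !mulr1.
by rewrite !mulr0 powR0 ?gt_eqF.
Qed.

Lemma lq_term_ge0 a S i x : 0 <= a i -> 0 <= lq_term a S i x.
Proof. by move=> a0; rewrite mulr_ge0. Qed.

Lemma lq_fun_ge0 q a S x : (forall i, 0 <= a i) -> (0 <= lq_fun q a S x)%E.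
Proof.
move=> a0; have sup0 : (0 <= ereal_sup (range (fun i => (lq_term a S i x)%:E)))%E.
  apply: (@le_trans _ _ (lq_term a S (e 0%N) x)%:E); first by rewrite lee_fin lq_term_ge0.
  by apply: ereal_sup_ubound; exists (e 0%N).
by case: q => [r||] //=; exact: poweR_ge0.
Qed.

Section measurable.
Variables (S : I -> set X) (a : I -> R).
Hypotheses (mS : forall i, measurable (S i)) (a0 : forall i, 0 <= a i).

Lemma lq_fun_finE r x : 0 < r ->
  (lq_fun r%:E a S x = (\sum_(n <oo) ((a \o e) n `^ r * \1_((S \o e) n) x)%:E) `^ r^-1)%E.
Proof.
move=> r0; rewrite /lq_fun esum_enumerate; last by move=> i; rewrite lee_fin powR_ge0.
by congr (_ `^ _)%E; apply: eq_eseriesr => n _; rewrite lq_term_power.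
Qed.

Lemma lq_fun_supE q x : ~~ (q \is a fin_num) ->
  (lq_fun q a S x = ereal_sup (range (fun n => ((a \o e) n * \1_((S \o e) n) x)%:E)))%E.
Proof. by case: q => [r||] //= _; rewrite range_enumerate. Qed.

Lemma measurable_lq_fun q : (0 < q)%E -> measurable_fun setT (lq_fun q a S).
Proof.
case: q => [r||] //; rewrite ?lte_fin => r0.
  have b0 n : 0 <= (a \o e) n `^ r by exact: powR_ge0.
  have -> : lq_fun r%:E a S = (fun x => ereal_sup (range
      (fun n => (partial_sum (S \o e) (fun n => (a \o e) n `^ r) n x)%:E)) `^ r^-1)%E.
    by apply/funext => x; rewrite lq_fun_finE// ereal_sup_partial_sum.
  apply: (measurableT_comp (measurable_poweR r^-1)).
  apply: (measurable_sup_of (h := partial_sum _ _)) => [n|x]; last exact: nondecreasing_partial_sum.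
  by apply: measurable_partial_sum => i; exact: mS.
have -> : lq_fun +oo a S = (fun x => ereal_sup (range
    (fun n => (partial_max (S \o e) (a \o e) n x)%:E))).
  apply/funext => x; rewrite lq_fun_supE// ereal_sup_partial_max// => n.
  exact: a0.
apply: (measurable_sup_of (h := partial_max _ _)) => [n|x].
  by apply: measurable_partial_max => i; exact: mS.
by apply: nondecreasing_partial_max => i; exact: a0.
Qed.

End measurable.

Lemma Lnorm_fin_ge0 (p : R) (h : X -> \bar R) : (forall x, 0 <= h x)%E ->
  ('N[mu]_p%:E[h] = (\int[mu]_x (h x `^ p)) `^ p^-1)%E.
Proof.
move=> h0; rewrite unlock /Lnorm; congr (_ `^ _)%E.
by apply: eq_integral => x _; rewrite gee0_abs.
Qed.

Lemma Lnorm_le_scale (p D : R) (g h : X -> \bar R) : 0 < p -> 0 <= D ->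
  (forall x, 0 <= g x)%E -> (forall x, 0 <= h x)%E ->
  measurable_fun setT g -> measurable_fun setT h ->
  (\int[mu]_x (g x `^ p) <= D%:E * \int[mu]_x (h x `^ p))%E ->
  ('N[mu]_p%:E[g] <= (D `^ p^-1)%:E * 'N[mu]_p%:E[h])%E.
Proof.
move=> p0 D0 g0 h0 mg mh gh; rewrite !Lnorm_fin_ge0// -poweR_EFin -poweRM//; last first.
  by apply: integral_ge0 => x _; exact: poweR_ge0.
have gi0 : (0 <= \int[mu]_x (g x `^ p))%E by apply: integral_ge0 => x _; exact: poweR_ge0.
apply: gt0_ler_poweR; rewrite ?invr_ge0 ?(ltW p0)// in_itv/= leey andbT//.
exact: le_trans gh.
Qed.

Lemma lee_poweR (r : R) (u v : \bar R) : 0 <= r -> (0 <= u)%E -> (u <= v)%E ->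
  (u `^ r <= v `^ r)%E.
Proof.
move=> r0 u0 uv; apply: gt0_ler_poweR => //; rewrite in_itv/= leey andbT//.
exact: le_trans uv.
Qed.

Lemma lq_fun_le q a a' S x : (0 < q)%E -> (forall i, 0 <= a i <= a' i) ->
  (lq_fun q a S x <= lq_fun q a' S x)%E.
Proof.
move=> q0 aa'.
have le_term i : 0 <= lq_term a S i x <= lq_term a' S i x.
  by have /andP[a0 ai] := aa' i; rewrite mulr_ge0//= ler_wpM2r.
case: q q0 => [r||] //; rewrite ?lte_fin => r0 /=.
  apply: lee_poweR; first by rewrite invr_ge0 ltW.
    by apply: esum_ge0 => i _; rewrite lee_fin powR_ge0.
  apply: le_esum => i _; rewrite lee_fin; have /andP[t0 tt'] := le_term i.
  by apply: ge0_ler_powR; rewrite ?nnegrE ?(ltW r0)// (le_trans t0).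
apply: ge_ereal_sup => _ [i _ <-].
apply: (@le_trans _ _ (lq_term a' S i x)%:E); last by apply: ereal_sup_ubound; exists i.
by rewrite lee_fin; have /andP[] := le_term i.
Qed.

Lemma esumZl_enumerate (D : R) (h : I -> \bar R) : 0 <= D -> (forall i, 0 <= h i)%E ->
  (\esum_(i in [set: I]) (D%:E * h i) = D%:E * \esum_(i in [set: I]) h i)%E.
Proof.
move=> D0 h0; rewrite !esum_enumerate// => [|i]; last by rewrite mule_ge0.
by rewrite nneseriesZl.
Qed.

Lemma lq_funZ q (D : R) a S x : (0 < q)%E -> 0 <= D -> (forall i, 0 <= a i) ->
  (lq_fun q (fun i => (D * a i)%R) S x <= D%:E * lq_fun q a S x)%E.
Proof.
move=> q0 D0 a0.
have termZ i : lq_term (fun i => D * a i) S i x = D * lq_term a S i x.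
  by rewrite /lq_term mulrA.
case: q q0 => [r||] //; rewrite ?lte_fin => r0 /=.
  under eq_esum do rewrite termZ powRM ?lq_term_ge0// EFinM.
  rewrite esumZl_enumerate ?powR_ge0//; last by move=> i; rewrite lee_fin powR_ge0.
  rewrite poweRM ?lee_fin ?powR_ge0//; last by apply: esum_ge0 => i _; rewrite lee_fin powR_ge0.
  by rewrite poweR_EFin -powRrM divff ?gt_eqF// powRr1.
apply: ge_ereal_sup => _ [i _ <-]; rewrite termZ EFinM lee_wpmul2l ?lee_fin//.
by apply: ereal_sup_ubound; exists i.
Qed.

Section reindexing.
Variables (th : I -> I) (thI : injective th).

Lemma esum_comp_le (h : I -> \bar R) : (forall i, 0 <= h i)%E ->
  (\esum_(i in [set: I]) h (th i) <= \esum_(i in [set: I]) h i)%E.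
Proof.
move=> h0; rewrite -(@reindex_esum _ _ _ setT (range th) th)//; last first.
  by apply: inj_bij => i j _ _; exact: thI.
rewrite esum_mkcond; apply: le_esum => i _; case: ifP => // _.
Qed.

Lemma esum_comp_vanish (h : I -> \bar R) : (forall i, ~ range th i -> h i = 0%E) ->
  (\esum_(i in [set: I]) h i = \esum_(i in [set: I]) h (th i))%E.
Proof.
move=> hv; rewrite -(@reindex_esum _ _ _ setT (range th) th)//; last first.
  by apply: inj_bij => i j _ _; exact: thI.
rewrite [RHS]esum_mkcond; apply: eq_esum => i _; case: ifPn => //.
by rewrite notin_setE => /hv.
Qed.

Lemma lq_fun_comp_le q a S x : (0 < q)%E -> (forall i, 0 <= a i) ->
  (lq_fun q (a \o th) (S \o th) x <= lq_fun q a S x)%E.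
Proof.
move=> q0 a0; case: q q0 => [r||] //; rewrite ?lte_fin => r0 /=.
  apply: lee_poweR; first by rewrite invr_ge0 ltW.
    by apply: esum_ge0 => i _; rewrite lee_fin powR_ge0.
  by apply: (@esum_comp_le (fun i => ((lq_term a S i x) `^ r)%:E)) => i; rewrite lee_fin powR_ge0.
by apply: ge_ereal_sup => _ [i _ <-]; apply: ereal_sup_ubound; exists (th i).
Qed.

Lemma lq_fun_comp_vanish q a S x : (0 < q)%E -> (forall i, 0 <= a i) ->
  (forall i, ~ range th i -> a i = 0) ->
  (lq_fun q a S x <= lq_fun q (a \o th) (S \o th) x)%E.
Proof.
move=> q0 a0 av.
have tv i : ~ range th i -> lq_term a S i x = 0 by move=> /av; rewrite /lq_term => ->; rewrite mul0r.
case: q q0 => [r||] //; rewrite ?lte_fin => r0.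
  rewrite /lq_fun (esum_comp_vanish (h := fun i => ((lq_term a S i x) `^ r)%:E))// => i /tv ->.
  by rewrite powR0// gt_eqF.
apply: ge_ereal_sup => _ [i _ <-].
have [[j _ <-]|/tv ->] := pselect (range th i).
  by apply: ereal_sup_ubound; exists j.
by apply: lq_fun_ge0 => j; exact: a0.
Qed.

End reindexing.

Lemma Lnorm_le (p : R) (g h : X -> \bar R) : 0 < p ->
  (forall x, 0 <= g x <= h x)%E ->
  measurable_fun setT g -> measurable_fun setT h -> ('N[mu]_p%:E[g] <= 'N[mu]_p%:E[h])%E.
Proof.
move=> p0 gh mg mh.
have g0 x : (0 <= g x)%E by have /andP[] := gh x.
have h0 x : (0 <= h x)%E by have /andP[/le_trans] := gh x; apply.
have := @Lnorm_le_scale p 1 g h p0 ler01 g0 h0 mg mh.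
rewrite powR1 !mul1e; apply; apply: ge0_le_integral => //.
- by move=> x _; exact: poweR_ge0.
- exact: (measurableT_comp (measurable_poweR p)).
- exact: (measurableT_comp (measurable_poweR p)).
- by move=> x _; apply: lee_poweR; rewrite ?(ltW p0)//; have /andP[] := gh x.
Qed.

Lemma Lnorm_lq_scale (p D : R) q a a' S : 0 < p -> (0 < q)%E -> 0 <= D ->
  (forall i, measurable (S i)) ->
  (forall i, 0 <= a i) -> (forall i, 0 <= a' i) -> (forall i, a i <= D * a' i) ->
  ('N[mu]_p%:E[lq_fun q a S] <= D%:E * 'N[mu]_p%:E[lq_fun q a' S])%E.
Proof.
move=> p0 q0 D0 mS a0 a'0 aa'.
have ma := measurable_lq_fun mS a0 q0; have ma' := measurable_lq_fun mS a'0 q0.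
have scale x : (0 <= lq_fun q a S x <= D%:E * lq_fun q a' S x)%E.
  rewrite lq_fun_ge0//=; apply: le_trans (lq_funZ S x q0 D0 a'0).
  by apply: lq_fun_le => // i; rewrite a0 aa'.
pose g x := (D%:E * lq_fun q a' S x)%E.
apply: (@le_trans _ _ 'N[mu]_p%:E[g]%E).
  by apply: Lnorm_le => //; exact: measurable_funeM.
rewrite -[X in (X%:E * _)%E](powRr1 D0) -(@divff _ p) ?gt_eqF// powRrM.
apply: Lnorm_le_scale => //.
- exact: powR_ge0.
- by move=> x; have /andP[/le_trans] := scale x; apply.
- by move=> x; exact: lq_fun_ge0.
- exact: measurable_funeM.
under eq_integral do rewrite poweRM ?lee_fin ?lq_fun_ge0// poweR_EFin.
rewrite ge0_integralZl_EFin ?powR_ge0//.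
- by move=> x _; exact: poweR_ge0.
- exact: (measurableT_comp (measurable_poweR p)).
Qed.

Variables (K : R) (K_ge0 : 0 <= K).

(** For finite q the p-th power of the l^q norm is the power p / q of a sum of multiples of
    indicators, to which the bound on sums applies with exponent p / q. *)
Theorem Lnorm_lq_bound p q : 0 < p -> (0 < q)%E -> exists2 C, 0 <= C &
  forall (U V W Wh : I -> set X) (sg : I -> int),
  engulfing_family mu U V W Wh sg K -> forall a, (forall i, 0 <= a i) ->
  ('N[mu]_p%:E[lq_fun q a V] <= C%:E * 'N[mu]_p%:E[lq_fun q a U])%E.
Proof.
move=> p0 q0.
suff [C C0 bound] : exists2 C, 0 <= C &
  forall (U V W Wh : I -> set X) (sg : I -> int),
  engulfing_family mu U V W Wh sg K -> forall a, (forall i, 0 <= a i) ->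
  (\int[mu]_x (lq_fun q a V x `^ p) <= C%:E * \int[mu]_x (lq_fun q a U x `^ p))%E.
  exists (C `^ p^-1) => [|U V W Wh sg ef' a a0]; first exact: powR_ge0.
  have [mU mV _ _ _ _ _ _ _ _ _] := ef'.
  apply: Lnorm_le_scale => //; try by move=> x; exact: lq_fun_ge0.
  - exact: measurable_lq_fun.
  - exact: measurable_lq_fun.
  - exact: bound ef' _ a0.
case: q q0 => [r||] //; rewrite ?lte_fin => r0.
  have rp : 0 < p / r by rewrite divr_gt0.
  have [C C0 bound] := sum_seq_bound mu x0 K_ge0 rp.
  exists C => // U V W Wh sg /(engulfing_family_comp e) ef' a a0.
  have E S x : (lq_fun r%:E a S x `^ p =
      (\sum_(n <oo) ((a \o e) n `^ r * \1_((S \o e) n) x)%:E) `^ (p / r))%E.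
    by rewrite lq_fun_finE// -poweRrM [_ * p]mulrC.
  under eq_integral do rewrite E; under [in leRHS]eq_integral do rewrite E.
  by apply: (bound _ _ _ _ _ ef') => n; exact: powR_ge0.
have [C C0 bound] := max_seq_bound mu x0 K_ge0 p0.
exists C => // U V W Wh sg /(engulfing_family_comp e) ef' a a0.
under eq_integral do rewrite lq_fun_supE//; under [in leRHS]eq_integral do rewrite lq_fun_supE//.
by apply: (bound _ _ _ _ _ ef') => n; exact: a0.
Qed.

End lq_functions.

(** * Matching the scales of the two matrices *)

Section integer_powers.
Variables (R : realType) (d : nat).
Implicit Types (A B : 'M[R]_d.+1).

Lemma invmx_expz A j : invmx (A ^ j) = A ^ (- j).
Proof. by rewrite -invr_expz. Qed.

Lemma expz_unitmx A j : A \in unitmx -> A ^ j \in unitmx.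
Proof. by move=> uA; exact: unitrXz. Qed.

Lemma det_expz A j : \det (A ^ j) = \det A ^ j.
Proof.
have detX m : \det (A ^+ m) = \det A ^+ m.
  elim: m => [|m IHm]; first by rewrite !expr0 det1.
  by rewrite !exprS -mulmxE det_mulmx IHm.
by case: j => m /=; rewrite ?NegzE -?exprnP -?exprnN ?detX// -[_ ^- _]/(invmx _) det_inv detX.
Qed.

Lemma expz_mulmx A i j : A \in unitmx -> A ^ i *m A ^ j = A ^ (i + j).
Proof. by move=> uA; rewrite mulmxE -exprzDr. Qed.

Lemma powers_bounded A (n0 : nat) :
  exists2 K, 0 <= K & forall m : int, 0 <= m <= n0%:Z -> entries_le K (A ^ m).
Proof.
elim: n0 => [|n0 [K K0 HK]].
  exists 1 => // m; rewrite -eq_le => /eqP <-; rewrite expr0z.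
  exact: entries_le1.
have [L L0 HL] := entries_bounded (A ^ n0.+1).
exists (Num.max K L) => [|m /andP[m0]]; first by rewrite le_max K0.
rewrite le_eqVlt => /predU1P[->|mn]; first by apply: le_entries HL; rewrite le_max lexx orbT.
apply: (@le_entries _ _ _ K); first by rewrite le_max lexx.
by apply: HK; lia.
Qed.

Lemma negative_powers_bounded A : expansive A ->
  exists2 K, 0 <= K & forall m : int, m <= 0 -> entries_le K (A ^ m).
Proof.
move=> /expansive_decay[K [t [K0 /andP[t0 t1] decay]]].
exists K => // m m0; have -> : A ^ m = invmx A ^+ `|m|%N.
  by rewrite -[invmx A]/(A^-1) exprnP exprz_inv; congr (_ ^ _); lia.
apply: le_entries (decay _).
by rewrite ler_piMr// exprn_ile1 ?ltW.
Qed.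

Lemma quasi_norm_expz A rho j x : A \in unitmx -> homogeneous_quasi_norm A rho ->
  rho (A ^ j *m x) = `|\det A| ^ j * rho x.
Proof.
move=> uA hrho; case: j => m; first by rewrite -exprnP quasi_norm_exp.
rewrite NegzE.
have D0 : `|\det A| ^ m.+1 != 0 :> R.
  by rewrite expfz_neq0// normr_eq0 -unitfE -unitmxE.
apply: (mulfI D0); rewrite -(invr_expz `|\det A|) mulVKf//.
by rewrite -[X in X * _]exprnP -quasi_norm_exp// mulmxA exprnP expz_mulmx// subrr expr0z mul1mx.
Qed.

End integer_powers.

(** ** The scales j of A and floor (j eps) of B *)
Section matched_scales.
Variables (R : realType) (d : nat) (A B : 'M[R]_d.+1).
Hypotheses (eA : expansive A) (eB : expansive B) (AB : equivalent_mx A B).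
Hypothesis detBA : `|\det B| < `|\det A|.

Let eps : R := ln `|\det A| / ln `|\det B|.
Local Notation fs := (floor_scale eps).
Let a := `|\det A|.
Let b := `|\det B|.
Let a1 : 1 < a := expansive_det_gt1 eA.
Let b1 : 1 < b := expansive_det_gt1 eB.
Let a0 : 0 < a := lt_trans ltr01 a1.
Let b0 : 0 < b := lt_trans ltr01 b1.
Let uA : A \in unitmx := eA.1.
Let uB : B \in unitmx := eB.1.

Lemma eps_gt1 : 1 < eps.
Proof.
by rewrite /eps ltr_pdivlMr ?ln_gt0// mul1r ltr_ln ?posrE.
Qed.

Lemma floor_scale_itv j : (fs j)%:~R <= j%:~R * eps < (fs j)%:~R + 1.
Proof. by have := floor_itv (j%:~R * eps); rewrite intrD. Qed.

Lemma floor_scale_mono i j : i <= j -> fs i <= fs j.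
Proof.
move=> ij; apply: le_floor; rewrite ler_wpM2r ?ler_int//.
by rewrite ltW// (lt_trans _ eps_gt1).
Qed.

Lemma floor_scale_inj : injective fs.
Proof.
suff lt i j : i < j -> fs i < fs j.
  by move=> i j fij; case: (ltgtP i j) => // /lt; rewrite fij ltxx.
move=> ij; rewrite -(ltr_int R).
have /andP[fi _] := floor_scale_itv i; have /andP[_ fj] := floor_scale_itv j.
have ij1 : (i%:~R + 1 : R) <= j%:~R by rewrite -(intrD _ i 1) ler_int lezD1.
have := eps_gt1.
have : (i%:~R + 1) * eps <= j%:~R * eps by rewrite ler_wpM2r// ltW// (lt_trans _ eps_gt1).
by move=> *; lra.
Qed.

Lemma det_expzE j : a ^ j = b `^ (j%:~R * eps).
Proof.
rewrite -powR_intmul ?(ltW a0)// /powR !gt_eqF//; congr expR.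
by rewrite /eps mulrA divfK// gt_eqF// ln_gt0.
Qed.

Lemma det_ratio_le1 j : b ^ (fs j) <= a ^ j.
Proof.
rewrite det_expzE -powR_intmul ?(ltW b0)//.
by apply: ler_powR; [exact: ltW|have /andP[] := floor_scale_itv j].
Qed.

Lemma det_ratio_gt j : a ^ j <= b * b ^ (fs j).
Proof.
rewrite det_expzE -powR_intmul ?(ltW b0)// -{2}[b](powRr1 (ltW b0)).
rewrite -powRD; last by rewrite (gt_eqF b0) implybT.
by apply: ler_powR; [exact: ltW|have /andP[_ /ltW] := floor_scale_itv j; rewrite addrC].
Qed.

(** By homogeneity, rho_A (A^-j B^i x) = |det A|^-j rho_A (B^i x) is comparable to
    |det A|^-j |det B|^i rho_B x, hence to rho_A x when i = floor (j eps), because then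
    |det A|^j and |det B|^i differ by a factor between 1 and |det B|.  Operators that are
    bounded for a quasi-norm have bounded entries. *)
Lemma matched_scale_bounded : exists K, forall j,
  entries_le K (A ^ (- j) *m B ^ (fs j)) /\ entries_le K (B ^ (- fs j) *m A ^ j).
Proof.
have [rA [rB [hA hB [C C1 rAB]]]] := AB.
have C0 : 0 < C by exact: lt_le_trans C1.
have [_ rA0 _ _ _] := hA; have [_ rB0 _ _ _] := hB.
have rAleB x : rA x <= C * rB x by rewrite -ler_pdivrMl//; have /andP[] := rAB x.
have rBleA x : rB x <= C * rA x by have /andP[] := rAB x.
have aj0 j : 0 < a ^ j by rewrite exprz_gt0.
have bj0 j : 0 < b ^ j by rewrite exprz_gt0.
have [K1 HK1] := quasi_norm_operator_bounded eA hA (C * C).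
have [K2 HK2] := quasi_norm_operator_bounded eB hB (b * (C * C)).
exists (Num.max K1 K2) => j; split.
  apply: (@le_entries _ _ _ K1); first by rewrite le_max lexx.
  apply: HK1 => x; rewrite -mulmxA (quasi_norm_expz _ _ uA hA) -invr_expz.
  rewrite ler_pdivrMl ?aj0// (le_trans (rAleB _))// (quasi_norm_expz _ _ uB hB).
  rewrite [leLHS]mulrCA [leRHS](_ : _ = a ^ j * (C * (C * rA x))); last by ring.
  rewrite ler_pM ?mulr_ge0 ?(ltW C0) ?(ltW (bj0 _))//; first exact: det_ratio_le1.
  by rewrite ler_wpM2l// ltW.
apply: (@le_entries _ _ _ K2); first by rewrite le_max lexx orbT.
apply: HK2 => x; rewrite -mulmxA (quasi_norm_expz _ _ uB hB) -invr_expz.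
rewrite ler_pdivrMl ?bj0// (le_trans (rBleA _))// (quasi_norm_expz _ _ uA hA).
rewrite [leLHS]mulrCA [leRHS](_ : _ = b * b ^ (fs j) * (C * (C * rB x))); last first.
  by move: (rB x) (b ^ fs j) => u v; ring.
rewrite ler_pM ?mulr_ge0 ?(ltW C0) ?(ltW (aj0 _))//; first exact: det_ratio_gt.
by rewrite ler_wpM2l// ltW.
Qed.

(** The determinant of A^-j B^i, i = floor (j eps), lies between 1 / |det B| and 1; the
    rounding down in i is what provides the bound by 1. *)
Lemma matched_lattices : exists C (pi : int -> 'cV[int]_d.+1 -> 'cV[int]_d.+1),
  (forall j, injective (pi j)) /\ forall j k,
    entries_le C (A ^ (- j) *m B ^ (fs j) *m map_mx intr (pi j k) - map_mx intr k).
Proof.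
have [K HK] := matched_scale_bounded.
have K0 : 0 <= K by apply: le_trans ((HK 0).1 ord0 ord0).
have bV0 : 0 < b^-1 by rewrite invr_gt0.
have [C C0 HC] := lattice_approx_bounded d bV0 K0.
have lattice j : exists f : 'cV[int]_d.+1 -> 'cV[int]_d.+1, injective f /\
    forall k, entries_le C (A ^ (- j) *m B ^ (fs j) *m map_mx intr (f k) - map_mx intr k).
  have detM : `|\det (A ^ (- j) *m B ^ (fs j))| = (a ^ j)^-1 * b ^ (fs j).
    have normXz (x : R) m : `|x ^ m| = `|x| ^ m.
      by case: m => m; rewrite ?NegzE -?invr_expz ?normfV -exprnP normrX.
    by rewrite det_mulmx !det_expz normrM -invr_expz normfV !normXz.
  have [||f fi fC] := HC _ (HK j).1; last by exists f.
    by rewrite detM ler_pdivlMl ?exprz_gt0// ler_pdivrMr// mulrC det_ratio_gt.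
  by rewrite detM ler_pdivrMl ?exprz_gt0// mulr1 det_ratio_le1.
have [pi piP] := boolp.choice lattice.
by exists C, pi; split => j; [exact: (piP j).1|exact: (piP j).2].
Qed.

End matched_scales.

(** * Cubes of matched indices *)

Section matched_cubes.
Variables (R : realType) (d : nat) (A B : 'M[R]_d.+1).
Hypotheses (eA : expansive A) (eB : expansive B).
Local Notation mu := (lebesgue_cV R d.+1).
Local Notation idx := (int * 'cV[int]_d.+1)%type.

Lemma dilated_cubeE (X : 'M[R]_d.+1) j k : X \in unitmx ->
  dilated_cube X j k = frame_cube (X ^ j) (map_mx intr k).
Proof.
move=> uX; have uXj := expz_unitmx j uX.
apply/seteqP; split => [_ [x x01 <-] i|x xX].
  by rewrite mulKmx// addrK; exact: x01.
exists (invmx (X ^ j) *m x - map_mx intr k); first exact: xX.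
by rewrite subrK mulKVmx.
Qed.

Variables (eps : R) (pi : int -> 'cV[int]_d.+1 -> 'cV[int]_d.+1) (K C : R).
Local Notation fs := (floor_scale eps).
Hypotheses (K_ge0 : 0 <= K) (C_ge0 : 0 <= C).
Hypotheses (scaleAB : forall j, entries_le K (A ^ (- j) *m B ^ (fs j)))
  (scaleBA : forall j, entries_le K (B ^ (- fs j) *m A ^ j))
  (negA : forall m, m <= 0 -> entries_le K (A ^ m))
  (piC : forall j k,
    entries_le C (A ^ (- j) *m B ^ (fs j) *m map_mx intr (pi j k) - map_mx intr k)).

Definition match_index (jk : idx) : idx := (fs jk.1, pi jk.1 jk.2).
Definition cubes (X : 'M[R]_d.+1) (jk : idx) := dilated_cube X jk.1 jk.2.

Let n := d.+1.
Let uA : A \in unitmx := eA.1.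
Let uB : B \in unitmx := eB.1.

(** Seen from the frame A^j, the cube of B of index match_index (j, k) has bounded size and lies
    at bounded distance of k, hence W (j, k) holds both cubes.  Since the negative powers of
    A are bounded, a box of finer scale has bounded size in the frame of a coarser one, which
    gives the engulfing property. *)
Lemma matched_engulfing : exists (N : nat) (K0 : R) (Wh : idx -> set 'cV[R]_d.+1),
  let W (jk : idx) := frame_box (A ^ jk.1) (map_mx intr jk.2) N%:R in
  [/\ 0 <= K0,
    engulfing_family mu (cubes A) (cubes B \o match_index) W Wh fst K0 &
    engulfing_family mu (cubes B \o match_index) (cubes A) W Wh fst K0].
Proof.
have [N NP] : exists N : nat, 1 + (n%:R * (K * 1) + C) <= N%:R.
  by exists (Num.truncn (1 + (n%:R * (K * 1) + C))).+1; apply/ltW/truncnS_gt.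
(* L' bounds the position in the frame A^j of a box W of finer scale that meets W j, and
   L'' the position in the frame of B of the box W around its cube. *)
pose L' := n%:R * (K * (N%:R + N%:R)) + N%:R.
have [N' N'P] : exists N' : nat, L' <= N'%:R.
  by exists (Num.truncn L').+1; apply/ltW/truncnS_gt.
pose L'' := n%:R * (K * N%:R) + n%:R * (K * C).
have [N'' N''P] : exists N'' : nat, L'' <= N''%:R.
  by exists (Num.truncn L'').+1; apply/ltW/truncnS_gt.
(* The number of cubes that cover a box of half-width m in their frame. *)
pose c (m : nat) : R := ((2 * m).+1 ^ n)%N%:R.
pose K0 := c N + c N' + c N''.
have c0 m : 0 <= c m by exact: ler0n.
pose W (jk : idx) := frame_box (A ^ jk.1) (map_mx intr jk.2) N%:R.
pose Wh (jk : idx) := frame_box (A ^ jk.1) (map_mx intr jk.2) N'%:R.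
have nKC : 0 <= n%:R * (K * 1) by rewrite !mulr_ge0.
have cubesE X jk : X \in unitmx -> cubes X jk = frame_cube (X ^ jk.1) (map_mx intr jk.2).
  by move=> uX; rewrite /cubes dilated_cubeE.
have mA jk : measurable (cubes A jk).
  by rewrite cubesE//; exact: measurable_frame_cube.
have mB jk : measurable ((cubes B \o match_index) jk).
  by rewrite /= cubesE//; exact: measurable_frame_cube.
have mW jk : measurable (W jk) by exact: measurable_frame_box.
have mWh jk : measurable (Wh jk) by exact: measurable_frame_box.
have AW jk : cubes A jk `<=` W jk.
  rewrite cubesE//; apply: subset_trans (@frame_cube_sub_box _ _ _ _) _.
  by apply: le_frame_box; rewrite (le_trans _ NP)// lerDl addr_ge0.
have BW jk : (cubes B \o match_index) jk `<=` W jk.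
  rewrite /= cubesE//; apply: subset_trans (@frame_cube_sub_box _ _ _ _) _.
  have S : entries_le K (invmx (A ^ jk.1) *m B ^ (fs jk.1)) by rewrite invmx_expz.
  have P : entries_le C (invmx (A ^ jk.1) *m B ^ (fs jk.1) *m
      map_mx intr (pi jk.1 jk.2) - map_mx intr jk.2) by rewrite invmx_expz.
  apply: subset_trans (frame_box_sub S (expz_unitmx _ uB) P (N := 1)) _.
  by apply: le_frame_box; rewrite (le_trans _ NP)// lerDr.
have A0 jk : (0 < mu (cubes A jk))%E.
  by rewrite cubesE//; apply: mu_frame_cube_gt0; exact: expz_unitmx.
have B0 jk : (0 < mu ((cubes B \o match_index) jk))%E.
  by rewrite /= cubesE//; apply: mu_frame_cube_gt0; exact: expz_unitmx.
have WleA m jk : (mu (frame_box (A ^ jk.1) (map_mx intr jk.2) m%:R) <=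
    (c m)%:E * mu (cubes A jk))%E.
  by rewrite cubesE//; apply: mu_frame_box_le; exact: expz_unitmx.
have leK0 m (x : \bar R) : (0 <= x)%E -> c m <= K0 -> ((c m)%:E * x <= K0%:E * x)%E.
  by move=> x0 cK; apply: lee_wpmul2r => //; rewrite lee_fin.
have WA jk : (mu (W jk) <= K0%:E * mu (cubes A jk))%E.
  apply: le_trans (WleA N jk) _; apply: leK0; rewrite ?measure_ge0// /K0.
  by have := c0 N'; have := c0 N''; lra.
have Wfin jk : (mu (W jk) < +oo)%E.
  apply: le_lt_trans (WA jk) _; rewrite lte_mul_pinfty// ?lee_fin ?addr_ge0//.
  by rewrite cubesE//; apply: mu_frame_cube_fin; exact: expz_unitmx.
have WB jk : (mu (W jk) <= K0%:E * mu ((cubes B \o match_index) jk))%E.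
  apply: (@le_trans _ _ ((c N'')%:E * mu ((cubes B \o match_index) jk))%E); last first.
    by apply: leK0; rewrite ?measure_ge0// /K0; have := c0 N'; have := c0 N; lra.
  rewrite /= cubesE//.
  apply: le_trans (mu_frame_box_le N'' (pi jk.1 jk.2) _ (expz_unitmx _ uB)).
  apply: le_measure; rewrite ?inE//; first exact: measurable_frame_box.
  have S : entries_le K (invmx (B ^ (fs jk.1)) *m A ^ jk.1) by rewrite invmx_expz.
  have P : entries_le (n%:R * (K * C)) (invmx (B ^ (fs jk.1)) *m A ^ jk.1 *m
      map_mx intr jk.2 - map_mx intr (pi jk.1 jk.2)).
    rewrite invmx_expz (_ : _ - _ = - (B ^ (- fs jk.1) *m A ^ jk.1 *m
      (A ^ (- jk.1) *m B ^ (fs jk.1) *m map_mx intr (pi jk.1 jk.2) - map_mx intr jk.2))).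
      by apply: entries_leN; exact: entries_leM.
    rewrite mulmxBr opprB !mulmxA; congr (_ - _).
    rewrite -[_ *m A ^ jk.1 *m A ^ _]mulmxA expz_mulmx// subrr expr0z mulmx1.
    by rewrite expz_mulmx// addNr expr0z mul1mx.
  apply: subset_trans (frame_box_sub S (expz_unitmx _ uA) P (N := N%:R)) _.
  exact: le_frame_box.
have eng i j : i.1 <= j.1 -> W i `&` W j !=set0 -> W i `<=` Wh j.
  move=> ij [x [Wi Wj]] y Wiy; apply: le_entries N'P _.
  rewrite (_ : _ - _ = invmx (A ^ j.1) *m (y - x) +
    (invmx (A ^ j.1) *m x - map_mx intr j.2)); last by rewrite mulmxBr addrA subrK.
  apply: entries_leD => //.
  rewrite (_ : invmx (A ^ j.1) *m (y - x) = A ^ (- j.1 + i.1) *m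
    ((invmx (A ^ i.1) *m y - map_mx intr i.2) - (invmx (A ^ i.1) *m x - map_mx intr i.2))).
    by apply: entries_leM; [apply: negA; lia|exact: entries_leB].
  rewrite opprB addrA subrK -mulmxBr -expz_mulmx// -mulmxA invmx_expz.
  by rewrite mulKVmx//; exact: expz_unitmx.
have WhW jk : (mu (Wh jk) <= K0%:E * mu (W jk))%E.
  apply: (le_trans (WleA N' jk)).
  apply: (@le_trans _ _ (K0%:E * mu (cubes A jk))%E).
    by apply: leK0; rewrite ?measure_ge0// /K0; have := c0 N; have := c0 N''; lra.
  rewrite lee_wpmul2l// ?lee_fin ?addr_ge0// le_measure ?inE//.
exists N, K0, Wh; split; first by rewrite /K0 !addr_ge0.
- exact: (EngulfingFamily mA mB mW mWh AW BW A0 Wfin WA eng WhW).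
- exact: (EngulfingFamily mB mA mW mWh BW AW B0 Wfin WB eng WhW).
Qed.

End matched_cubes.

(** * Sums of measures over a set *)

Section carleson.
Context d (X : measurableType d) (R : realType) (mu : {measure set X -> \bar R}).
Variables (I : choiceType) (e : nat -> I) (f : I -> nat).
Hypotheses (ef : cancel e f) (fe : cancel f e).
Implicit Types (a : I -> R) (S U V : I -> set X) (J : set I) (P : set X).
Local Open Scope ereal_scope.

(** The integral over P of a sum of multiples of indicators, as a sum of measures. *)
Definition local_mass a S J P := \esum_(i in J) ((a i)%:E * mu (S i `&` P)).

Lemma local_mass_ge0 a S J P : (forall i, (0 <= a i)%R) -> 0 <= local_mass a S J P.
Proof. by move=> a0; apply: esum_ge0 => i _; rewrite mule_ge0// lee_fin. Qed.

Lemma integral_local_mass a S J P : (forall i, (0 <= a i)%R) ->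
  (forall i, measurable (S i)) -> measurable P ->
  \int[mu]_(x in P) (\esum_(i in J) (a i * \1_(S i) x)%:E) = local_mass a S J P.
Proof.
move=> a0 mS mP.
pose b i : R := if i \in J then a i else 0%R.
have b0 i : (0 <= b i)%R by rewrite /b; case: ifP.
have E x : \esum_(i in J) (a i * \1_(S i) x)%:E = \sum_(n <oo) (b (e n) * \1_(S (e n)) x)%:E.
  rewrite esum_mkcond (esum_enumerate ef fe); last first.
    by move=> i; case: ifP => // _; rewrite lee_fin mulr_ge0.
  by apply: eq_eseriesr => n _; rewrite /b; case: ifP; rewrite ?mul0r.
rewrite (eq_integral (fun x => \sum_(n <oo) (b (e n) * \1_(S (e n)) x)%:E)); last by move=> x _; exact: E.
have mi n : measurable_fun P (fun x => (\1_(S (e n)) x : R)%:E).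
  by apply/measurable_EFinP; apply: measurable_funTS; apply: measurable_indic.
rewrite integral_nneseries//; last 2 first.
- by move=> n; apply/measurable_EFinP; apply: measurable_funM => //; apply/measurable_EFinP; exact: mi.
- by move=> n x _; rewrite lee_fin mulr_ge0.
rewrite /local_mass esum_mkcond (esum_enumerate ef fe); last first.
  by move=> i; case: ifP => // _; rewrite mule_ge0// lee_fin.
apply: eq_eseriesr => n _; under eq_integral do rewrite EFinM.
rewrite ge0_integralZl_EFin// integral_indic// /b; case: ifP => // _.
by rewrite mul0e.
Qed.

(** Only the sets V i that meet P contribute, and the corresponding U i are covered by the
    P' s; each term is thus dominated by K0 times the terms of the M sums over the P' s. *)
Lemma local_mass_transfer (K0 C : R) (N : \bar R) (M : nat) a U V J J' P (P' : 'I_M -> set X) :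
  (0 <= K0)%R -> (0 <= C)%R -> 0 <= N -> (forall i, (0 <= a i)%R) ->
  (forall i, measurable (U i)) -> (forall i, measurable (V i)) ->
  measurable P -> (forall s, measurable (P' s)) ->
  (forall i, mu (V i) <= K0%:E * mu (U i)) ->
  (forall i, J i -> V i `&` P !=set0 -> J' i /\ U i `<=` \bigcup_(s in setT) P' s) ->
  (forall s, mu (P' s) <= C%:E * mu P) ->
  (forall s, local_mass a U J' (P' s) <= N * mu (P' s)) ->
  local_mass a V J P <= (K0 * (M%:R * C))%:E * N * mu P.
Proof.
move=> K00 C0 N0 a0 mU mV mP mP' VU near_P P'P P'N.
have step : local_mass a V J P <= K0%:E * \sum_(s < M) local_mass a U J' (P' s).
  rewrite /local_mass esum_mkcond.
  rewrite -(@esum_sum _ _ 'I_M); last first.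
    by move=> i s _ _; rewrite mule_ge0// lee_fin.
  rewrite [in leRHS]esum_mkcond -(esumZl_enumerate ef fe)//; last first.
    by move=> i; case: ifP => // _; apply: sume_ge0 => s _; rewrite mule_ge0// lee_fin.
  apply: le_esum => i _; case: ifPn => [|_]; last first.
    rewrite mule_ge0 ?lee_fin//; case: ifP => // _.
    by apply: sume_ge0 => s _; rewrite mule_ge0// lee_fin.
  rewrite inE => Ji; have [VP|VP] := pselect (V i `&` P !=set0); last first.
    rewrite (_ : V i `&` P = set0) ?measure0 ?mule0; last first.
      by apply/seteqP; split => // x VPx; apply: VP; exists x.
    rewrite mule_ge0 ?lee_fin//; case: ifP => // _.
    by apply: sume_ge0 => s _; rewrite mule_ge0// lee_fin.
  have [J'i UP] := near_P i Ji VP; rewrite ifT ?inE//.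
  rewrite -ge0_sume_distrr// muleCA lee_wpmul2l ?lee_fin//.
  apply: (@le_trans _ _ (mu (V i))); first by apply: le_measure; rewrite ?inE//; exact: measurableI.
  apply: (le_trans (VU i)); rewrite lee_wpmul2l ?lee_fin//.
  apply: (@measure_le_fin_cover _ _ _ mu 'I_M) => //.
    by move=> s; exact: measurableI.
  by move=> x Ux; have [s _ xs] := UP x Ux; exists s.
apply: (le_trans step).
have Psum : \sum_(s < M) local_mass a U J' (P' s) <= \sum_(s < M) (N * (C%:E * mu P)).
  apply: lee_sum => s _; apply: (le_trans (P'N s)); exact: lee_wpmul2l.
apply: (@le_trans _ _ (K0%:E * \sum_(s < M) (N * (C%:E * mu P)))).
  by rewrite lee_wpmul2l ?lee_fin.
rewrite [leRHS](_ : _ = K0%:E * (M%:R%:E * (N * (C%:E * mu P)))); last first.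
  by rewrite !EFinM -!muleA; congr (_ * (_ * _)); rewrite muleCA.
by rewrite sumr_const card_ord mule_natl.
Qed.

End carleson.

Lemma local_mass_le_scale d (X : measurableType d) (R : realType)
    (mu : {measure set X -> \bar R}) (I : choiceType) (e : nat -> I) (f : I -> nat)
    (ef : cancel e f) (fe : cancel f e) (D : R) (a a' : I -> R) (S : I -> set X) J P :
  0 <= D -> (forall i, 0 <= a' i) -> (forall i, a i <= D * a' i) ->
  (local_mass mu a S J P <= D%:E * local_mass mu a' S J P)%E.
Proof.
move=> D0 a'0 aa'; rewrite /local_mass esum_mkcond [in leRHS]esum_mkcond.
rewrite -(esumZl_enumerate ef fe)//; last first.
  by move=> i; case: ifP => // _; rewrite mule_ge0// lee_fin.
apply: le_esum => i _; case: ifP => _; last by rewrite mule0.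
by rewrite muleA -EFinM lee_wpmul2r// lee_fin.
Qed.

Section local_mass_reindexing.
Context d (X : measurableType d) (R : realType) (mu : {measure set X -> \bar R}).
Variables (I : choiceType) (th : I -> I) (th_inj : injective th).
Implicit Types (a : I -> R) (S : I -> set X) (J : set I).

Lemma local_mass_comp_le a S J P : (forall i, 0 <= a i) ->
  (local_mass mu (a \o th) (S \o th) (th @^-1` J) P <= local_mass mu a S J P)%E.
Proof.
move=> a0; rewrite /local_mass esum_mkcond [leRHS]esum_mkcond.
pose h i := if i \in J then ((a i)%:E * mu (S i `&` P))%E else 0%E.
have h0 i : (0 <= h i)%E by rewrite /h; case: ifP => // _; rewrite mule_ge0// lee_fin.
apply: le_trans (esum_comp_le th_inj h0); apply: le_esum => i _.
by case: ifPn => [|_]; [rewrite inE => Ji; rewrite /h ifT// inE|exact: h0].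
Qed.

Lemma local_mass_comp_vanish a S J P : (forall i, ~ range th i -> a i = 0) ->
  local_mass mu a S J P = local_mass mu (a \o th) (S \o th) (th @^-1` J) P.
Proof.
move=> av; rewrite /local_mass esum_mkcond [RHS]esum_mkcond.
pose h i := if i \in J then ((a i)%:E * mu (S i `&` P))%E else 0%E.
rewrite -/h (esum_comp_vanish th_inj (h := h)); last first.
  by move=> i /av ai; rewrite /h ai mul0e; case: ifP.
by apply: eq_esum => i _; rewrite /h; congr (if _ then _ else _).
Qed.

Lemma local_mass_subset a S J J' P : (forall i, 0 <= a i) -> J `<=` J' ->
  (local_mass mu a S J P <= local_mass mu a S J' P)%E.
Proof.
move=> a0 JJ'; rewrite /local_mass esum_mkcond [leRHS]esum_mkcond; apply: le_esum => i _.
case: ifPn => [|_]; first by rewrite inE => /JJ' J'i; rewrite ifT// inE.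
by case: ifP => // _; rewrite mule_ge0// lee_fin.
Qed.

End local_mass_reindexing.

(** * The operators and the norms of the sequence spaces *)

Section operator_algebra.
Variables (R : realType) (d : nat) (eps : R) (pi : int -> 'cV[int]_d.+1 -> 'cV[int]_d.+1).
Local Notation fs := (floor_scale eps).
Hypotheses (fs_inj : injective fs) (pi_inj : forall j, injective (pi j)).
Implicit Types c : cseq R d.

Lemma operator_S_match c j k : operator_S eps pi c (fs j) (pi j k) = c j k.
Proof.
rewrite /operator_S; case: pselect => [ex|[]]; last by exists (j, k).
case: (projT2 (cid ex)) => /fs_inj <- /pi_inj <- //.
Qed.

Lemma operator_S_off c i m : ~ range (match_index eps pi) (i, m) ->
  operator_S eps pi c i m = 0.
Proof.
move=> off; rewrite /operator_S; case: pselect => // -[[j k] [/= ij mk]].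
by exfalso; apply: off; exists (j, k) => //; rewrite /match_index /= -ij -mk.
Qed.

Lemma operator_TS c : operator_T eps pi (operator_S eps pi c) = c.
Proof.
by apply/funext => j; apply/funext => k; rewrite /operator_T operator_S_match.
Qed.

Lemma operator_S_linear : linear (operator_S eps pi : cseq R d -> cseq R d).
Proof.
move=> z u v; apply/funext => i; apply/funext => m.
rewrite /operator_S !fctE; case: pselect => // _.
by rewrite /= scaler0 addr0.
Qed.

Lemma operator_T_linear : linear (operator_T eps pi : cseq R d -> cseq R d).
Proof. by move=> z u v; apply/funext => i; apply/funext => m. Qed.

Lemma match_index_inj : injective (match_index eps pi).
Proof. by move=> [j k] [j' k'] [/fs_inj <- /pi_inj <-]. Qed.

End operator_algebra.

(** ** The norms as L^p(l^q) norms and as suprema of sums of measures *)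
Section tl_as_lq.
Variables (R : realType) (d : nat) (X : 'M[R]_d.+1) (alpha : R).
Hypothesis uX : X \in unitmx.
Local Notation mu := (lebesgue_cV R d.+1).
Local Notation idx := (int * 'cV[int]_d.+1)%type.
Implicit Types (c : cseq R d) (q : \bar R).

Definition tl_coefs c (jk : idx) : R := tl_coef X alpha c jk.1 jk.2.

Lemma tl_coefs_ge0 c jk : 0 <= tl_coefs c jk.
Proof.
by rewrite mulr_ge0 ?powR_ge0//; case: (c _ _) => x y; exact: sqrtr_ge0.
Qed.

Lemma measurable_cubes jk : measurable (cubes X jk).
Proof. by rewrite /cubes dilated_cubeE//; exact: measurable_frame_cube. Qed.

Lemma tl_sumE (r : R) c J x : 0 < r -> (tl_sum X alpha r c J x =
  \esum_(jk in [set jk : idx | J jk.1]) ((lq_term (tl_coefs c) (cubes X) jk x) `^ r)%:E)%E.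
Proof.
move=> r0; rewrite /tl_sum esum_esum; last by move=> i j _ _; rewrite lee_fin powR_ge0.
by congr esum; apply/seteqP; split => [[j k] []|[j k]] //=.
Qed.

Lemma tl_funE q c : (0 < q)%E -> tl_fun X alpha q c = lq_fun q (tl_coefs c) (cubes X).
Proof.
case: q => [r||] //; rewrite ?lte_fin => r0; apply/funext => x //=.
by rewrite tl_sumE//; congr (_ `^ _)%E; congr esum; apply/seteqP; split.
Qed.

Lemma mu_cube_fin l m : (0 < mu (dilated_cube X l m) < +oo)%E.
Proof.
rewrite dilated_cubeE// mu_frame_cube_gt0 ?mu_frame_cube_fin//; exact: expz_unitmx.
Qed.

Variables (e : nat -> idx) (f : idx -> nat).
Hypotheses (ef : cancel e f) (fe : cancel f e).

Definition scale_mass (a : idx -> R) (r : R) l m :=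
  local_mass mu (fun jk => a jk `^ r) (cubes X) [set jk | jk.1 <= l] (dilated_cube X l m).

Lemma tl_average (r : R) c l m : 0 < r ->
  (\int[mu]_(x in dilated_cube X l m) tl_sum X alpha r c [set j | (j <= l)%R] x =
   scale_mass (tl_coefs c) r l m)%E.
Proof.
move=> r0; rewrite /scale_mass -(integral_local_mass mu ef fe).
- apply: eq_integral => x _; rewrite tl_sumE//; apply: eq_esum => jk _.
  by rewrite lq_term_power// tl_coefs_ge0.
- by move=> jk; exact: powR_ge0.
- exact: measurable_cubes.
- by have := measurable_cubes (l, m).
Qed.

Lemma tl_norm_inf_le (r : R) c (N : \bar R) : 0 < r -> (0 <= N)%E ->
  (forall l m, scale_mass (tl_coefs c) r l m <= N * mu (dilated_cube X l m))%E ->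
  (tl_norm X alpha +oo r%:E c <= N `^ r^-1)%E.
Proof.
move=> r0 N0 massN; apply: ge_ereal_sup => _ [[l m] _ <-]; cbn [fst snd].
have /andP[P0 Poo] := mu_cube_fin l m.
rewrite tl_average//; have := massN l m.
have -> : mu (dilated_cube X l m) = (fine (mu (dilated_cube X l m)))%:E.
  by rewrite fineK// ge0_fin_numE.
set v := fine _; have v0 : 0 < v by rewrite fine_gt0// P0.
rewrite inver gt_eqF// => le_mass; apply: lee_poweR; first by rewrite invr_ge0 ltW.
  rewrite mule_ge0 ?lee_fin ?invr_ge0 ?(ltW v0)//; apply: local_mass_ge0 => jk.
  exact: powR_ge0.
by rewrite lee_pdivrMl// muleC.
Qed.

Lemma scale_mass_le_norm (r : R) c l m : 0 < r ->
  (scale_mass (tl_coefs c) r l m <=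
   tl_norm X alpha +oo r%:E c `^ r * mu (dilated_cube X l m))%E.
Proof.
move=> r0; have /andP[P0 Poo] := mu_cube_fin l m.
have mass0 : (0 <= scale_mass (tl_coefs c) r l m)%E.
  by apply: local_mass_ge0 => jk; exact: powR_ge0.
have : ((mu (dilated_cube X l m))^-1 * scale_mass (tl_coefs c) r l m <=
    tl_norm X alpha +oo r%:E c `^ r)%E.
  have inv0 : (0 <= (mu (dilated_cube X l m))^-1 * scale_mass (tl_coefs c) r l m)%E.
    by rewrite mule_ge0// inve_ge0 ltW.
  rewrite -[leLHS]poweRe1// -(@mulVf _ r) ?gt_eqF// poweRrM.
  apply: lee_poweR; [exact: ltW|exact: poweR_ge0|].
  by apply: ereal_sup_ubound; exists (l, m) => //; cbn [fst snd]; rewrite tl_average.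
have -> : mu (dilated_cube X l m) = (fine (mu (dilated_cube X l m)))%:E.
  by rewrite fineK// ge0_fin_numE.
have v0 : 0 < fine (mu (dilated_cube X l m)) by rewrite fine_gt0// P0.
by rewrite inver gt_eqF// lee_pdivrMl// muleC.
Qed.

End tl_as_lq.

Lemma tl_norm_inf_ge0 (R : realType) (d : nat) (X : 'M[R]_d.+1) (alpha r : R) (c : cseq R d) :
  0 < r -> (0 <= tl_norm X alpha +oo r%:E c)%E.
Proof.
move=> r0; apply: le_trans (poweR_ge0 _ _) _; last first.
  by apply: ereal_sup_ubound; exists (0, 0).
Qed.

Lemma tl_norm_ge0 (R : realType) (d : nat) (X : 'M[R]_d.+1) (alpha : R) p q (c : cseq R d) :
  (0 < p)%E -> (0 < q)%E -> (0 <= tl_norm X alpha p q c)%E.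
Proof.
case: p => [p||] // p0; first by rewrite /tl_norm unlock poweR_ge0.
case: q => [q||] // q0; first exact: tl_norm_inf_ge0.
apply: (@le_trans _ _ (tl_coefs X alpha c (0, 0))%:E); first by rewrite lee_fin tl_coefs_ge0.
by apply: ereal_sup_ubound; exists (0, 0).
Qed.

(** * Comparison of the two norms *)

Section change_of_frame.
Variables (R : realType) (d : nat) (A : 'M[R]_d.+1) (uA : A \in unitmx).
Local Notation mu := (lebesgue_cV R d.+1).
Local Notation idx := (int * 'cV[int]_d.+1)%type.
Variables (e : nat -> idx) (f : idx -> nat).
Hypotheses (ef : cancel e f) (fe : cancel f e).
Implicit Types (J : set idx) (X Y : 'M[R]_d.+1).

(** A bound on the averages over the cubes with frame X passes to the cubes with a comparable
    frame Y and to the other family of an engulfing pair, because a cube with frame Y meets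
    only sets that lie in boundedly many cubes with frame X. *)
Lemma local_mass_change_frame (K K0 : R) (n0 : nat) : 0 <= K0 ->
  exists2 C1 : R, 0 <= C1 & forall (U V Wh : idx -> set 'cV[R]_d.+1),
    engulfing_family mu U V
      (fun jk => frame_box (A ^ jk.1) (map_mx intr jk.2) n0%:R) Wh fst K0 ->
  forall (a : idx -> R) J J' X Y (N : \bar R) m, (forall i, 0 <= a i) -> (0 <= N)%E ->
    X \in unitmx -> Y \in unitmx ->
    entries_le K (invmx X *m Y) -> entries_le K (invmx Y *m X) ->
    J `<=` J' -> (forall i, J' i -> entries_le K (invmx X *m A ^ i.1)) ->
    (forall v : 'cV[int]_d.+1, local_mass mu a U J' (frame_cube X (map_mx intr v)) <=
       N * mu (frame_cube X (map_mx intr v)))%E ->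
    (local_mass mu a V J (frame_cube Y (map_mx intr m)) <=
      C1%:E * N * mu (frame_cube Y (map_mx intr m)))%E.
Proof.
move=> K00; have [M [C [C0 neighbours]]] := @frame_cube_neighbours R d.+1 K n0.
exists (K0 * (M%:R * C)); first by rewrite !mulr_ge0.
move=> U V Wh eUV a J J' X Y N m a0 N0 uX uY XY YX JJ' XA UN.
have [P' [P'cover P'le]] := neighbours X Y m uX uY XY YX.
apply: (@local_mass_transfer _ _ R mu idx e f ef fe K0 C N M a U V J J' _
  (fun s => frame_cube X (map_mx intr (P' s))) K00 C0 N0 a0).
- exact: ef_mU eUV.
- exact: ef_mV eUV.
- exact: measurable_frame_cube.
- by move=> s; exact: measurable_frame_cube.
- move=> i; apply: le_trans (ef_W_le eUV i); apply: le_measure; rewrite ?inE.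
  + exact: (ef_mV eUV).
  + exact: (ef_mW eUV).
  + exact: (ef_VW eUV).
- move=> i /JJ' J'i ViY; split; first exact: J'i.
  apply: (P'cover (A ^ i.1) (map_mx intr i.2) (U i) (V i)).
  + exact: expz_unitmx.
  + exact: XA.
  + exact: (ef_UW eUV).
  + exact: (ef_VW eUV).
  + exact: ViY.
- exact: P'le.
- by move=> s; exact: UN.
Qed.

End change_of_frame.

Lemma poweR_bound (R : realType) (r D : R) (N : \bar R) : 0 < r -> 0 <= D -> (0 <= N)%E ->
  ((D%:E * N `^ r) `^ r^-1 = (D `^ r^-1)%:E * N)%E.
Proof.
move=> r0 D0 N0; rewrite poweRM ?lee_fin ?poweR_ge0// poweR_EFin; congr (_ * _)%E.
by rewrite -poweRrM mulfV ?gt_eqF// poweRe1.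
Qed.

Section transfer.
Variables (R : realType) (d : nat) (A B : 'M[R]_d.+1) (alpha : R).
Hypotheses (eA : expansive A) (eB : expansive B).
Hypothesis detBA : `|\det B| < `|\det A|.

Let eps : R := ln `|\det A| / ln `|\det B|.
Local Notation fs := (floor_scale eps).
Local Notation mu := (lebesgue_cV R d.+1).
Local Notation idx := (int * 'cV[int]_d.+1)%type.
Let n := d.+1.
Let uA : A \in unitmx := eA.1.
Let uB : B \in unitmx := eB.1.
Let b := `|\det B|.
Let b1 : 1 < b := expansive_det_gt1 eB.
Let b0 : 0 < b := lt_trans ltr01 b1.

(** The cost of replacing |det A|^j by |det B|^(floor (j eps)) in the coefficients: these
    numbers differ by a factor between 1 and |det B|. *)
Definition coef_const : R := b `^ `|alpha + 2^-1|.
Local Notation D := coef_const.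

Lemma coef_const_ge0 : 0 <= D. Proof. exact: powR_ge0. Qed.

Lemma det_power_compare j :
  `|\det B| `^ (- ((fs j)%:~R * (alpha + 2^-1))) <=
    D * `|\det A| `^ (- (j%:~R * (alpha + 2^-1))) /\
  `|\det A| `^ (- (j%:~R * (alpha + 2^-1))) <=
    D * `|\det B| `^ (- ((fs j)%:~R * (alpha + 2^-1))).
Proof.
set x := alpha + 2^-1; rewrite -/b.
have -> : `|\det A| `^ (- (j%:~R * x)) = b `^ (- (j%:~R * eps * x)).
  have a0 : 0 < `|\det A| by exact: lt_trans detBA.
  rewrite /powR !gt_eqF//; congr expR.
  have lnb : ln b != 0 by rewrite gt_eqF// ln_gt0.
  by rewrite /eps -/b; field.
have := floor_scale_itv A B j; rewrite -/eps; set y : R := (fs j)%:~R; set z := j%:~R * eps.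
move=> /andP[yz zy].
have zyx : `|(z - y) * x| <= `|x|.
  by rewrite normrM ler_piMl// ger0_norm; lra.
have zyx1 := le_trans (ler_norm _) zyx.
have zyx2 : - ((z - y) * x) <= `|x| by rewrite (le_trans (ler_norm _))// normrN.
by rewrite /coef_const -/x -!powRD ?(gt_eqF b0) ?implybT//; split; apply: ler_powR;
  rewrite ?(ltW b1)//; lra.
Qed.

Variable pi : int -> 'cV[int]_d.+1 -> 'cV[int]_d.+1.
Hypothesis pi_inj : forall j, injective (pi j).
Local Notation th := (match_index eps pi).
Local Notation S := (operator_S eps pi : cseq R d -> cseq R d).
Local Notation T := (operator_T eps pi : cseq R d -> cseq R d).

Let fs_inj : injective fs := floor_scale_inj eA eB detBA.
Let th_inj : injective th := match_index_inj fs_inj pi_inj.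

Lemma coefs_S_le c jk : tl_coefs B alpha (S c) (th jk) <= D * tl_coefs A alpha c jk.
Proof.
rewrite /tl_coefs /tl_coef /= operator_S_match// mulrA ler_wpM2r//.
  by case: (c _ _) => x y; exact: sqrtr_ge0.
exact: (det_power_compare _).1.
Qed.

Lemma coefs_T_le s jk : tl_coefs A alpha (T s) jk <= D * tl_coefs B alpha s (th jk).
Proof.
rewrite /tl_coefs /tl_coef /= mulrA ler_wpM2r//.
  by case: (T s _ _) => x y; exact: sqrtr_ge0.
exact: (det_power_compare _).2.
Qed.

Lemma coefs_S_off c i : ~ range th i -> tl_coefs B alpha (S c) i = 0.
Proof.
case: i => i m off; rewrite /tl_coefs /tl_coef /= operator_S_off//.
by rewrite /Normc.normc /= expr0n/= addr0 sqrtr0 mulr0.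
Qed.

Variables (K C : R).
Hypotheses (K_ge0 : 0 <= K) (C_ge0 : 0 <= C).
Hypotheses (scaleAB : forall j, entries_le K (A ^ (- j) *m B ^ (fs j)))
  (scaleBA : forall j, entries_le K (B ^ (- fs j) *m A ^ j))
  (negA : forall m, m <= 0 -> entries_le K (A ^ m))
  (negB : forall m, m <= 0 -> entries_le K (B ^ m))
  (piC : forall j k,
    entries_le C (A ^ (- j) *m B ^ (fs j) *m map_mx intr (pi j k) - map_mx intr k)).
Variables (e : nat -> idx) (f : idx -> nat).
Hypotheses (ef : cancel e f) (fe : cancel f e).

(** Both operators move coefficients between matched cubes: for S, the sequence vanishes off
    the matched indices, and for T, the other indices are dropped.  Up to the factor D, the
    norms to compare are then L^p(l^q) norms of the same coefficients on two families of
    cubes that form an engulfing pair, in either order. *)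
Lemma transfer_fin (p : R) q : 0 < p -> (0 < q)%E -> exists2 C0 : R, 0 <= C0 &
  (forall c, tl_norm B alpha p%:E q (S c) <= C0%:E * tl_norm A alpha p%:E q c)%E /\
  (forall s, tl_norm A alpha p%:E q (T s) <= C0%:E * tl_norm B alpha p%:E q s)%E.
Proof.
move=> p0 q0.
have [N [K0 [Wh [K00 efAB efBA]]]] := matched_engulfing eA eB K_ge0 C_ge0 scaleAB scaleBA negA piC.
have [C0 C00 bound] := Lnorm_lq_bound mu 0 ef fe K00 p0 q0.
have D0 := coef_const_ge0.
have mA := measurable_cubes uA; have mB := measurable_cubes uB.
have mBth jk : measurable ((cubes B \o th) jk) := mB (th jk).
exists (C0 * D); first by rewrite mulr_ge0.
split => c.
  rewrite /tl_norm !tl_funE//.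
  have sB0 i : 0 <= tl_coefs B alpha (S c) i := tl_coefs_ge0 _ _ _ _.
  have cA0 i : 0 <= tl_coefs A alpha c i := tl_coefs_ge0 _ _ _ _.
  apply: (@le_trans _ _ ('N[mu]_p%:E[lq_fun q (tl_coefs B alpha (S c) \o th) (cubes B \o th)])%E).
    apply: Lnorm_le => //; last 2 first.
    - exact: (measurable_lq_fun ef fe mB sB0).
    - exact: (measurable_lq_fun ef fe mBth (fun i => sB0 (th i))).
    move=> x; rewrite (lq_fun_ge0 e)//=.
    by apply: (lq_fun_comp_vanish e th_inj) => //; exact: coefs_S_off.
  apply: le_trans; first exact: (bound _ _ _ _ _ efAB (tl_coefs B alpha (S c) \o th) (fun i => sB0 (th i))).
  rewrite EFinM -muleA lee_wpmul2l ?lee_fin//.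
  exact: (Lnorm_lq_scale mu ef fe p0 q0 D0 mA (fun i => sB0 (th i)) cA0 (coefs_S_le c)).
rewrite /tl_norm !tl_funE//.
have cA0 i : 0 <= tl_coefs A alpha (T c) i := tl_coefs_ge0 _ _ _ _.
have sB0 i : 0 <= tl_coefs B alpha c i := tl_coefs_ge0 _ _ _ _.
apply: (@le_trans _ _ (D%:E * 'N[mu]_p%:E[lq_fun q (tl_coefs B alpha c \o th) (cubes A)])%E).
  exact: (Lnorm_lq_scale mu ef fe p0 q0 D0 mA cA0 (fun i => sB0 (th i)) (coefs_T_le c)).
rewrite mulrC EFinM -muleA lee_wpmul2l ?lee_fin//.
apply: le_trans; first exact: (bound _ _ _ _ _ efBA (tl_coefs B alpha c \o th) (fun i => sB0 (th i))).
rewrite lee_wpmul2l ?lee_fin//; apply: Lnorm_le => //; last 2 first.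
- exact: (measurable_lq_fun ef fe mBth (fun i => sB0 (th i))).
- exact: (measurable_lq_fun ef fe mB sB0).
by move=> x; rewrite (lq_fun_ge0 e)//=; exact: (lq_fun_comp_le th_inj).
Qed.

Lemma transfer_inf_inf : exists2 C0 : R, 0 <= C0 &
  (forall c, tl_norm B alpha +oo +oo (S c) <= C0%:E * tl_norm A alpha +oo +oo c)%E /\
  (forall s, tl_norm A alpha +oo +oo (T s) <= C0%:E * tl_norm B alpha +oo +oo s)%E.
Proof.
have D0 := coef_const_ge0.
exists D => //; split => c; apply: ge_ereal_sup => _ [i _ <-].
  have sup0 : (0 <= D%:E * tl_norm A alpha +oo +oo c)%E.
    rewrite mule_ge0 ?lee_fin//.
    apply: (@le_trans _ _ (tl_coefs A alpha c (0, 0))%:E); first by rewrite lee_fin tl_coefs_ge0.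
    by apply: ereal_sup_ubound; exists (0, 0).
  have [[jk _ <-]|off] := pselect (range th i); last first.
    by rewrite -/(tl_coefs B alpha (S c) i) coefs_S_off.
  apply: (@le_trans _ _ (D * tl_coefs A alpha c jk)%:E).
    by rewrite lee_fin -/(tl_coefs B alpha (S c) (th jk)) coefs_S_le.
  by rewrite EFinM lee_wpmul2l ?lee_fin//; apply: ereal_sup_ubound; exists jk.
apply: (@le_trans _ _ (D * tl_coefs B alpha c (th i))%:E).
  by rewrite lee_fin -/(tl_coefs A alpha (T c) i) coefs_T_le.
by rewrite EFinM lee_wpmul2l ?lee_fin//; apply: ereal_sup_ubound; exists (th i).
Qed.

(** Averages over cubes are compared one cube at a time.  A cube of B of scale l is seen from the
    frame A^l', with l' just above (l + 1) / eps: then floor (l' eps) > l, so the scales j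
    with floor (j eps) <= l are at most l', while floor (l' eps) - l stays bounded.  A cube of
    A of scale l is seen from the frame of B of scale floor (l eps).  In both cases the two
    frames are uniformly comparable. *)
Lemma transfer_inf_fin (r : R) : 0 < r -> exists2 C0 : R, 0 <= C0 &
  (forall c, tl_norm B alpha +oo r%:E (S c) <= C0%:E * tl_norm A alpha +oo r%:E c)%E /\
  (forall s, tl_norm A alpha +oo r%:E (T s) <= C0%:E * tl_norm B alpha +oo r%:E s)%E.
Proof.
move=> r0.
have [n0 [K0 [Wh [K00 efAB efBA]]]] :=
  matched_engulfing eA eB K_ge0 C_ge0 scaleAB scaleBA negA piC.
have eps1 : 1 < eps := eps_gt1 eA eB detBA.
have eps0 : 0 < eps by exact: lt_trans eps1.
have [K2 K20 powB] := powers_bounded B (Num.truncn (1 + eps)).+1.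
pose K' := K + (n%:R * (K * K) + n%:R * (K2 * K)).
have KK0 : 0 <= n%:R * (K * K) by rewrite !mulr_ge0.
have K2K0 : 0 <= n%:R * (K2 * K) by rewrite !mulr_ge0.
have KK' : K <= K' by rewrite lerDl addr_ge0.
have KKK' : n%:R * (K * K) <= K' by rewrite /K' addrCA lerDl addr_ge0.
have K2KK' : n%:R * (K2 * K) <= K' by rewrite /K' addrA lerDr addr_ge0.
have [C1 C10 change] := local_mass_change_frame uA ef fe K' n0 K00.
have D0 := coef_const_ge0.
have Dr0 : 0 <= D `^ r by exact: powR_ge0.
exists ((C1 * D `^ r) `^ r^-1); first exact: powR_ge0.
have scale_coef (x y : R) : 0 <= x -> 0 <= y -> x <= D * y -> x `^ r <= D `^ r * y `^ r.
  move=> x0 y0 xy; rewrite -powRM//; apply: ge0_ler_powR; rewrite ?nnegrE ?mulr_ge0//.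
  exact: ltW.
split => [c|s]; rewrite -poweR_bound ?mulr_ge0 ?tl_norm_inf_ge0//.
  set N := tl_norm A _ _ _ _; have N0 : (0 <= N)%E by exact: tl_norm_inf_ge0.
  apply: (tl_norm_inf_le uB ef fe r0) => [|l m]; first by rewrite mule_ge0 ?poweR_ge0// lee_fin mulr_ge0.
  pose l' := Num.floor ((l%:~R + 1) / eps) + 1.
  have fl : (Num.floor ((l%:~R + 1) / eps))%:~R <= (l%:~R + 1) / eps < l'%:~R.
    by rewrite /l'; exact: floor_itv.
  have lt_l : l%:~R + 1 < l'%:~R * eps.
    by rewrite -ltr_pdivrMr//; have /andP[] := fl.
  have le_l : l'%:~R * eps <= l%:~R + 1 + eps.
    by rewrite /l' intrD mulrDl mul1r lerD2r -ler_pdivlMr//; have /andP[] := fl.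
  have fsl' := floor_scale_itv A B l'; rewrite -/eps in fsl'.
  have l_lt : l < fs l'.
    have /andP[_ fl2] := fsl'; rewrite -(ltr_int R).
    by lra.
  have le_n0 : fs l' - l <= (Num.truncn (1 + eps)).+1%:Z.
    rewrite -(ler_int R) intrB; have /andP[fl1 _] := fsl'.
    have /ltW tr := truncnS_gt (1 + eps).
    by apply: le_trans tr; lra.
  have le_l' j : fs j <= l -> j <= l'.
    move=> fjl; rewrite leNgt; apply/negP => /ltW l'j.
    have : fs l' <= fs j by exact: floor_scale_mono eA eB detBA _ _ l'j.
    by move=> /le_trans /(_ fjl) /(lt_le_trans l_lt); rewrite ltxx.
  rewrite /scale_mass.
  rewrite (local_mass_comp_vanish mu th_inj); last first.
    by move=> i off; rewrite coefs_S_off// powR0 ?gt_eqF.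
  rewrite dilated_cubeE//.
  have lm1 : - fs l' + l <= 0 by rewrite addrC subr_le0 (ltW l_lt).
  rewrite EFinM -(muleA C1%:E).
  apply: (change _ _ _ efAB _ _ [set jk | jk.1 <= l'] (A ^ l') (B ^ l)).
  - by move=> i; exact: powR_ge0.
  - by rewrite mule_ge0 ?poweR_ge0// lee_fin.
  - exact: expz_unitmx.
  - exact: expz_unitmx.
  - apply: (le_entries KKK').
    rewrite (_ : _ *m _ = A ^ (- l') *m B ^ (fs l') *m B ^ (- fs l' + l)).
      by apply: entries_leM => //; exact: negB.
    by rewrite -mulmxA expz_mulmx// addrA subrr add0r invmx_expz.
  - apply: (le_entries K2KK').
    rewrite (_ : _ *m _ = B ^ (fs l' - l) *m (B ^ (- fs l') *m A ^ l')).
      by apply: entries_leM => //; apply: powB; rewrite le_n0 andbT subr_ge0 (ltW l_lt).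
    by rewrite mulmxA expz_mulmx// invmx_expz addrAC subrr add0r.
  - by move=> jk /=; exact: le_l'.
  - move=> jk /= jl'; apply: (le_entries KK').
    by rewrite invmx_expz expz_mulmx//; apply: negA; rewrite addrC subr_le0.
  - move=> v; rewrite -dilated_cubeE//.
    rewrite -muleA.
    apply: (@le_trans _ _ ((D `^ r)%:E * scale_mass A (tl_coefs A alpha c) r l' v)%E); last first.
      apply: lee_wpmul2l; first by rewrite lee_fin.
      exact: (scale_mass_le_norm alpha uA ef fe).
    apply: (local_mass_le_scale mu ef fe) => // jk; first exact: powR_ge0.
    by apply: scale_coef; rewrite ?tl_coefs_ge0//; exact: coefs_S_le.
set N := tl_norm B _ _ _ _; have N0 : (0 <= N)%E by exact: tl_norm_inf_ge0.
apply: (tl_norm_inf_le uA ef fe r0) => [|l m]; first by rewrite mule_ge0 ?poweR_ge0// lee_fin mulr_ge0.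
rewrite /scale_mass dilated_cubeE//.
rewrite EFinM -(muleA C1%:E).
apply: (change _ _ _ efBA _ _ [set jk | fs jk.1 <= fs l /\ jk.1 <= l] (B ^ fs l) (A ^ l)).
- by move=> i; exact: powR_ge0.
- by rewrite mule_ge0 ?poweR_ge0// lee_fin.
- exact: expz_unitmx.
- exact: expz_unitmx.
- by apply: (le_entries KK'); rewrite invmx_expz.
- by apply: (le_entries KK'); rewrite invmx_expz.
- by move=> jk /= jl; split => //; exact: (floor_scale_mono eA eB detBA).
- move=> jk /= [_ jl]; apply: (le_entries KKK').
  rewrite invmx_expz (_ : _ *m _ = B ^ (- fs l) *m A ^ l *m A ^ (- l + jk.1)).
    by apply: entries_leM => //; apply: negA; rewrite addrC subr_le0.
  by rewrite -mulmxA expz_mulmx// addrA subrr add0r.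
move=> v; rewrite -dilated_cubeE//.
rewrite -muleA.
    apply: (@le_trans _ _ ((D `^ r)%:E * scale_mass B (tl_coefs B alpha s) r (fs l) v)%E); last first.
      apply: lee_wpmul2l; first by rewrite lee_fin.
      exact: (scale_mass_le_norm alpha uB ef fe).
apply: le_trans.
  apply: (local_mass_le_scale mu ef fe (D := D `^ r) (a' := fun jk => tl_coefs B alpha s (th jk) `^ r)) => //.
    by move=> jk; exact: powR_ge0.
  by move=> jk; apply: scale_coef; rewrite ?tl_coefs_ge0//; exact: coefs_T_le.
apply: lee_wpmul2l; first by rewrite lee_fin.
rewrite /scale_mass.
apply: le_trans (local_mass_comp_le mu th_inj _ _ _ (fun i => powR_ge0 _ _)).
by apply: local_mass_subset => [jk|jk []//]; exact: powR_ge0.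
Qed.

Lemma transfer p q : (0 < p)%E -> (0 < q)%E -> exists2 C0 : R, 0 <= C0 &
  (forall c, tl_norm B alpha p q (S c) <= C0%:E * tl_norm A alpha p q c)%E /\
  (forall s, tl_norm A alpha p q (T s) <= C0%:E * tl_norm B alpha p q s)%E.
Proof.
case: p => [p||] // p0 q0; first exact: transfer_fin.
case: q q0 => [q||] // q0; [exact: transfer_inf_fin|exact: transfer_inf_inf].
Qed.

End transfer.

(** * The bounded embedding and its left inverse *)

Lemma bounded_operator_intro (R : realType) (d : nat) (NX NY : cseq R d -> \bar R)
    (F : cseq R d -> cseq R d) (C0 : R) :
  linear F -> 0 <= C0 -> (forall c, 0 <= NX c)%E ->
  (forall c, NY (F c) <= C0%:E * NX c)%E ->
  bounded_operator [set c | (NX c < +oo)%E] NX [set c | (NY c < +oo)%E] NY F.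
Proof.
move=> linF C00 NX0 bound; split=> // [c /= NXc|].
  by apply: le_lt_trans (bound c) _; rewrite lte_mul_pinfty ?lee_fin.
exists (C0 + 1) => [|c _]; first by rewrite ltr_wpDl.
by apply: le_trans (bound c) _; rewrite lee_wpmul2r// lee_fin lerDl.
Qed.

(** Since T (S c) = c, the bound on T yields both the lower bound on S and the surjectivity
    of T. *)
Theorem theorem5p9 (R : realType) (d : nat) (alpha : R) (p q : \bar R)
    (A B : 'M[R]_d.+1) :
  (0 < p)%E -> (0 < q)%E ->
  expansive A -> expansive B -> equivalent_mx A B ->
  `|\det B| < `|\det A| ->
  let eps : R := ln `|\det A| / ln `|\det B| in
  exists pi : int -> 'cV[int]_d.+1 -> 'cV[int]_d.+1,
    (forall j : int, injective (pi j)) /\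
    let S : cseq R d -> cseq R d := operator_S eps pi in
    let T : cseq R d -> cseq R d := operator_T eps pi in
    let fA := tl_space A alpha p q in
    let fB := tl_space B alpha p q in
    [/\ bounded_embedding fA (tl_norm A alpha p q) fB (tl_norm B alpha p q) S,
        bounded_operator fB (tl_norm B alpha p q) fA (tl_norm A alpha p q) T /\
        (forall c : cseq R d, fA c -> exists2 s : cseq R d, fB s & T s = c) &
        forall c : cseq R d, T (S c) = c].
Proof.
move=> p0 q0 eA eB AB detBA eps.
have [C [pi [pi_inj piC]]] := matched_lattices eA eB AB.
have fs_inj : injective (floor_scale eps) := floor_scale_inj eA eB detBA.
exists pi; split=> // S T fA fB.
have TS c : T (S c) = c := operator_TS fs_inj pi_inj c.
have [K1 scale] := matched_scale_bounded eA eB AB.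
have [K2 K20 negA] := negative_powers_bounded eA.
have [K3 K30 negB] := negative_powers_bounded eB.
have K10 : 0 <= K1 by apply: le_trans ((scale 0).1 ord0 ord0).
have C_ge0 : 0 <= C by apply: le_trans (piC 0 0 ord0 ord0).
have K_ge0 : 0 <= K1 + (K2 + K3) by rewrite !addr_ge0.
have le1 : K1 <= K1 + (K2 + K3) by rewrite lerDl addr_ge0.
have le2 : K2 <= K1 + (K2 + K3) by rewrite addrCA lerDl addr_ge0.
have le3 : K3 <= K1 + (K2 + K3) by rewrite addrA lerDr addr_ge0.
have [|e [f [ef fe]]] := @enumerate_countType (int * 'cV[int]_d.+1)%type (fun n : nat => (n%:Z, 0)).
  by move=> m n [].
have [C0 C00 [SC0 TC0]] : exists2 C0 : R, 0 <= C0 &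
    (forall c, tl_norm B alpha p q (S c) <= C0%:E * tl_norm A alpha p q c)%E /\
    (forall s, tl_norm A alpha p q (T s) <= C0%:E * tl_norm B alpha p q s)%E.
  apply: (@transfer R d A B alpha eA eB detBA pi pi_inj (K1 + (K2 + K3)) C K_ge0 C_ge0 _ _ _ _ piC e f ef fe p q p0 q0).
  - by move=> j; exact: (le_entries le1 (scale j).1).
  - by move=> j; exact: (le_entries le1 (scale j).2).
  - by move=> m /negA; exact: le_entries.
  - by move=> m /negB; exact: le_entries.
have NA0 c : (0 <= tl_norm A alpha p q c)%E by exact: tl_norm_ge0.
have NB0 c : (0 <= tl_norm B alpha p q c)%E by exact: tl_norm_ge0.
have bS : bounded_operator fA (tl_norm A alpha p q) fB (tl_norm B alpha p q) S.
  exact: bounded_operator_intro (@operator_S_linear _ _ _ _) C00 NA0 SC0.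
have bT : bounded_operator fB (tl_norm B alpha p q) fA (tl_norm A alpha p q) T.
  exact: bounded_operator_intro (@operator_T_linear _ _ _ _) C00 NB0 TC0.
split=> //; split=> //.
- have [_ _ [CT CT0 TCT]] := bT; exists CT => // c fAc.
  by rewrite -{1}(TS c); apply: TCT; have [_ SfB _] := bS; exact: SfB.
- by move=> c fAc; exists (S c) => //; have [_ SfB _] := bS; exact: SfB.
Qed.
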